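(* Let $\mathbf{x}_1,\dots,\mathbf{x}_n$ be i.i.d. $N_p(\mathbf{0},\boldsymbol{\Sigma})$ with $\boldsymbol{\Sigma}=(r^{|i-j|})_{1\le i,j\le p}$, $r=r_n\in[0,1)$, $p=p_n\to\infty$, and $\log p=o(n^{1/7})$. Suppose $r_n\to1$ and $1-r_n\ge C/\log p$ for all large $n$, for some constant $C>0$ not depending on $n$. Then, with $$c_n=\frac{\sqrt{2n\log p}}{1-r^2},\qquad d_n=\frac{r\sqrt{2n\log p}}{1-r^2}+2\log p-\tfrac12\big[\log\log p+\log(4\pi)\big],$$ $c_n\mathcal{L}_n-d_n$ converges weakly to the distribution with cdf $\exp(-e^{-x})$.
   Context: Write $\mathbf{x}_k=(x_{k1},\dots,x_{kp})^T$. For $1\le i<j\le p$ define $$\hat\rho_{i,j}=\frac{\sum_{k=1}^n x_{ki}x_{kj}}{\sqrt{\sum_{k=1}^n x_{ki}^2\sum_{k=1}^n x_{kj}^2}},\qquad \mathcal{L}_n=\max_{1\le i<j\le p}\hat\rho_{i,j}.$$ Limits are as $n\to\infty$. *)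

(* Defs.v *)
From HB Require Import structures.
From mathcomp Require Import all_boot all_order all_algebra.
From mathcomp Require Import all_classical all_reals all_analysis.
Set Implicit Arguments. Unset Strict Implicit. Unset Printing Implicit Defensive.
Import Order.TTheory GRing.Theory Num.Theory.
Import numFieldNormedType.Exports.
Local Open Scope classical_set_scope.
Local Open Scope ring_scope.

Section defs.
Context {R : realType} {d : measure_display} {T : measurableType d}.
Variable P : probability T R.

Definition Sigma_entry (r : R) (i j : nat) : R :=
  r ^+ (if (i <= j)%N then (j - i)%N else (i - j)%N).

Definition centered_normal_law (Y : T -> R) (v : R) : Prop :=
  (v = 0 -> P [set w | Y w = 0] = 1%E) /\
  (0 < v -> forall B : set R, measurable B ->
     P (Y @^-1` B) = normal_prob 0 (Num.sqrt v) B).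

(* x = (x 0, ..., x (p-1)) is a random vector with law N_p(0, Sigma),
   Sigma = (r^{|i-j|}): measurable coordinates and every linear combination
   a^T x is N(0, a^T Sigma a). *)
Definition is_Np_AR (p : nat) (r : R) (x : nat -> T -> R) : Prop :=
  (forall i, (i < p)%N -> measurable_fun setT (x i)) /\
  forall a : nat -> R,
    centered_normal_law (fun w => \sum_(i < p) a i * x i w)
      (\sum_(i < p) \sum_(j < p) a i * a j * Sigma_entry r i j).

(* Mutual independence of the random vectors x 0, ..., x (n-1), each with
   p real coordinates (product rule on measurable rectangles, which generate
   the product sigma-algebra). *)
Definition indep_vectors (n p : nat) (x : nat -> nat -> T -> R) : Prop :=
  forall B : nat -> nat -> set R, (forall k i, measurable (B k i)) ->
    P [set w | forall k, (k < n)%N -> forall i, (i < p)%N -> B k i (x k i w)]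
    = (\prod_(k < n) P [set w | forall i, (i < p)%N -> B k i (x k i w)])%E.

End defs.

Section stats.
Context {R : realType} {T : Type}.

Definition rho_hat (n : nat) (x : nat -> nat -> T -> R) (i j : nat) (w : T) : R :=
  (\sum_(k < n) x k i w * x k j w) /
  Num.sqrt ((\sum_(k < n) x k i w ^+ 2) * (\sum_(k < n) x k j w ^+ 2)).

(* L_n = max_{1 <= i < j <= p} hat rho_{i,j}  (0-based indices).  The seed
   rho_hat 0 1 of the iterated max is itself one of the maximised terms when
   p >= 2, so this is exactly the maximum whenever p >= 2. *)
Definition Lmax (n p : nat) (x : nat -> nat -> T -> R) (w : T) : R :=
  \big[Num.max/rho_hat n x 0 1 w]_(ij : 'I_p * 'I_p | (ij.1 < ij.2)%N)
     rho_hat n x ij.1 ij.2 w.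

End stats.

Definition c_seq {R : realType} (n p : nat) (r : R) : R :=
  Num.sqrt (2 * n%:R * ln (p%:R)) / (1 - r ^+ 2).

Definition d_seq {R : realType} (n p : nat) (r : R) : R :=
  r * Num.sqrt (2 * n%:R * ln (p%:R)) / (1 - r ^+ 2) + 2 * ln (p%:R)
  - 2^-1 * (ln (ln (p%:R)) + ln (4 * pi)).

(* Main.v *)
Require Import Defs.
From HB Require Import structures.
From mathcomp Require Import all_boot all_order all_algebra.
From mathcomp Require Import all_classical all_reals all_analysis.
From mathcomp Require Import measurable_realfun real_interval.
From mathcomp Require Import ring lra.
Set Implicit Arguments. Unset Strict Implicit. Unset Printing Implicit Defensive.
Import Order.TTheory GRing.Theory Num.Theory.
Import numFieldNormedType.Exports.
Local Open Scope classical_set_scope.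
Local Open Scope ring_scope.

(** Conditionally on column [i], column [i+1] is [r x_i + sqrt(1 - r^2) e] with
    [e] a fresh standard Gaussian vector, so the columns form a stationary
    reversible Markov chain with the Ornstein-Uhlenbeck kernel [P], and
    [c_n L_n - d_n <= x] says that no pair of columns is in the set [D] of pairs
    with correlation above a threshold [tau].  Pairs at distance at least two are
    negligible, because their correlation is at most [r^2] and [tau >= r].
    Let [f] be the conditional probability of a hit in one step and [b] its mean.
    The probability [w_j] of no hit in [j] steps obeys, by reversibility and
    symmetry of [D], [w_(j+1) = w_j - <f, W_j>], and [<f, W_j>] is close to
    [b w_j]: going back [H] steps costs at most [2 H |f|_2^2], after which [P^H]
    contracts the centred part by [r^H].  Here [H] is of order [(log p)^2], since
    [1 - r >= C / log p], and [|f|_2^2] is smaller than [1 / p] by a power of [p]: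
    a hit from [x] has small conditional probability unless [|x|] is unusually
    large.  Hence [w_(p-1)] is asymptotic to [(1 - b)^(p-1)], and a half-angle
    rotation of the pair reduces [b] to the Gaussian tail
    [P(Z > sqrt n (tau - r) / (1 - r^2))], for which [p b -> exp(-x)].

    The [L^2] contraction by [r] comes from
    [cov (f, P_t f)^2 <= var f * cov (f, P_(t^2) f)] and
    [cov (f, P_t f) = O(t)] as [t -> 0], iterated along [t = r^(2^k)]. *)

(** * The standard Gaussian measure *)

(** The obstacle is that [r] tends to 1: hits at neighbouring positions might cluster, and all
    bounds must be uniform as [1 - r^2] vanishes. Writing [tau = r + (1 - r^2) v] makes this factor
    divide out of the inequalities for adjacent columns; what remains is [v], close to [sqrt 2 eps]
    with [eps = sqrt (log p / n)]. After the rotation the difference of the two squared norms enters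
    only through its square. Norm fluctuations of relative size [eps] then shift [v] by [O(eps^2)];
    times [sqrt n] and the level [sqrt (2 log p)] this is of order [eps log p], which tends to 0.
    Clustering is excluded by a numerical gap. For small [1 - r^2], a sizeable hit probability from
    [x] requires [|x|^2] to exceed [n] by about [2 sqrt 2 eps n], while an excess of [2 eps n]
    already has probability about [1 / p]. The cut at [11/5 eps n] lies strictly between, which
    gains a power of [p] on either side of it. Laws are compared through [E cos (a Y + t)]; the
    phase [t] carries the sine part, so no complex numbers occur. *)

Section gauss.
Context {R : realType}.
Local Notation lb := (@lebesgue_measure R).
Local Notation N01 := (normal_prob (0:R) 1).

(** The pushforward of Lebesgue measure under [m + s x], scaled by [s], gives half-open intervals
    their length, hence is Lebesgue measure; the formula is the change of variables for a
    pushforward. *)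
Lemma ge0_integral_affine (m s : R) (f : R -> \bar R) : 0 < s ->
  measurable_fun setT f -> (forall x, (0 <= f x)%E) ->
  (\int[lb]_x f x = s%:E * \int[lb]_x f (m + s * x)%R)%E.
Proof.
move=> s0 mf f0.
pose phi := (fun x : R => m + s * x) : measurableTypeR R -> measurableTypeR R.
have mphi : measurable_fun setT phi.
  by apply: measurable_funD => //; exact: measurable_funM.
have sE : `|s| = s by rewrite ger0_norm// ltW.
pose mu'_ : {measure set (measurableTypeR R) -> \bar R} :=
  mscale (NngNum (normr_ge0 s)) (pushforward lb phi).
pose mu' := mu'_ mphi.
have E A : measurable A -> lb A = mu' A.
  apply: lebesgue_measure_unique => _ [[a b]] _ <-.
  have -> : mu' `]a, b]%classic = (s%:E * lb (phi @^-1` `]a, b]%classic))%E.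
    by rewrite -[in RHS]sE.
  have -> : phi @^-1` `]a, b]%classic = `](a - m) / s, (b - m) / s]%classic.
    apply/seteqP; split => x /=; rewrite !in_itv/=;
      by rewrite ltr_pdivrMr// ler_pdivlMr// ltrBlDl lerBrDl mulrC.
  rewrite !lebesgue_measure_itv/= !lte_fin.
  rewrite ltr_pM2r ?invr_gt0// ltrD2r.
  case: ifP => ab; last by rewrite mule0.
  by rewrite -EFinD -EFinM -mulrBl mulrC divfK ?gt_eqF//; congr EFin; ring.
transitivity (\int[mu']_x f x)%E.
  by apply: eq_measure_integral => A mA _; exact: E.
rewrite ge0_integral_mscale//= sE; congr (_ * _)%E.
by rewrite ge0_integral_pushforward//.
Qed.

(** The Radon-Nikodym derivative of the normal law and its density have the same integral over every
    measurable set, so they agree almost everywhere. *)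
Lemma ge0_integral_normal_prob (m s : R) (f : R -> \bar R) :
  measurable_fun setT f -> (forall x, (0 <= f x)%E) ->
  (\int[normal_prob m s]_x f x = \int[lb]_x (f x * (normal_pdf m s x)%:E))%E.
Proof.
move=> mf f0.
have dom := @normal_prob_dominates R m s.
rewrite -(Radon_Nikodym_SigmaFinite.change_of_variables dom)//.
apply: ae_eq_integral => //.
- apply: emeasurable_funM => //; apply: (measurable_int lb).
  exact: Radon_Nikodym_SigmaFinite.f_integrable.
- apply: emeasurable_funM => //=; apply/measurableT_comp => //=.
  exact: measurable_normal_pdf.
- apply: ae_eqe_mul2l => /=.
  apply: integral_ae_eq => //=.
  + exact: Radon_Nikodym_SigmaFinite.f_integrable.
  + apply/measurableT_comp => //=; exact: measurable_normal_pdf.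
  + by move=> E E01 mE; rewrite -Radon_Nikodym_SigmaFinite.f_integral.
Qed.

Lemma normal_pdf_affine (m s x : R) : 0 < s ->
  s * normal_pdf m s (m + s * x) = normal_pdf 0 1 x.
Proof.
move=> s0; rewrite !normal_pdfE ?gt_eqF//=.
rewrite /normal_peak /normal_fun.
rewrite expr1n mul1r subr0 mulrA.
have -> : m + s * x - m = s * x by ring.
congr (_ * _).
  rewrite -mulrnAr sqrtrM ?sqr_ge0// sqrtr_sqr ger0_norm ?(ltW s0)//.
  by rewrite invfM mulrA mulfV ?gt_eqF// mul1r.
congr expR; rewrite !mulr2n.
have -> : s ^+ 2 + s ^+ 2 = s ^+ 2 * 2 by ring.
by field; rewrite gt_eqF.
Qed.

Lemma ge0_integral_normal_affine (m s : R) (f : R -> \bar R) : 0 < s ->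
  measurable_fun setT f -> (forall x, (0 <= f x)%E) ->
  (\int[normal_prob m s]_x f x = \int[N01]_x f (m + s * x)%R)%E.
Proof.
move=> s0 mf f0.
have mp u v : measurable_fun setT (fun x : R => (normal_pdf u v x)%:E).
  by apply/measurableT_comp => //; exact: measurable_normal_pdf.
rewrite ge0_integral_normal_prob// (ge0_integral_affine m s0); last 2 first.
- exact: emeasurable_funM.
- by move=> x; rewrite mule_ge0// lee_fin normal_pdf_ge0.
rewrite ge0_integral_normal_prob//; last first.
  apply: measurableT_comp => //.
  by apply: measurable_funD => //; exact: measurable_funM.
have ma : measurable_fun setT (fun x : R => m + s * x : R).
  by apply: measurable_funD => //; exact: measurable_funM.
rewrite -ge0_integralZl//; last 3 first.
- apply: emeasurable_funM; first exact: (measurableT_comp mf ma).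
  exact: (measurableT_comp (mp m s) ma).
- by move=> x _; rewrite mule_ge0// lee_fin normal_pdf_ge0.
- by rewrite lee_fin ltW.
apply: eq_integral => x _.
by rewrite -(normal_pdf_affine m x s0) EFinM muleCA muleA.
Qed.

Lemma normal_prob_affine (m s : R) (A : set R) : 0 < s -> measurable A ->
  normal_prob m s A = N01 ((fun x => m + s * x) @^-1` A).
Proof.
move=> s0 mA.
have ma : measurable_fun setT (fun x : R => m + s * x : R).
  by apply: measurable_funD => //; exact: measurable_funM.
have mA' : measurable ((fun x : R => m + s * x) @^-1` A).
  by rewrite -[X in measurable X]setTI; exact: ma.
have mi : measurable_fun [set: R] (fun x : R => (\1_A x)%:E : \bar R).
  by apply/measurable_EFinP; exact: measurable_indic.
have i0 (x : R) : (0 <= (\1_A x)%:E :> \bar R)%E by rewrite lee_fin.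
have := ge0_integral_normal_affine m s0 mi i0.
rewrite (integral_indic (normal_prob m s) measurableT mA) setIT => ->.
by rewrite -(setIT (_ @^-1` A)) -integral_indic.
Qed.

End gauss.

(* [normal_prob] lives on the Borel space [measurableTypeR R]; [stdN] is the
   same measure on [R] with its canonical measurable structure. *)
Definition of_borel {R : realType} (x : measurableTypeR R) : R := x.

Lemma measurable_of_borel {R : realType} : measurable_fun setT (@of_borel R).
Proof. by move=> _ Y mY; rewrite setTI. Qed.

HB.instance Definition _ {R : realType} :=
  isMeasurableFun.Build _ _ _ _ (@of_borel R) measurable_of_borel.

Definition stdN {R : realType} : probability R R :=
  distribution (normal_prob (0:R) 1) (@of_borel R).

Section stdN_theory.
Context {R : realType}.
Local Notation lb := (@lebesgue_measure R).
Local Notation phi := (normal_pdf (0:R) 1).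

Lemma ge0_integral_stdN (f : R -> \bar R) : measurable_fun setT f ->
  (forall x, (0 <= f x)%E) ->
  (\int[stdN]_x f x = \int[lb]_x (f x * (phi x)%:E))%E.
Proof.
move=> mf f0; rewrite ge0_integral_distribution//.
by rewrite -ge0_integral_normal_prob.
Qed.

Lemma normal_prob_stdN (m s : R) (A : set R) : 0 < s -> measurable A ->
  normal_prob m s A = stdN ((fun x => m + s * x) @^-1` A).
Proof. exact: normal_prob_affine. Qed.

End stdN_theory.

(** * Expectations of bounded measurable functions *)

(** This class is closed under products, sums and partial means, and integrable for every
    probability, so side conditions of integration reduce to closure lemmas. *)
Definition bmf {R : realType} d (T : measurableType d) (f : T -> R) :=
  measurable_fun setT f /\ exists M : R, forall x, `|f x| <= M.

Definition Ex {R : realType} d (T : measurableType d)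
  (P : {measure set T -> \bar R}) (f : T -> R) : R := Rintegral P setT f.

Section bmf_theory.
Context {R : realType} d (T : measurableType d).
Implicit Types f g : T -> R.

Lemma bmf_cst (c : R) : bmf (fun _ : T => c).
Proof. by split => //; exists `|c|. Qed.

Lemma bmfD f g : bmf f -> bmf g -> bmf (fun x => f x + g x).
Proof.
move=> [mf [M fM]] [mg [N gN]]; split; first exact: measurable_funD.
by exists (M + N) => x; rewrite (le_trans (ler_normD _ _))// lerD.
Qed.

Lemma bmfM f g : bmf f -> bmf g -> bmf (fun x => f x * g x).
Proof.
move=> [mf [M fM]] [mg [N gN]]; split; first exact: measurable_funM.
by exists (M * N) => x; rewrite normrM ler_pM.
Qed.

Lemma bmfZ (c : R) f : bmf f -> bmf (fun x => c * f x).
Proof. by move=> bf; apply: bmfM => //; exact: bmf_cst. Qed.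

Lemma bmfN f : bmf f -> bmf (fun x => - f x).
Proof.
move=> [mf [M fM]]; split; first exact: measurableT_comp.
by exists M => x; rewrite normrN.
Qed.

Lemma bmfB f g : bmf f -> bmf g -> bmf (fun x => f x - g x).
Proof. by move=> bf bg; apply: bmfD => //; exact: bmfN. Qed.

Lemma bmfX f n : bmf f -> bmf (fun x => f x ^+ n).
Proof.
move=> [mf [M fM]]; split; first exact: measurable_funX.
exists (M ^+ n) => x; rewrite normrX lerXn2r// ?nnegrE//.
by rewrite (le_trans _ (fM x)).
Qed.

Lemma bmf_norm f : bmf f -> bmf (fun x => `|f x|).
Proof.
move=> [mf [M fM]]; split; first exact: measurableT_comp.
by exists M => x; rewrite normr_id.
Qed.

Lemma bmf_indic (A : set T) : measurable A -> bmf (\1_A : T -> R).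
Proof.
move=> mA; split; first exact: measurable_indic.
by exists 1 => x; rewrite indicE; case: (_ \in _); rewrite ?normr1 ?normr0.
Qed.

Lemma bmf_sum (I : Type) (r : seq I) (F : I -> T -> R) :
  (forall i, bmf (F i)) -> bmf (fun x => \sum_(i <- r) F i x).
Proof.
move=> bF; elim: r => [|i r IH].
  by under eq_fun do rewrite big_nil; exact: bmf_cst.
by under eq_fun do rewrite big_cons; exact: bmfD.
Qed.

Lemma bmf_prod (I : Type) (r : seq I) (F : I -> T -> R) :
  (forall i, bmf (F i)) -> bmf (fun x => \prod_(i <- r) F i x).
Proof.
move=> bF; elim: r => [|i r IH].
  by under eq_fun do rewrite big_nil; exact: bmf_cst.
by under eq_fun do rewrite big_cons; exact: bmfM.
Qed.

Lemma bmf_cos f : measurable_fun setT f -> bmf (fun x => cos (f x)).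
Proof.
move=> mf; split; last by exists 1 => x; rewrite ler_norml cos_geN1 cos_le1.
apply: (measurableT_comp _ mf); apply: continuous_measurable_fun.
exact: continuous_cos.
Qed.

Lemma bmf_comp d' (S : measurableType d') (h : T -> S) (f : S -> R) :
  bmf f -> measurable_fun setT h -> bmf (fun x => f (h x)).
Proof.
by move=> [mf [M fM]] mh; split; [exact: measurableT_comp|exists M].
Qed.

End bmf_theory.

Section Ex_theory.
Context {R : realType} d (T : measurableType d) (P : probability T R).
Implicit Types f g : T -> R.

Lemma bmf_integrable f : bmf f -> P.-integrable setT (EFin \o f).
Proof.
move=> [mf [M fM]]; apply: measurable_bounded_integrable => //.
  by rewrite (le_lt_trans (probability_le1 _ _))// ltry.
exists M; split; first exact: num_real.
by move=> x Mx y _ /=; rewrite (le_trans (fM y))// ltW.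
Qed.

Lemma ExE f : bmf f -> (Ex P f)%:E = (\int[P]_x (f x)%:E)%E.
Proof. by move=> bf; rewrite fineK//; apply: integrable_fin_num => //; exact: bmf_integrable. Qed.

Lemma Ex_cst (c : R) : Ex P (fun _ => c) = c.
Proof. by rewrite /Ex Rintegral_cst//= probability_setT mulr1. Qed.

Lemma ExD f g : bmf f -> bmf g -> Ex P (fun x => f x + g x) = Ex P f + Ex P g.
Proof. by move=> bf bg; rewrite /Ex RintegralD//; exact: bmf_integrable. Qed.

Lemma ExB f g : bmf f -> bmf g -> Ex P (fun x => f x - g x) = Ex P f - Ex P g.
Proof. by move=> bf bg; rewrite /Ex RintegralB//; exact: bmf_integrable. Qed.

Lemma ExZ (c : R) f : bmf f -> Ex P (fun x => c * f x) = c * Ex P f.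
Proof. by move=> bf; rewrite /Ex RintegralZl//; exact: bmf_integrable. Qed.

Lemma eq_Ex f g : f =1 g -> Ex P f = Ex P g.
Proof. by move=> fg; apply: eq_Rintegral => x _; exact: fg. Qed.

Lemma Ex_le f g : bmf f -> bmf g -> (forall x, f x <= g x) -> Ex P f <= Ex P g.
Proof. by move=> bf bg fg; apply: le_Rintegral => //; exact: bmf_integrable. Qed.

Lemma Ex_ge0 f : (forall x, 0 <= f x) -> 0 <= Ex P f.
Proof. by move=> f0; exact: Rintegral_ge0. Qed.

Lemma Ex_norm f : bmf f -> `|Ex P f| <= Ex P (fun x => `|f x|).
Proof. by move=> bf; apply: le_normr_Rintegral => //; exact: bmf_integrable. Qed.

Lemma Ex_indic (A : set T) : measurable A -> Ex P (\1_A) = fine (P A).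
Proof. by move=> mA; rewrite /Ex /Rintegral integral_indic// setIT. Qed.

Lemma Ex_sum (I : Type) (r : seq I) (F : I -> T -> R) :
  (forall i, bmf (F i)) ->
  Ex P (fun x => \sum_(i <- r) F i x) = \sum_(i <- r) Ex P (F i).
Proof.
move=> bF; elim: r => [|i r IH].
  rewrite big_nil -[RHS](Ex_cst 0); apply: eq_Ex => x.
  by rewrite big_nil.
rewrite big_cons -IH -ExD//; last exact: bmf_sum.
by apply: eq_Ex => x; rewrite big_cons.
Qed.

Lemma Ex_cvg (f_ : nat -> T -> R) (f : T -> R) (M : R) :
  (forall n, measurable_fun setT (f_ n)) -> measurable_fun setT f ->
  (forall n x, `|f_ n x| <= M) ->
  (forall x, f_ ^~ x @ \oo --> f x) ->
  (fun n => Ex P (f_ n)) @ \oo --> Ex P f.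
Proof.
move=> mf_ mf fM cf.
have [|||||_ _] := @dominated_convergence _ _ _ P setT measurableT
   (fun n x => (f_ n x)%:E) (EFin \o f) (cst M%:E).
- by move=> n; apply/measurable_EFinP.
- exact/measurable_EFinP.
- by apply: aeW => x _; apply: cvg_EFin; [exact: nearW|exact: cf].
- exact: (bmf_integrable (@bmf_cst R _ T M)).
- by apply: aeW => x n _ /=; rewrite lee_fin fM.
have bf : bmf f.
  split=> //; exists M => x.
  have e : (fun n => `|f_ n x|) @ \oo --> `|f x| by apply: cvg_norm; exact: cf.
  rewrite -(cvg_lim _ e)//.
  by apply: limr_le; [apply/cvg_ex; exists `|f x| | exact: nearW].
have bfn n : bmf (f_ n) by split => //; exists M.
rewrite -ExE// => h; apply/(@fine_cvg R _ _ _ (EFin \o (fun n => Ex P (f_ n)))).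
by apply: cvg_trans h; apply: near_eq_cvg; apply: nearW => n /=; rewrite ExE.
Qed.

(** The quadratic form [E (s f + t g)^2] is nonnegative; its value at [(c, - b)] is [c (a c - b^2)].
    If [c = 0] the form is affine in [t], and a nonzero [b] would allow the value -1. *)
Lemma Ex_CS f g : bmf f -> bmf g ->
  (Ex P (fun x => f x * g x)) ^+ 2 <=
    Ex P (fun x => f x ^+ 2) * Ex P (fun x => g x ^+ 2).
Proof.
move=> bf bg.
set a := Ex P (fun x => f x ^+ 2); set b := Ex P (fun x => f x * g x).
set c := Ex P (fun x => g x ^+ 2).
have bf2 := bmfX 2 bf; have bg2 := bmfX 2 bg; have bfg := bmfM bf bg.
have H (s t : R) : 0 <= s ^+ 2 * a + 2 * s * t * b + t ^+ 2 * c.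
  have -> : s ^+ 2 * a + 2 * s * t * b + t ^+ 2 * c =
     Ex P (fun x => (s * f x + t * g x) ^+ 2).
    have b1 := bmfZ (s ^+ 2) bf2; have b2 := bmfZ (2 * s * t) bfg.
    have b3 := bmfZ (t ^+ 2) bg2; have b12 := bmfD b1 b2.
    rewrite -!ExZ// -!ExD//.
    by apply: eq_Ex => x; ring.
  by apply: Ex_ge0 => x; exact: sqr_ge0.
have a0 : 0 <= a by apply: Ex_ge0 => x; exact: sqr_ge0.
have c0 : 0 <= c by apply: Ex_ge0 => x; exact: sqr_ge0.
have [c00|cn0] := eqVneq c 0.
  have [->|b0] := eqVneq b 0; first by rewrite expr0n/= mulr_ge0.
  have := H 1 (- (a + 1) / (2 * b)); rewrite c00.
  have -> : 1 ^+ 2 * a + 2 * 1 * (- (a + 1) / (2 * b)) * b +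
    (- (a + 1) / (2 * b)) ^+ 2 * 0 = -1 by field.
  by rewrite lerNr oppr0 ler10.
have cp : 0 < c by rewrite lt_def cn0.
have := H c (- b).
have -> : c ^+ 2 * a + 2 * c * - b * b + (- b) ^+ 2 * c = c * (a * c - b ^+ 2).
  by ring.
by rewrite pmulr_rge0// subr_ge0.
Qed.

End Ex_theory.

Lemma Ex_distribution {R : realType} d d' (T : measurableType d)
  (S : measurableType d') (P : probability T R) (X : {mfun T >-> S})
  (f : S -> R) : bmf f -> Ex (distribution P X) f = Ex P (fun x => f (X x)).
Proof.
move=> bf; rewrite /Ex /Rintegral integral_distribution//.
  by apply/measurable_EFinP; exact: bf.1.
by apply: (@bmf_integrable _ _ _ P (f \o X)); exact: bmf_comp.
Qed.

(** * Fubini for bounded functions on a product of probabilities *)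

Section fubini.
Context {R : realType} d d' (T : measurableType d) (S : measurableType d').
Variables (P : probability T R) (Q : probability S R) (f : T * S -> R).
Hypothesis bf : bmf f.

Let bf1 x : bmf (fun y => f (x, y)).
Proof. by apply: (bmf_comp bf); exact: pair1_measurable. Qed.

Let bf2 y : bmf (fun x => f (x, y)).
Proof. by apply: (bmf_comp bf); exact: pair2_measurable. Qed.

Lemma bmf_Ex1 : bmf (fun x => Ex Q (fun y => f (x, y))).
Proof.
have bfi : (P \x Q)%E.-integrable setT (EFin \o f) by exact: bmf_integrable.
split.
  apply/measurable_EFinP; rewrite (_ : _ \o _ = fubini_F Q (EFin \o f)).
    exact: measurable_fubini_F bfi.
  by apply/funext => x /=; rewrite ExE.
have [M fM] := bf.2; exists M => x.
rewrite (le_trans (Ex_norm _ _))// -[leRHS](Ex_cst Q M) Ex_le//.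
  exact: bmf_norm.
exact: bmf_cst.
Qed.

Lemma bmf_Ex2 : bmf (fun y => Ex P (fun x => f (x, y))).
Proof.
have bfi : (P \x Q)%E.-integrable setT (EFin \o f) by exact: bmf_integrable.
split.
  apply/measurable_EFinP; rewrite (_ : _ \o _ = fubini_G P (EFin \o f)).
    exact: measurable_fubini_G bfi.
  by apply/funext => y /=; rewrite ExE.
have [M fM] := bf.2; exists M => x.
rewrite (le_trans (Ex_norm _ _))// -[leRHS](Ex_cst P M) Ex_le//.
  exact: bmf_norm.
exact: bmf_cst.
Qed.

Lemma Ex_prod1 :
  Ex (P \x Q)%E f = Ex P (fun x => Ex Q (fun y => f (x, y))).
Proof.
have bfi : (P \x Q)%E.-integrable setT (EFin \o f) by exact: bmf_integrable.
have := integral12_prod_meas1 bfi; rewrite /fubini_F /=.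
under eq_integral do rewrite -ExE//.
rewrite -(ExE P bmf_Ex1) => e; apply: EFin_inj.
by rewrite e (ExE (P \x Q)%E bf).
Qed.

Lemma Ex_prod2 :
  Ex (P \x Q)%E f = Ex Q (fun y => Ex P (fun x => f (x, y))).
Proof.
have bfi : (P \x Q)%E.-integrable setT (EFin \o f) by exact: bmf_integrable.
have := integral21_prod_meas1 bfi; rewrite /fubini_G /=.
under eq_integral do rewrite -ExE//.
rewrite -(ExE Q bmf_Ex2) => e; apply: EFin_inj.
by rewrite e (ExE (P \x Q)%E bf).
Qed.

Lemma Ex_swap : Ex P (fun x => Ex Q (fun y => f (x, y))) =
  Ex Q (fun y => Ex P (fun x => f (x, y))).
Proof. by rewrite -Ex_prod1 Ex_prod2. Qed.

End fubini.

(** * Exponential moments and the cosine transform of the standard normal law *)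

Section stdN_moments.
Context {R : realType}.
Local Notation lb := (@lebesgue_measure R).
Local Notation phi := (normal_pdf (0:R) 1).

Lemma normal_pdf01E (x : R) :
  phi x = (Num.sqrt (2 * pi))^-1 * expR (- x ^+ 2 / 2).
Proof.
rewrite normal_pdfE ?oner_neq0//= /normal_peak /normal_fun subr0 expr1n mul1r.
by rewrite !mulr2n -mulr2n -mulr_natl.
Qed.

(** The substitution [x = c z] with [c = (1 - 2 s)^(-1/2)] turns [exp (s x^2)] times the density
    into the density of [z], up to the factor [c]. *)
Lemma ge0_expR_sqr_stdN (s : R) : s < 1 / 2 ->
  (\int[stdN]_x (expR (s * x ^+ 2))%:E = ((Num.sqrt (1 - 2 * s))^-1)%:E)%E.
Proof.
move=> s2; have c0 : 0 < 1 - 2 * s by lra.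
set c := (Num.sqrt (1 - 2 * s))^-1.
have cp : 0 < c by rewrite invr_gt0 sqrtr_gt0.
have c2 : c ^+ 2 = (1 - 2 * s)^-1 by rewrite exprVn sqr_sqrtr// ltW.
have ms : measurable_fun setT (fun x : R => expR (s * x ^+ 2)).
  by apply: measurableT_comp => //; exact: measurable_funM.
have mp : measurable_fun setT (fun x : R => (phi x)%:E).
  by apply/measurable_EFinP; exact: measurable_normal_pdf.
rewrite ge0_integral_stdN; [|exact/measurable_EFinP|]; last first.
  by move=> x; rewrite lee_fin expR_ge0.
rewrite (ge0_integral_affine 0 cp); last 2 first.
- by apply: emeasurable_funM => //; exact/measurable_EFinP.
- by move=> x; rewrite mule_ge0 ?lee_fin ?expR_ge0 ?normal_pdf_ge0.
rewrite [X in (_ * X)%E](_ : _ = \int[lb]_x (phi x)%:E)%E; last first.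
  apply: eq_integral => x _; rewrite -EFinM; congr EFin.
  rewrite !normal_pdf01E mulrCA -expRD; congr (_ * expR _).
  rewrite add0r !exprMn c2; field; lra.
by rewrite integral_normal_pdf mule1.
Qed.

(** Integrability comes from [1 + y^2 <= 4 exp (y^2 / 4)], whose right-hand side has a finite mean
    by [ge0_expR_sqr_stdN]. *)
Lemma stdN_integrable_sqr (C : R) :
  stdN.-integrable setT (fun y : R => (C * (1 + y ^+ 2))%:E).
Proof.
have m2 : measurable_fun setT (fun y : R => C * (1 + y ^+ 2)).
  by apply: measurable_funM => //; apply: measurable_funD => //.
have me : measurable_fun setT (fun x : R => expR (1 / 4 * x ^+ 2)).
  by apply: measurableT_comp => //; exact: measurable_funM.
apply/integrableP; split; first exact/measurable_EFinP.
apply: (@le_lt_trans _ _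
    (\int[stdN]_x ((`|C| * 4)%:E * (expR (1 / 4 * x ^+ 2))%:E))%E).
  apply: ge0_le_integral => //.
  - by apply/measurable_EFinP; exact: measurableT_comp.
  - by apply: emeasurable_funM => //; exact/measurable_EFinP.
  move=> x _; rewrite abse_EFin -EFinM lee_fin normrM -[leRHS]mulrA ler_wpM2l//.
  have x2 := sqr_ge0 x.
  rewrite ger0_norm; last by lra.
  have := expR_ge1Dx (1 / 4 * x ^+ 2); lra.
rewrite ge0_integralZl//; last by apply/measurable_EFinP.
by rewrite ge0_expR_sqr_stdN; [rewrite -EFinM ltry|lra].
Qed.

Lemma stdN_integrable (f : R -> R) (C : R) : measurable_fun setT f ->
  (forall y, `|f y| <= C * (1 + y ^+ 2)) ->
  stdN.-integrable setT (EFin \o f).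
Proof.
move=> mf fC; apply: le_integrable (stdN_integrable_sqr C) => //.
  exact/measurable_EFinP.
by move=> x _; rewrite /= lee_fin (le_trans (fC x))// ler_norm.
Qed.

Lemma integral_stdN (f : R -> R) : measurable_fun setT f ->
  (\int[stdN]_x (f x)%:E = \int[lb]_x (f x * phi x)%:E)%E.
Proof.
move=> mf; rewrite integralE [RHS]integralE.
have me : measurable_fun setT (fun x => (f x)%:E) by exact/measurable_EFinP.
have H (g : R -> \bar R) (h : R -> \bar R) : measurable_fun setT g ->
   (forall x, 0 <= g x)%E -> (forall x, g x * (phi x)%:E = h x)%E ->
   (\int[stdN]_x g x = \int[lb]_x h x)%E.
  move=> mg g0 gh; rewrite ge0_integral_stdN//.
  by apply: eq_integral => x _.
congr (_ - _)%E; apply: H => //.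
- exact: measurable_funepos.
- move=> x; rewrite !funeposE -!EFin_max -EFinM; congr EFin.
  by rewrite maxr_pMl ?normal_pdf_ge0// mul0r.
- exact: measurable_funeneg.
- move=> x; rewrite !funenegE -!EFinN -!EFin_max -EFinM; congr EFin.
  by rewrite maxr_pMl ?normal_pdf_ge0// mul0r mulNr.
Qed.

Lemma lb_integrable (f : R -> R) (C : R) : measurable_fun setT f ->
  (forall y, `|f y| <= C * (1 + y ^+ 2)) ->
  lb.-integrable setT (fun x => (f x * phi x)%:E).
Proof.
move=> mf fC; have /integrableP[_ fi] := stdN_integrable mf fC.
have mp := @measurable_normal_pdf R 0 1.
apply/integrableP; split.
  by apply/measurable_EFinP; apply: measurable_funM.
move: fi; rewrite ge0_integral_stdN//; last first.
  by apply/measurable_EFinP; exact: measurableT_comp.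
congr (_ < _)%E; apply: eq_integral => x _ /=.
by rewrite -EFinM normrM (ger0_norm (normal_pdf_ge0 _ _ _)).
Qed.

Lemma is_derive_phi (x : R) : is_derive x 1 phi (- x * phi x).
Proof.
have -> : phi = fun x => (Num.sqrt (2 * pi))^-1 * expR (- x ^+ 2 / 2).
  by apply/funext => y; exact: normal_pdf01E.
apply: is_derive_eq; rewrite /GRing.scale/=; field.
by rewrite gt_eqF// sqrtr_gt0 mulr_gt0// pi_gt0.
Qed.

Lemma measurable_sin_affine (a t : R) :
  measurable_fun setT (fun y : R => sin (a * y + t)).
Proof.
apply: measurableT_comp.
  by apply: continuous_measurable_fun; exact: continuous_sin.
by apply: measurable_funD => //; exact: measurable_funM.
Qed.

Lemma measurable_cos_affine (a t : R) :
  measurable_fun setT (fun y : R => cos (a * y + t)).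
Proof.
apply: measurableT_comp.
  by apply: continuous_measurable_fun; exact: continuous_cos.
by apply: measurable_funD => //; exact: measurable_funM.
Qed.

Let g (a t y : R) := y * sin (a * y + t) - a * cos (a * y + t).

Let mg a t : measurable_fun setT (g a t).
Proof.
apply: measurable_funB; apply: measurable_funM => //.
- exact: measurable_sin_affine.
- exact: measurable_cos_affine.
Qed.

Let g_le a t y : `|g a t y| <= (1 + `|a|) * (1 + y ^+ 2).
Proof.
rewrite /g (le_trans (ler_normB _ _))// !normrM.
have s1 : `|sin (a * y + t)| <= 1 by rewrite ler_norml sin_geN1 sin_le1.
have c1 : `|cos (a * y + t)| <= 1 by rewrite ler_norml cos_geN1 cos_le1.
have h1 : `|y| * `|sin (a * y + t)| <= `|y| by rewrite ler_piMr.
have h2 : `|a| * `|cos (a * y + t)| <= `|a| by rewrite ler_piMr.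
have y2 : `|y| ^+ 2 = y ^+ 2 by rewrite real_normK// num_real.
have := sqr_ge0 (`|y| - 1); have := normr_ge0 y; have := normr_ge0 a.
by rewrite -y2; nra.
Qed.

Lemma normal_pdf01_le (x : R) : phi x * (1 + x ^+ 2 / 2) <= 1.
Proof.
have p2 : 1 <= Num.sqrt (2 * pi) :> R.
  by rewrite -[leLHS]sqrtr1 ler_sqrt//; have := @pi_ge2 R; lra.
have sp : 0 < Num.sqrt (2 * pi) :> R by lra.
rewrite normal_pdf01E -mulrA mulrC ler_pdivrMr// mul1r.
rewrite (_ : - x ^+ 2 / 2 = - (x ^+ 2 / 2)); last by lra.
rewrite expRN mulrC ler_pdivrMr ?expR_gt0//.
rewrite (le_trans (expR_ge1Dx _))// ler_peMl// expR_ge0.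
Qed.

(** Gaussian integration by parts: the integrand is the derivative of [- sin (a y + t) phi y], which
    vanishes at both infinities. The fundamental theorem is applied on symmetric intervals, which
    then exhaust the line by dominated convergence. *)
Lemma integral_parts_sin (a t : R) :
  (\int[lb]_x (g a t x * phi x)%:E = 0)%E.
Proof.
pose G (y : R) : R := - sin (a * y + t) * phi y.
have dG (x : R) : is_derive x (1:R) G (g a t x * phi x).
  have ? := is_derive_phi x.
  apply: is_derive_eq; rewrite /GRing.scale/= /g; ring.
have cG : continuous G.
  move=> x; apply: differentiable_continuous; apply/derivable1_diffP.
  by have [] := dG x.
have cg : continuous (fun x => g a t x * phi x).
  move=> x; apply: differentiable_continuous; apply/derivable1_diffP.
  have ? := is_derive_phi x.
  by apply: ex_derive.
pose B n : set R := `[- n.+1%:R, n.+1%:R]%classic.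
have E n : (\int[lb]_(x in B n) (g a t x * phi x)%:E =
    (G n.+1%:R - G (- n.+1%:R))%:E)%E.
  rewrite (@continuous_FTC2 R _ G)//.
  - by rewrite gtrN.
  - by apply: continuous_subspaceT.
  - split; [by move=> x _; have [] := dG x| |].
      by apply: cvg_at_right_filter; exact: cG.
    by apply: cvg_at_left_filter; exact: cG.
  - by move=> x _; rewrite derive1E; have [_] := dG x.
have ig := lb_integrable (mg a t) (g_le a t).
have mgp : measurable_fun setT (fun x => g a t x * phi x).
  apply: measurable_funM; first exact: mg.
  exact: measurable_normal_pdf.
have mi n : measurable_fun [set: R] (\1_(B n) : R -> R).
  by apply: measurable_indic; exact: measurable_itv.
have [|||||_ _] := @dominated_convergence _ _ _ lb setT measurableT
   (fun n x => (g a t x * phi x * \1_(B n) x)%:E)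
   (fun x => (g a t x * phi x)%:E) (fun x => `|(g a t x * phi x)%:E|)%E.
- move=> n; apply/measurable_EFinP; apply: measurable_funM => //; exact: mi.
- exact/measurable_EFinP.
- apply: aeW => x _; apply: cvg_EFin; first exact: nearW.
  apply: cvg_near_cst; near=> n.
  have xn : `|x| <= n.+1%:R.
    rewrite (@le_trans _ _ n%:R) ?ler_nat//; near: n.
    exact: nbhs_infty_ger.
  by rewrite /= indicE mem_set ?mulr1//= /B/= in_itv/= -ler_norml.
- exact: integrable_abse.
- apply: aeW => x n _; rewrite lee_fin normrM ler_piMr// indicE.
  by case: (_ \in _); rewrite ?normr1 ?normr0.
move=> h; apply/esym; move: h => /cvg_lim <-//; apply/esym/cvg_lim => //.
have -> : (fun n => \int[lb]_x (g a t x * phi x * \1_(B n) x)%:E)%E =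
   (fun n => (G n.+1%:R - G (- n.+1%:R))%:E).
  apply/funext => n; rewrite -E [RHS]integral_mkcond; apply: eq_integral => x _.
  by rewrite patchE indicE; case: ifPn; rewrite ?mulr1 ?mulr0.
apply: cvg_EFin; first exact: nearW.
apply: norm_cvg0; apply: (@squeeze_cvgr _ _ _ _ (fun=> 0) (fun n => 2 / n.+1%:R)).
- near=> n; rewrite normr_ge0/= (le_trans (ler_normB _ _))//.
  have n0 : (0:R) < n.+1%:R by [].
  have GE (x : R) : `|x| = n.+1%:R -> `|G x| <= n.+1%:R^-1.
    move=> xn; rewrite /G normrM normrN ger0_norm ?normal_pdf_ge0//.
    have s1 : `|sin (a * x + t)| <= 1 by rewrite ler_norml sin_geN1 sin_le1.
    rewrite (@le_trans _ _ (phi x))// ?ler_piMl ?normal_pdf_ge0//.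
    have := normal_pdf01_le x; have := normal_pdf_ge0 0 1 x.
    have -> : x ^+ 2 = n.+1%:R ^+ 2 by rewrite -xn real_normK// num_real.
    rewrite -[n.+1%:R^-1]mul1r ler_pdivlMr// => p0.
    apply: le_trans; rewrite ler_wpM2l//.
    by have := sqr_ge0 (n.+1%:R - 1 : R); lra.
  have := GE n.+1%:R; rewrite ger0_norm// => /(_ erefl) h1.
  have := GE (- n.+1%:R); rewrite normrN ger0_norm// => /(_ erefl) h2.
  by rewrite [leRHS]mulr_natl mulr2n lerD.
- exact: cvg_cst.
- rewrite -[X in _ --> X](mulr0 2); apply: cvgMr => //.
  exact: cvg_harmonic.
Unshelve. all: by end_near. Qed.

Let C t (a : R) : R := \int[stdN]_(y in setT) cos (a * y + t).

(** Differentiation under the integral sign, dominated by [1 + y^2], gives the mean of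
    [- Y sin (a Y + t)], and [integral_parts_sin] turns it into [- a C]. *)
Let C_derive t (a : R) : is_derive a (1:R) (C t) (- a * C t a).
Proof.
pose f (a y : R) : R := cos (a * y + t).
have df (x y : R) : is_derive x (1:R) (f ^~ y) (- sin (x * y + t) * y).
  by apply: is_derive_eq; rewrite /GRing.scale/=; ring.
have pE x y : partial1of2 f x y = - sin (x * y + t) * y.
  by rewrite partial1of2E; have [_] := df x y.
have bf x : stdN.-integrable setT (EFin \o f x).
  by apply: bmf_integrable; apply: bmf_cos; apply: measurable_funD => //;
    exact: measurable_funM.
have aI : `]a - 1, a + 1[%classic a by rewrite /= in_itv/=; lra.
have d1 (x y : R) : `]a - 1, a + 1[%classic x -> setT y ->
   derivable (f ^~ y) x 1 by move=> _ _; have [] := df x y.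
pose G (y : R) : R := 1 * (1 + y ^+ 2).
have G0 y : 0 <= G y by rewrite /G; have := sqr_ge0 y; lra.
have iG : stdN.-integrable setT (EFin \o G) by exact: stdN_integrable_sqr.
have sG x y : `|partial1of2 f x y| <= G y.
  rewrite pE normrM normrN /G mul1r.
  have s1 : `|sin (x * y + t)| <= 1 by rewrite ler_norml sin_geN1 sin_le1.
  have h1 : `|sin (x * y + t)| * `|y| <= `|y| by rewrite ler_piMl.
  have y2 : `|y| ^+ 2 = y ^+ 2 by rewrite real_normK// num_real.
  by have := sqr_ge0 (`|y| - 1); rewrite -y2; nra.
have dG (x y : R) : `]a - 1, a + 1[%classic x -> setT y ->
   `|partial1of2 f x y| <= G y by move=> _ _; exact: sG.
have bf' x : `]a - 1, a + 1[%classic x -> stdN.-integrable setT (EFin \o f x).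
  by move=> _; exact: bf.
apply: DeriveDef.
  exact: (derivable_under_integral measurableT aI bf' d1 G0 iG dG).
rewrite -derive1E.
rewrite (differentiation_under_integral measurableT aI bf' d1 G0 iG dG).
have ms : measurable_fun setT (fun y : R => - sin (a * y + t) * y).
  apply: measurable_funM => //; apply: measurableT_comp => //.
  exact: measurable_sin_affine.
have is_ : stdN.-integrable setT (EFin \o (fun y : R => - sin (a * y + t) * y)).
  by apply: (stdN_integrable (C := 1)) => // y; rewrite -pE.
rewrite (@eq_Rintegral _ _ _ _ setT (fun y => - sin (a * y + t) * y)); last first.
  by move=> y _; exact: pE.
apply/eqP; rewrite eq_sym -subr_eq0; apply/eqP.
rewrite /C -RintegralZl//; last exact: bf.
rewrite -RintegralB//; last first.
  apply: bmf_integrable; apply: bmfZ; apply: bmf_cos.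
  by apply: measurable_funD => //; exact: measurable_funM.
rewrite /Rintegral (eq_integral (fun y => (g a t y)%:E)); last first.
  by move=> y _; congr EFin; rewrite /g; ring.
by rewrite integral_stdN// integral_parts_sin.
Qed.

(** By [C' = - a C], the product [C a * exp (a^2 / 2)] is constant in [a], and at [a = 0] it equals
    [cos t]. *)
Lemma Ex_cos_stdN (a t : R) :
  Ex stdN (fun y => cos (a * y + t)) = expR (- a ^+ 2 / 2) * cos t.
Proof.
pose H (a : R) : R := C t a * expR (a ^+ 2 / 2).
have dH (x : R) : is_derive x (1:R) H 0.
  have ? := C_derive t x.
  by apply: is_derive_eq; rewrite /GRing.scale/=; field.
have := is_derive_0_is_cst a 0 dH; rewrite /H.
rewrite expr0n/= mul0r expR0 mulr1.
have -> : C t 0 = cos t.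
  rewrite -[RHS](Ex_cst (@stdN R)); apply: eq_Ex => y.
  by rewrite mul0r add0r.
move=> <-; rewrite mulrCA -expRD mulNr addNr expR0 mulr1.
by [].
Qed.

End stdN_moments.

(** * Gaussian tails, and the determination of a law by its cosine transform *)

Section tail.
Context {R : realType}.
Local Notation lb := (@lebesgue_measure R).
Local Notation phi := (normal_pdf (0:R) 1).

Definition Qtail (u : R) : R := fine (stdN `[u, +oo[%classic).

Lemma QtailE (u : R) :
  ((Qtail u)%:E = \int[lb]_(x in `[u, +oo[) (phi x)%:E)%E.
Proof. by rewrite /Qtail fineK ?fin_num_measure//; exact: measurable_itv. Qed.

Lemma continuous_phi : continuous phi.
Proof. by apply: continuous_normal_pdf; rewrite oner_neq0. Qed.

Lemma cvg_inv_pinfty : x^-1 @[x --> +oo] --> (0 : R).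
Proof.
have h := @gtr0_cvgV0 R R (pinfty_nbhs R) _ id.
by apply/h; [near=> x; near: x; exact: nbhs_pinfty_gt|exact: cvg_id].
Unshelve. all: by end_near. Qed.

Lemma cvg_phi_pinfty : phi x @[x --> +oo] --> 0.
Proof.
apply: (@squeeze_cvgr _ _ _ _ (fun=> 0) (fun x => x^-1)).
- near=> x; rewrite normal_pdf_ge0/=.
  have x0 : 0 < x by near: x; exact: nbhs_pinfty_gt.
  rewrite -[x^-1]mul1r ler_pdivlMr//.
  apply: le_trans (normal_pdf01_le x); rewrite ler_wpM2l ?normal_pdf_ge0//.
  by have := sqr_ge0 (x - 1); lra.
- exact: cvg_cst.
- exact: cvg_inv_pinfty.
Unshelve. all: by end_near. Qed.

Lemma measurable_within_ray (u : R) (f : R -> R) :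
  {within `[u, +oo[, continuous f} -> measurable_fun `[u, +oo[ f.
Proof.
move=> cf; apply: subspace_continuous_measurable_fun => //.
Qed.

Lemma integral_xphi (u : R) : 0 < u ->
  (\int[lb]_(x in `[u, +oo[) (x * phi x)%:E = (phi u)%:E)%E.
Proof.
move=> u0.
rewrite (@ge0_continuous_FTC2y R _ (fun x => - phi x) u 0).
- by rewrite -EFinB sub0r opprK.
- by move=> x ux; rewrite mulr_ge0 ?normal_pdf_ge0// (le_trans (ltW u0)).
- apply: continuous_subspaceT => x; apply: cvgM; first exact: cvg_id.
  exact: continuous_phi.
- by rewrite -[X in _ --> X]oppr0; apply: cvgN; exact: cvg_phi_pinfty.
- move=> x _; have ? := is_derive_phi x; exact: ex_derive.
- by apply: cvg_at_right_filter; apply: cvgN; exact: continuous_phi.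
- move=> x _; rewrite derive1E; have ? := is_derive_phi x.
  rewrite derive_val; ring.
Qed.

Lemma integral_mills (u : R) : 0 < u ->
  (\int[lb]_(x in `[u, +oo[) ((1 + x ^- 2) * phi x)%:E = (phi u / u)%:E)%E.
Proof.
move=> u0.
have d (x : R) : 0 < x ->
    is_derive x (1:R) (fun x : R => - (phi x / x)) ((1 + x ^- 2) * phi x).
  move=> x0; have ? := is_derive_phi x.
  have ? : x != 0 by rewrite gt_eqF.
  have ? : is_derive x (1:R) (fun x : R => x^-1) (- x ^- 2 *: (1 : R)).
    by apply: (@is_deriveV R id x 1 1); rewrite ?gt_eqF.
  apply: is_derive_eq; rewrite /GRing.scale/=; field.
  by rewrite gt_eqF.
rewrite (@ge0_continuous_FTC2y R _ (fun x => - (phi x / x)) u 0).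
- by rewrite -EFinB sub0r opprK.
- move=> x ux; rewrite mulr_ge0 ?normal_pdf_ge0// addr_ge0// invr_ge0.
  exact: sqr_ge0.
- apply: continuous_in_subspaceT => x; rewrite inE/= in_itv/= andbT => ux.
  apply: cvgM; last exact: continuous_phi.
  apply: cvgD; first exact: cvg_cst.
  apply: cvgV; first by rewrite expf_neq0// gt_eqF// (lt_le_trans u0).
  exact: sqr_continuous.
- rewrite -[X in _ --> X]oppr0; apply: cvgN; rewrite -[X in _ --> X](mulr0 0).
  apply: cvgM; first exact: cvg_phi_pinfty.
  exact: cvg_inv_pinfty.
- by move=> x ux; have [] := d x (lt_trans u0 ux).
- apply: (@cvg_at_right_filter _ _ (fun x => - (phi x / x))).
  have /derivable1_diffP/differentiable_continuous : derivable
    (fun x => - (phi x / x)) u 1 by have [] := d u u0.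
  exact.
- move=> x; rewrite in_itv/= andbT => ux.
  by rewrite derive1E; have [_] := d x (lt_trans u0 ux).
Unshelve. all: by end_near. Qed.

(** With [Qtail_ge] these are the Mills bounds; they pin the tail down up to the factor
    [1 + u^(-2)], which is all that the calibration of the level uses. *)
Lemma Qtail_le (u : R) : 0 < u -> Qtail u <= phi u / u.
Proof.
move=> u0; rewrite ler_pdivlMr// mulrC -lee_fin EFinM QtailE -integral_xphi//.
have mp := @measurable_normal_pdf R 0 1.
rewrite -ge0_integralZl//=; last 3 first.
- by apply: measurable_funTS; exact/measurable_EFinP.
- by move=> x _; rewrite lee_fin normal_pdf_ge0.
- by rewrite lee_fin ltW.
apply: ge0_le_integral => //=.
- by move=> x _; rewrite lee_fin mulr_ge0 ?normal_pdf_ge0// ltW.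
- by apply: measurable_funTS; apply/measurable_EFinP; exact: measurable_funM.
- by apply: measurable_funTS; apply/measurable_EFinP; exact: measurable_funM.
- move=> x; rewrite in_itv/= andbT => ux.
  by rewrite lee_fin ler_wpM2r// normal_pdf_ge0.
Qed.

Lemma Qtail_ge (u : R) : 0 < u -> phi u / u <= (1 + u ^- 2) * Qtail u.
Proof.
move=> u0; rewrite -lee_fin [leRHS]EFinM QtailE -integral_mills//.
have mp := @measurable_normal_pdf R 0 1.
rewrite -ge0_integralZl//=; last 3 first.
- by apply: measurable_funTS; exact/measurable_EFinP.
- by move=> x _; rewrite lee_fin normal_pdf_ge0.
- by rewrite lee_fin addr_ge0// invr_ge0 sqr_ge0.
have mi : measurable_fun `[u, +oo[ (fun x : R => ((1 + x ^- 2) * phi x)%:E).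
  apply/measurable_EFinP; apply: measurable_within_ray.
  apply: continuous_in_subspaceT => x; rewrite inE/= in_itv/= andbT => ux.
  apply: cvgM; last exact: continuous_phi.
  apply: cvgD; first exact: cvg_cst.
  apply: cvgV; first by rewrite expf_neq0// gt_eqF// (lt_le_trans u0).
  exact: sqr_continuous.
apply: ge0_le_integral => //=.
- move=> x _; rewrite lee_fin mulr_ge0 ?normal_pdf_ge0// addr_ge0// invr_ge0.
  exact: sqr_ge0.
- by apply: measurable_funTS; apply/measurable_EFinP; exact: measurable_funM.
- move=> x; rewrite in_itv/= andbT => ux.
  have x0 : 0 < x by rewrite (lt_le_trans u0).
  rewrite lee_fin ler_wpM2r ?normal_pdf_ge0// lerD2l lef_pV2 ?posrE ?exprn_gt0//.
  by rewrite lerXn2r// ?nnegrE ltW.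
Qed.

End tail.

(** * Fourier inversion by Gaussian smoothing *)

Definition gauss_kernel {R : realType} (s x y : R) : R :=
  expR (- (s * (y - x)) ^+ 2 / 2).

Section gauss_kernel_theory.
Context {R : realType}.
Local Notation lb := (@lebesgue_measure R).
Local Notation phi := (normal_pdf (0:R) 1).
Local Notation K := gauss_kernel.

(** A Gaussian bump is itself a mean of cosines. This is how knowledge of cosine means is converted
    into knowledge of means of localised functions. *)
Lemma gauss_kernelE (s x y : R) :
  K s x y = Ex stdN (fun z : R => cos (s * (y - x) * z + 0)).
Proof. by rewrite Ex_cos_stdN cos0 mulr1. Qed.

Lemma expR_Nsqr_le1 (x : R) : `|expR (- x ^+ 2 / 2)| <= 1.
Proof.
rewrite ger0_norm ?expR_ge0// -[X in _ <= X]expR0 ler_expR.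
by have := sqr_ge0 x; lra.
Qed.

Lemma bmf_gauss_kernel (s : R) : bmf (fun z : R * R => K s z.1 z.2).
Proof.
split; last by exists 1 => z; exact: expR_Nsqr_le1.
apply: measurableT_comp => //; apply: measurable_funM => //.
apply: measurableT_comp => //; apply: measurable_funX.
by apply: measurable_funM => //; exact: measurable_funB.
Qed.

(** The indicator of [B] smoothed at scale [1 / s] is an integral of bumps centred in [B]. The
    weight [exp (x^2 / 2)] cancels the density of [stdN], so that this integral is again a mean; it
    is bounded because [B] will be a bounded window. *)
Lemma gauss_smoothing (s y : R) (B : set R) : 0 < s -> measurable B ->
  bmf (fun x : R => s * expR (x ^+ 2 / 2) * \1_B x) ->
  Ex stdN (fun z : R => \1_B (y + s^-1 * z)) =
  Ex stdN (fun x : R => s * expR (x ^+ 2 / 2) * \1_B x * K s x y).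
Proof.
move=> s0 mB bB.
have si : 0 < s^-1 by rewrite invr_gt0.
have ma : measurable_fun [set: R] (fun z : R => y + s^-1 * z).
  by apply: measurable_funD => //; exact: measurable_funM.
have bK1 : bmf (fun x => K s x y).
  apply: (bmf_comp (h := fun x => (x, y)) (bmf_gauss_kernel s)).
  exact: pair2_measurable.
have bi : bmf (fun z : R => \1_B (y + s^-1 * z) : R).
  by apply: (bmf_comp (f := \1_B : R -> R) _ ma); exact: bmf_indic.
have bF := bmfM bB bK1.
have mp : measurable_fun [set: R] (fun x => (phi x)%:E).
  by apply/measurable_EFinP; exact: measurable_normal_pdf.
apply: EFin_inj; rewrite !ExE// !ge0_integral_stdN//.
- rewrite [RHS](ge0_integral_affine y si); last 2 first.
  + apply: emeasurable_funM => //; apply/measurable_EFinP; exact: bF.1.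
  + move=> x; rewrite mule_ge0// lee_fin ?normal_pdf_ge0//.
    by rewrite !mulr_ge0 ?expR_ge0// ltW.
  rewrite -ge0_integralZl//=.
  + apply: eq_integral => x _; rewrite -!EFinM; congr EFin.
    rewrite !normal_pdf01E /K.
    have -> : s * (y - (y + s^-1 * x)) = - x by field; rewrite gt_eqF.
    rewrite sqrrN.
    set e := expR ((y + s^-1 * x) ^+ 2 / 2).
    have -> : expR (- (y + s^-1 * x) ^+ 2 / 2) = e^-1.
      by rewrite -expRN mulNr.
    by field; rewrite !gt_eqF// ?expR_gt0// sqrtr_gt0 mulr_gt0// pi_gt0.
  + apply: (measurableT_comp (f := fun x : R => ((s * expR (x ^+ 2 / 2) * \1_B x * K s x y)%:E * (phi x)%:E)%E)) => //.
    apply: emeasurable_funM => //; apply/measurable_EFinP; exact: bF.1.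
  + move=> x _; rewrite mule_ge0// lee_fin ?normal_pdf_ge0//.
    by rewrite !mulr_ge0 ?expR_ge0// ltW.
  + by rewrite lee_fin ltW.
- by apply/measurable_EFinP; exact: bF.1.
- by move=> x; rewrite lee_fin !mulr_ge0 ?expR_ge0// ltW.
- by apply/measurable_EFinP; exact: bi.1.
Qed.

Lemma norm_le_window (n b x i : R) :
  - n <= x -> x <= b + i -> 1 <= n -> i <= 1 -> `|x| <= n + `|b| + 1.
Proof.
move=> h1 h2 h3 h4; have bb := ler_norm b; have nb := normr_ge0 b.
by rewrite ler_norml; apply/andP; split; lra.
Qed.

(** The smoothing scale [1 / s k = (k + 1)^(-2)] is finer than the margin [(k + 1)^(-1)] by which
    the window [B b k] exceeds [b]. The smoothed windows therefore converge at every point, [b]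
    included, to the indicator of the closed ray. *)
Let s (k : nat) : R := k.+1%:R ^+ 2.
Let B (b : R) (k : nat) : set R := `[- k.+1%:R, b + k.+1%:R^-1]%classic.
Let F b k (x : R) : R := s k * expR (x ^+ 2 / 2) * \1_(B b k) x.
Let h b k (y : R) : R := Ex stdN (fun z : R => \1_(B b k) (y + (s k)^-1 * z)).

Let s0 k : 0 < s k. Proof. by rewrite exprn_gt0. Qed.

Let mB b k : measurable (B b k). Proof. exact: measurable_itv. Qed.

Let bF b k : bmf (F b k).
Proof.
split.
  apply: measurable_funM; last exact: measurable_indic.
  apply: measurable_funM => //; apply: measurableT_comp => //.
  exact: measurable_funM.
exists (s k * expR ((k.+1%:R + `|b| + 1) ^+ 2 / 2)) => x.
rewrite /F indicE; case: (boolP (x \in B b k)) => [|_]; last first.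
  by rewrite mulr0 normr0 mulr_ge0 ?expR_ge0// ltW.
rewrite inE /B/= in_itv/= => /andP[x1 x2].
rewrite mulr1 ger0_norm ?mulr_ge0 ?expR_ge0 ?(ltW (s0 k))//.
rewrite ler_wpM2l ?(ltW (s0 k))// ler_expR ler_pM2r//.
have k1 : (1:R) <= k.+1%:R by rewrite ler1n.
have ki : k.+1%:R^-1 <= 1 :> R by rewrite invf_le1.
rewrite -(@real_normK _ x) ?num_real// lerXn2r// ?nnegrE//.
exact: norm_le_window x1 x2 k1 ki.
Qed.

Let hE b k y : h b k y = Ex stdN (fun x : R => F b k x * K (s k) x y).
Proof. exact: (gauss_smoothing y (s0 k) (mB b k) (bF b k)). Qed.

Let bFK b k y : bmf (fun x : R => F b k x * K (s k) x y).
Proof.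
apply: bmfM => //.
apply: (bmf_comp (h := fun x => (x, y)) (bmf_gauss_kernel (s k))).
exact: pair2_measurable.
Qed.

Section prob.
Context d (T : measurableType d) (P : probability T R) (g Y : T -> R).
Hypotheses (bg : bmf g) (mY : measurable_fun setT Y).

Let bgF b k : bmf (fun wx : T * R => g wx.1 * (F b k wx.2 * K (s k) wx.2 (Y wx.1))).
Proof.
apply: bmfM; first by apply: (bmf_comp bg); exact: measurable_fst.
apply: bmfM; first by apply: (bmf_comp (bF b k)); exact: measurable_snd.
apply: (bmf_comp (h := fun wx : T * R => (wx.2, Y wx.1)) (bmf_gauss_kernel (s k))).
by apply: measurable_fun_pair => //; exact: (measurableT_comp mY).
Qed.

Let bgK k x : bmf (fun w => g w * K (s k) x (Y w)).
Proof.
apply: bmfM => //.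
apply: (bmf_comp (h := fun w => (x, Y w)) (bmf_gauss_kernel (s k))).
by apply: measurable_fun_pair.
Qed.

Lemma Ex_window b k : Ex P (fun w => g w * h b k (Y w)) =
  Ex stdN (fun x => F b k x * Ex P (fun w => g w * K (s k) x (Y w))).
Proof.
transitivity (Ex P (fun w => Ex stdN (fun x => g w *
    (F b k x * K (s k) x (Y w))))).
  by apply: eq_Ex => w; rewrite hE ExZ.
rewrite (Ex_swap _ _ (bgF b k))/=; apply: eq_Ex => x.
by rewrite -ExZ//; apply: eq_Ex => w; ring.
Qed.

Lemma bmf_window b k :
  bmf (fun x => F b k x * Ex P (fun w => g w * K (s k) x (Y w))).
Proof.
have -> : (fun x => F b k x * Ex P (fun w => g w * K (s k) x (Y w))) =
  fun x => Ex P (fun w => g w * (F b k x * K (s k) x (Y w))).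
  by apply/funext => x; rewrite -ExZ//; apply: eq_Ex => w; ring.
exact: (bmf_Ex2 P stdN (bgF b k)).
Qed.

(** The bump is expanded into cosines and the two means are exchanged, after which the hypothesis
    applies for each [z] with [a = s z]. The result depends on [g] and [Y] through [c] alone. *)
Lemma Ex_kernel (c : R) : (forall a t, Ex P (fun w => g w * cos (a * Y w + t)) =
     c * (expR (- a ^+ 2 / 2) * cos t)) ->
  forall s x, Ex P (fun w => g w * K s x (Y w)) =
    c * Ex stdN (fun z => expR (- (s * z) ^+ 2 / 2) * cos (- (s * z * x))).
Proof.
move=> H s' x.
have mc : measurable_fun setT
    (fun wz : T * R => s' * (Y wz.1 - x) * wz.2 + 0).
  apply: measurable_funD => //; apply: measurable_funM => //.
  apply: measurable_funM => //; apply: measurable_funB => //.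
  exact: (measurableT_comp mY).
have bf : bmf (fun wz : T * R => g wz.1 * cos (s' * (Y wz.1 - x) * wz.2 + 0)).
  apply: bmfM; last exact: bmf_cos.
  by apply: (bmf_comp bg); exact: measurable_fst.
transitivity (Ex P (fun w => Ex stdN (fun z =>
     g w * cos (s' * (Y w - x) * z + 0)))).
  apply: eq_Ex => w; rewrite gauss_kernelE ExZ//; apply: bmf_cos.
  by apply: measurable_funD => //; exact: measurable_funM.
rewrite (Ex_swap _ _ bf)/= -ExZ.
  apply: eq_Ex => z; rewrite -H; apply: eq_Ex => w.
  congr (_ * cos _); ring.
apply: bmfM.
  split; last by exists 1 => z; exact: expR_Nsqr_le1.
  apply: measurableT_comp => //; apply: measurable_funM => //.
  apply: measurableT_comp => //; apply: measurable_funX.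
  exact: measurable_funM.
apply: bmf_cos; apply: measurableT_comp => //.
by apply: measurable_funM => //; exact: measurable_funM.
Qed.

End prob.

Lemma cvg_window b y : h b ^~ y @ \oo --> (\1_`]-oo, b]%classic y : R).
Proof.
rewrite -[X in _ --> X](Ex_cst (@stdN R)).
have ma k : measurable_fun [set: R] (fun z : R => y + (s k)^-1 * z).
  by apply: measurable_funD => //; exact: measurable_funM.
apply: (Ex_cvg (M := 1)) => //.
- move=> k.
  by apply: (measurableT_comp (f := \1_(B b k) : R -> R) _ (ma k)) => //;
    exact: measurable_indic.
- by move=> k x; rewrite indicE; case: (_ \in _); rewrite ?normr1 ?normr0.
move=> z; apply: cvg_near_cst; near=> k.
have k0 : (0:R) < k.+1%:R by [].
have kp : (k.+1%:R : R) = k%:R + 1 by rewrite -natr1.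
(* This size of [k] serves the left end of the window through [|z| + |y|] and the right end through
   [2 / |y - b|]; for [y = b] the quotient is 0 by convention. *)
have k1 : `|z| + `|y| + 1 + 2 / `|y - b| <= k%:R.
  by near: k; exact: nbhs_infty_ger.
have n0 : 0 <= 2 / `|y - b| by rewrite divr_ge0.
have zk : `|(s k)^-1 * z| <= k.+1%:R^-1.
  rewrite normrM ger0_norm ?invr_ge0 ?(ltW (s0 k))// mulrC ler_pdivrMr//.
  rewrite /s expr2 mulrA mulVf ?gt_eqF// mul1r.
  by have := normr_ge0 y; rewrite kp; lra.
have ki : k.+1%:R^-1 <= 1 :> R by rewrite invf_le1// ler1n.
move: zk; rewrite ler_norml => /andP[z1 z2].
have y1 : - `|y| <= y by rewrite lerNl -normrN ler_norm.
have nz := normr_ge0 z; have ny := normr_ge0 y.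
have kk : k.+1%:R^-1 * k.+1%:R = 1 :> R by rewrite mulVf ?gt_eqF.
rewrite !indicE /B; move: (k.+1%:R^-1) ((s k)^-1 * z) ki z1 z2 kk => i sz ki z1 z2.
rewrite kp => kk; have [yb|by_] := leP y b.
  rewrite [in RHS]mem_set ?mem_set//= in_itv/= ?kp//.
  by apply/andP; split; lra.
have -> : (y \in `]-oo, b]%classic) = false.
  by apply/negbTE; rewrite notin_setE/= in_itv/= leNgt by_.
rewrite memNset//= in_itv/= => /andP[_].
apply/negP; rewrite -ltNge.
have yb0 : 0 < y - b by rewrite subr_gt0.
have yk : 2 < (y - b) * (k%:R + 1).
  by move: k1; rewrite (gtr0_norm yb0) => k1; rewrite mulrC -ltr_pdivrMr//; lra.
have k3 : 0 < k%:R + 1 :> R by rewrite -kp.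
rewrite -(ltr_pM2r k3) mulrDl kk.
have h1 : - i * (k%:R + 1) <= sz * (k%:R + 1) by rewrite ler_pM2r.
have h2 : - i * (k%:R + 1) = - 1 by rewrite mulNr kk.
by nra.
Unshelve. all: by end_near. Qed.

(** Both sides are limits of means of smoothed windows, and for these the cosine hypothesis already
    gives equality. The weight [g] is what later permits treating the coordinates one at a time. *)
Lemma Ex_indic_ray_of_cos d (T : measurableType d) (P : probability T R)
    (g Y : T -> R) (c : R) :
  bmf g -> measurable_fun setT Y ->
  (forall a t, Ex P (fun w => g w * cos (a * Y w + t)) =
     c * (expR (- a ^+ 2 / 2) * cos t)) ->
  forall b, Ex P (fun w => g w * \1_`]-oo, b]%classic (Y w)) =
    c * fine (stdN `]-oo, b]%classic).
Proof.
move=> bg mY H b.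
have key k : Ex P (fun w => g w * h b k (Y w)) = c * Ex stdN (h b k).
  (* The same kernel formula for [stdN] itself, with weight 1 and constant 1, identifies the factor
     that multiplies [c]. *)
  have E2 s' x := @Ex_kernel _ _ (@stdN R) (fun=> 1) id (@bmf_cst R _ R 1)
     (@measurable_id _ R setT) 1 _ s' x.
  have h2 : Ex stdN (h b k) = Ex stdN (fun y => 1 * h b k y).
    by apply: eq_Ex => y; rewrite mul1r.
  rewrite h2 (@Ex_window _ _ (@stdN R) (fun=> 1) id (@bmf_cst R _ R 1)
     (@measurable_id _ R setT)) Ex_window// -ExZ; last first.
    exact: (@bmf_window _ _ (@stdN R) (fun=> 1) id (@bmf_cst R _ R 1)
     (@measurable_id _ R setT)).
  apply: eq_Ex => x; rewrite (Ex_kernel bg mY H) E2; first by ring.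
  move=> a t; rewrite mul1r -Ex_cos_stdN; apply: eq_Ex => y.
  by rewrite mul1r.
have [M gM] := bg.2.
have M0 : 0 <= M := le_trans (normr_ge0 _) (gM point).
have ha k y : `|h b k y| <= 1.
  rewrite (le_trans (Ex_norm _ _))//.
    by apply: (bmf_comp (f := \1_(B b k) : R -> R)) => //;
      [exact: bmf_indic|apply: measurable_funD => //; exact: measurable_funM].
  rewrite -[leRHS](Ex_cst (@stdN R) 1) Ex_le//.
  - apply: bmf_norm.
    by apply: (bmf_comp (f := \1_(B b k) : R -> R)) => //;
      [exact: bmf_indic|apply: measurable_funD => //; exact: measurable_funM].
  - exact: bmf_cst.
  - by move=> x; rewrite indicE; case: (_ \in _); rewrite ?normr1 ?normr0.
have mh k : measurable_fun setT (h b k).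
  have -> : h b k = fun y => Ex stdN (fun x : R => F b k x * K (s k) x y).
    by apply/funext => y; exact: hE.
  apply: (bmf_Ex2 stdN stdN (f := fun z : R * R => F b k z.1 * K (s k) z.1 z.2) _).1.
  apply: bmfM; last exact: bmf_gauss_kernel.
  by apply: (bmf_comp (bF b k)); exact: measurable_fst.
have mr : measurable_fun [set: R] (\1_`]-oo, b]%classic : R -> R).
  by apply: measurable_indic; exact: measurable_itv.
have c1 : (fun k => Ex P (fun w => g w * h b k (Y w))) @ \oo -->
    Ex P (fun w => g w * \1_`]-oo, b]%classic (Y w)).
  apply: (Ex_cvg (M := M)).
  - by move=> k; apply: measurable_funM; [exact: bg.1|exact: measurableT_comp].
  - by apply: measurable_funM; [exact: bg.1|exact: measurableT_comp].
  - by move=> k w; rewrite normrM -[M]mulr1 ler_pM.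
  - by move=> w; apply: cvgMr; exact: cvg_window.
have c2 : (fun k => c * Ex stdN (h b k)) @ \oo -->
    c * fine (stdN `]-oo, b]%classic).
  rewrite -Ex_indic; last exact: measurable_itv.
  apply: cvgMr; apply: (Ex_cvg (M := 1)) => //.
  by move=> y; exact: cvg_window.
move: c1; rewrite (_ : (fun k => _) = fun k => c * Ex stdN (h b k)); last first.
  by apply/funext => k; exact: key.
by move=> c1; exact: (cvg_unique _ c1 c2).
Qed.

End gauss_kernel_theory.

(** * Product measures and the Cramer-Wold device *)

Lemma measurable_forall_lt d (T : measurableType d) (l : nat)
    (Q : nat -> T -> Prop) :
  (forall i, (i < l)%N -> measurable [set w | Q i w]) ->
  measurable [set w | forall i, (i < l)%N -> Q i w].
Proof.
move=> mQ.
have -> : [set w | forall i, (i < l)%N -> Q i w] =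
   \bigcap_i (if (i < l)%N then [set w | Q i w] else setT).
  apply/seteqP; split => w /= h i; first by move=> _; case: ifPn => [/h|].
  by move=> il; have := h i I; rewrite il.
by apply: bigcapT_measurable => i; case: ifPn => [/mQ|].
Qed.


Definition Pr {R : realType} d (T : measurableType d) (P : {measure set T -> \bar R})
  (A : set T) : R := fine (P A).

Section Pr_theory.
Context {R : realType} d (T : measurableType d) (P : probability T R).
Implicit Types A B : set T.

Lemma PrE A : measurable A -> (Pr P A)%:E = P A.
Proof. by move=> mA; rewrite /Pr fineK// fin_num_measure. Qed.

Lemma Pr_ge0 A : 0 <= Pr P A.
Proof. by rewrite /Pr fine_ge0. Qed.

Lemma Pr_le A B : measurable A -> measurable B -> A `<=` B -> Pr P A <= Pr P B.
Proof.
by move=> mA mB AB; rewrite -lee_fin !PrE// le_measure// inE.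
Qed.

Lemma Pr_le1 A : measurable A -> Pr P A <= 1.
Proof. by move=> mA; rewrite -lee_fin PrE// probability_le1. Qed.

Lemma PrU A B : measurable A -> measurable B ->
  Pr P (A `|` B) <= Pr P A + Pr P B.
Proof.
move=> mA mB; rewrite -lee_fin EFinD !PrE//; last exact: measurableU.
exact: measureU2.
Qed.

Lemma Pr_Ex A : measurable A -> Pr P A = Ex P (\1_A).
Proof. by move=> mA; rewrite Ex_indic. Qed.

End Pr_theory.

(** * Extension of a product rule from a generating system stable under intersection *)

Section upgrade.
Context {R : realType} d (T : measurableType d) (P : probability T R).
Context d' (S : measurableType d').
Variables (G : set (set S)) (g : nat -> set S).
Hypotheses (mG : measurable = <<s G>>) (setIG : setI_closed G)
  (Gg : forall i, G (g i)) (g_cover : \bigcup_k g k = setT).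
Variables (l : nat) (Z : nat -> T -> S) (nu : nat -> probability S R).
Hypothesis mZ : forall i, (i < l)%N -> measurable_fun setT (Z i).
Hypothesis H : forall C : nat -> set S, (forall i, G (C i)) ->
  Pr P [set w | forall i, (i < l)%N -> C i (Z i w)] =
  \prod_(i < l) Pr (nu i) (C i).

Let mGm A : G A -> measurable A.
Proof. by move=> GA; rewrite mG; exact: sub_sigma_algebra. Qed.

(** One coordinate is upgraded at a time: with the other events fixed, both sides are finite
    measures in the event of coordinate [j], and they agree on a generating class closed under
    intersection. *)
Lemma indep_upgrade (C : nat -> set S) : (forall i, measurable (C i)) ->
  Pr P [set w | forall i, (i < l)%N -> C i (Z i w)] =
  \prod_(i < l) Pr (nu i) (C i).
Proof.
move=> mC.
have mE (D : nat -> set S) : (forall i, measurable (D i)) ->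
    measurable [set w | forall i, (i < l)%N -> D i (Z i w)].
  move=> mD; apply: measurable_forall_lt => i il.
  by rewrite -[X in measurable X]setTI; exact: mZ.
suff main j : (j <= l)%N -> forall D : nat -> set S,
    (forall i, measurable (D i)) -> (forall i, (j <= i)%N -> G (D i)) ->
    Pr P [set w | forall i, (i < l)%N -> D i (Z i w)] =
    \prod_(i < l) Pr (nu i) (D i).
  (* [main] asks for members of [G] from index [l] on; these indices occur on neither side, so [g 0]
     serves as filler. *)
  pose C' i := if (i < l)%N then C i else g 0.
  have <- : \prod_(i < l) Pr (nu i) (C' i) = \prod_(i < l) Pr (nu i) (C i).
    by apply: eq_bigr => i _; rewrite /C' ltn_ord.
  rewrite -(main l)// /C'.
  - congr (Pr P _); apply/seteqP; split => w /= h i il.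
      by rewrite il; exact: h.
    by have := h i il; rewrite il.
  - by move=> i; case: ifP => // _; exact: mGm.
  - by move=> i li; rewrite ltnNge li/=.
elim: j => [_ D mD GD|j IH jl D mD GD]; first by apply: H => i; exact: GD.
pose D' (A : set S) i := if i == j then A else D i.
have mD' A : measurable A -> forall i, measurable (D' A i).
  by move=> mA i; rewrite /D'; case: ifP.
pose F := [set w | forall i, (i < l)%N -> D' setT i (Z i w)].
have mF : measurable F by apply: mE; exact: mD'.
have mZj : measurable_fun setT (Z j) := mZ jl.
(* [P] restricted to the events of the other coordinates and pushed forward by [Z j]; its
   counterpart [m2] is [nu j] scaled by the remaining factors. *)
pose m1_ : {measure set S -> \bar R} := pushforward (mrestr P mF) (Z j).
pose m1 := m1_ mZj.
pose c := \prod_(i < l | (i : nat) != j) Pr (nu i) (D i).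
have c0 : 0 <= c by apply: prodr_ge0 => i _; exact: Pr_ge0.
pose m2 : {measure set S -> \bar R} := mscale (NngNum c0) (nu j).
have E1 A : measurable A ->
    m1 A = (Pr P [set w | forall i, (i < l)%N -> D' A i (Z i w)])%:E.
  move=> mA; rewrite PrE; last by apply: mE; exact: mD'.
  rewrite /m1 /m1_ /= /pushforward /mrestr; congr (P _).
  apply/seteqP; split => w.
    move=> [/= wA Fw] i il; have := Fw i il; rewrite /D'.
    by case: eqP => [->|].
  move=> /= h; split => /=.
    by have := h j jl; rewrite /D' eqxx.
  by move=> i il; have := h i il; rewrite /D'; case: eqP.
have E2 A : measurable A -> m2 A = (\prod_(i < l) Pr (nu i) (D' A i))%:E.
  move=> mA; rewrite /m2 /= /mscale/= -PrE// -EFinM; congr EFin.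
  rewrite [RHS](bigD1 (Ordinal jl))//= /D' eqxx mulrC; congr (_ * _).
  apply: eq_big => [i|i ij]; first by rewrite -val_eqE.
  by rewrite (negbTE ij).
have E12 A : G A -> m1 A = m2 A.
  move=> GA; rewrite E1 ?E2; [|exact: mGm..]; congr EFin.
  apply: IH => [|i|i ji]; first exact: ltnW.
    by apply: mD'; exact: mGm.
  by rewrite /D'; case: eqP => // ij; apply: GD; rewrite ltn_neqAle ji eq_sym andbT;
     apply/eqP.
have fin k : (m1 (g k) < +oo)%E by rewrite E1 ?ltry//; exact: mGm.
have := measure_unique G g mG setIG Gg g_cover m1 m2 E12 fin (D j) (mD j).
rewrite E1// E2// => -[] .
have -> : D' (D j) = D by apply/funext => i; rewrite /D'; case: eqP => [->|].
by [].
Qed.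

End upgrade.

Section rect.
Context d (S : measurableType d) (l : nat).

Definition rect : set (set (l.-tuple S)) :=
  [set A | exists2 B : nat -> set S, (forall i, measurable (B i)) &
     A = [set v : l.-tuple S | forall i : 'I_l, B i (tnth v i)]].

Lemma measurable_rect A : rect A -> measurable A.
Proof.
move=> [B mB ->].
have -> : [set v : l.-tuple S | forall i : 'I_l, B i (tnth v i)] =
   [set v | forall k, (k < l)%N ->
      forall i : 'I_l, (i : nat) = k -> B i (tnth v i)].
  apply/seteqP; split => v /= h; first by move=> k kl i _; exact: h.
  by move=> i; exact: (h i).
apply: measurable_forall_lt => k kl.
have -> : [set v : l.-tuple S | forall i : 'I_l, (i : nat) = k -> B i (tnth v i)] =
   (fun v => tnth v (Ordinal kl)) @^-1` B k.
  apply/seteqP; split => v /=; first by move=> /(_ (Ordinal kl)); apply.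
  by move=> h i ik; rewrite (_ : i = Ordinal kl)//; exact: val_inj.
rewrite -[X in measurable X]setTI; apply: measurable_tnth => //.
Qed.

Lemma rect_setT : rect setT.
Proof. by exists (fun=> setT) => //; apply/seteqP; split. Qed.

Lemma rect_setI : setI_closed rect.
Proof.
move=> _ _ [B mB ->] [C mC ->]; exists (fun i => B i `&` C i).
  by move=> i; exact: measurableI.
apply/seteqP; split => v /=; first by move=> [h1 h2] i; split.
by move=> h; split => i; have [] := h i.
Qed.

End rect.

(** A generator of the product sigma-algebra constrains one coordinate, so it is a rectangle whose
    other sides are the whole space. Rectangles, unlike these generators, are closed under
    intersection. *)
Lemma measurable_tuple_rect d (S : measurableType d) (l : nat) :
  @measurable _ (l.-tuple S) = <<s @rect d S l>>.
Proof.
apply/seteqP; split; last first.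
  apply: smallest_sub; first exact: sigma_algebra_measurable.
  exact: measurable_rect.
apply: smallest_sub; first exact: smallest_sigma_algebra.
apply: (@subset_trans _ (@rect d S l)); last exact: sub_sigma_algebra.
case: l => [|n]; first by rewrite big_ord0.
rewrite -bigcup_mkord_ord; apply: bigcup_sub => i /= il A [B mB <-].
exists (fun j => if j == i then B else setT).
  by move=> j; case: ifP.
rewrite setTI; apply/seteqP; split => v /=.
  move=> h j; case: eqP => // ji; move: h.
  by rewrite (_ : inord i = j)//; apply: val_inj; rewrite /= inordK.
by move=> /(_ (inord i)); rewrite inordK// eqxx.
Qed.


Definition tcons {S : Type} (l : nat) (z : S * l.-tuple S) : l.+1.-tuple S :=
  [tuple of z.1 :: z.2].

Lemma measurable_tcons d (S : measurableType d) (l : nat) :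
  measurable_fun setT (@tcons S l).
Proof. exact: measurable_cons. Qed.

HB.instance Definition _ d (S : measurableType d) (l : nat) :=
  isMeasurableFun.Build _ _ _ _ (@tcons S l) (@measurable_tcons d S l).

(** Built by consing one coordinate at a time, so that means unfold along the same recursion as sums
    over the coordinates and as the survival probabilities. *)
Fixpoint tprod {R : realType} d (S : measurableType d) (g : probability S R)
    (l : nat) : probability (l.-tuple S) R :=
  match l with
  | 0 => dirac ([tuple] : 0.-tuple S)
  | k.+1 => distribution (g \x tprod g k)%E (@tcons S k)
  end.

Section tprod_theory.
Context {R : realType} d (S : measurableType d) (g : probability S R).

Lemma Ex_tprodS l (f : l.+1.-tuple S -> R) : bmf f ->
  Ex (tprod g l.+1) f = Ex g (fun x => Ex (tprod g l) (fun v => f (tcons (x, v)))).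
Proof.
move=> bf; rewrite /= Ex_distribution// Ex_prod1//.
by apply: (bmf_comp bf); exact: measurable_tcons.
Qed.

Lemma ge0_integral_tprodS l (f : l.+1.-tuple S -> \bar R) :
  measurable_fun setT f -> (forall v, (0 <= f v)%E) ->
  (\int[tprod g l.+1]_v f v =
   \int[g]_x \int[tprod g l]_v f (tcons (x, v)))%E.
Proof.
move=> mf f0; rewrite /= ge0_integral_distribution// fubini_tonelli1//.
  by apply: (measurableT_comp mf); exact: measurable_tcons.
by move=> x /=.
Qed.

Lemma tprod_rect l (B : nat -> set S) : (forall i, measurable (B i)) ->
  Pr (tprod g l) [set v : l.-tuple S | forall i : 'I_l, B i (tnth v i)] =
  \prod_(i < l) Pr g (B i).
Proof.
elim: l B => [|l IH] B mB.
  rewrite big_ord0 /Pr /= /dirac indicE mem_set//.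
  by move=> /= [].
rewrite big_ord_recl -(IH (fun i => B i.+1))//.
rewrite /Pr /= /distribution /pushforward.
rewrite [X in product_measure1 _ _ X](_ : _ = B 0 `*`
   [set v : l.-tuple S | forall i : 'I_l, B i.+1 (tnth v i)]); last first.
  apply/seteqP; split => -[x v] /=.
    move=> h; split; first by have := h ord0.
    by move=> i; have := h (lift ord0 i); rewrite tnthS.
  move=> [h0 h] i; case: (unliftP ord0 i) => [j ->|->]//.
  by rewrite tnthS; exact: h.
rewrite product_measure1E//; last by apply: measurable_rect; exists (fun i => B i.+1).
rewrite fineM//; first by rewrite fin_num_measure.
by rewrite fin_num_measure//; apply: measurable_rect; exists (fun i => B i.+1).
Qed.

Lemma law_tprod dT (T : measurableType dT) (P : probability T R) l
    (Z : T -> l.-tuple S) : measurable_fun setT Z ->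
  (forall B : nat -> set S, (forall i, measurable (B i)) ->
    Pr P [set w | forall i : 'I_l, B i (tnth (Z w) i)] = \prod_(i < l) Pr g (B i)) ->
  forall A, measurable A -> P (Z @^-1` A) = tprod g l A.
Proof.
move=> mZ H A mA; have mZ' := mZ.
pose m1_ : {measure set (l.-tuple S) -> \bar R} := pushforward P Z.
pose m1 := m1_ mZ.
have E12 B : rect B -> m1 B = tprod g l B.
  move=> rB; have mB := measurable_rect rB.
  have mZB : measurable (Z @^-1` B) by rewrite -[X in measurable X]setTI; exact: mZ'.
  rewrite /m1 /m1_ /= /pushforward -PrE// -PrE//; congr EFin.
  by move: rB => [C mC ->]; rewrite tprod_rect// -H.
have fin (k : nat) : (m1 setT < +oo)%E.
  by rewrite /m1 /m1_ /= /pushforward preimage_setT probability_setT ltry.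
have cov : \bigcup_(k : nat) (setT : set (l.-tuple S)) = setT.
  by apply/seteqP; split => // x _; exists 0.
exact: (measure_unique (@rect d S l) (fun=> setT) (@measurable_tuple_rect d S l)
  (@rect_setI d S l) (fun=> @rect_setT d S l) cov m1 (tprod g l) E12 fin A mA).
Qed.

End tprod_theory.

Lemma measurable_mktuple d (T : measurableType d) d' (S : measurableType d')
    l (F : 'I_l -> T -> S) : (forall i, measurable_fun setT (F i)) ->
  measurable_fun setT (fun w => [tuple F i w | i < l]).
Proof.
move=> mF; apply/measurable_fun_tnthP => i.
by rewrite (_ : _ \o _ = F i)//; apply/funext => w /=; rewrite tnth_mktuple.
Qed.

(** * Joint standard normality from cosine means of linear combinations *)

Section cramer_wold.
Context {R : realType} d (T : measurableType d) (P : probability T R).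
Variables (N : nat) (Y : nat -> T -> R).
Hypothesis mY : forall i, (i < N)%N -> measurable_fun setT (Y i).
Hypothesis H : forall (a : nat -> R) (t : R),
  Ex P (fun w => cos (\sum_(i < N) a i * Y i w + t)) =
  expR (- (\sum_(i < N) a i ^+ 2) / 2) * cos t.

Let Y' i := if (i < N)%N then Y i else cst 0.

Let mY' i : measurable_fun setT (Y' i).
Proof. by rewrite /Y'; case: ifP => // /mY. Qed.

Let lin (a : nat -> R) j w := \sum_(j <= i < N) a i * Y' i w.

Let mlin a j : measurable_fun setT (lin a j).
Proof. by apply: measurable_sum => i; exact: measurable_funM. Qed.

Let pr b j w : R := \prod_(0 <= i < j) \1_`]-oo, (b i : R)]%classic (Y' i w).

Let bpr b j : bmf (pr b j).
Proof.
apply: bmf_prod => i.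
apply: (bmf_comp (f := \1_`]-oo, (b i : R)]%classic : R -> R)) => //.
by apply: bmf_indic; exact: measurable_itv.
Qed.

Let Phi (b : R) := fine (stdN `]-oo, b]%classic).

(** Each step trades the cosine dependence on coordinate [j] for the indicator of a ray. Multiplying
    the current weight by [cos (a' Y_j + t')] gives, by the product formula, two cosines of linear
    forms with coefficients [a'] and [- a']; the induction hypothesis evaluates both, and
    [Ex_indic_ray_of_cos] applies with that weight. *)
Lemma Ex_rays_cos j : (j <= N)%N -> forall b a t,
  Ex P (fun w => pr b j w * cos (lin a j w + t)) =
  \prod_(0 <= i < j) Phi (b i) *
   (expR (- (\sum_(j <= i < N) a i ^+ 2) / 2) * cos t).
Proof.
elim: j => [_|j IH jN] b a t.
  rewrite big_geq// mul1r !big_mkord -H; apply: eq_Ex => w.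
  rewrite /pr big_geq// mul1r /lin big_mkord.
  by congr (cos (_ + _)); apply: eq_bigr => i _; rewrite /Y' ltn_ord.
pose gg w := pr b j w * cos (lin a j.+1 w + t).
have bgg : bmf gg.
  by apply: bmfM => //; apply: bmf_cos; exact: measurable_funD.
pose c := \prod_(0 <= i < j) Phi (b i) *
   (expR (- (\sum_(j.+1 <= i < N) a i ^+ 2) / 2) * cos t).
have Hc a' t' : Ex P (fun w => gg w * cos (a' * Y' j w + t')) =
    c * (expR (- a' ^+ 2 / 2) * cos t').
  pose ap i := if i == j then a' else a i.
  pose am i := if i == j then - a' else a i.
  have lE (x : R) : lin (fun i => if i == j then x else a i) j =
      fun w => x * Y' j w + lin a j.+1 w.
    apply/funext => w; rewrite /lin big_ltn// eqxx; congr (_ + _).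
    apply: eq_big_nat => i /andP[ji _]; rewrite gtn_eqF//.
  have sE (x : R) : \sum_(j <= i < N) (if i == j then x else a i) ^+ 2 =
     x ^+ 2 + \sum_(j.+1 <= i < N) a i ^+ 2.
    rewrite big_ltn// eqxx; congr (_ + _).
    by apply: eq_big_nat => i /andP[ji _]; rewrite gtn_eqF.
  have IHj := IH (ltnW jN).
  transitivity (2^-1 * (Ex P (fun w => pr b j w * cos (lin ap j w + (t + t')))
    + Ex P (fun w => pr b j w * cos (lin am j w + (t - t'))))).
    have bc a1 t1 : bmf (fun w => pr b j w * cos (lin a1 j w + t1)).
      by apply: bmfM => //; apply: bmf_cos; exact: measurable_funD.
    rewrite -ExD// -ExZ; last exact: bmfD.
    apply: eq_Ex => w; rewrite /gg !lE.
    have -> : a' * Y' j w + lin a j.+1 w + (t + t') =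
      (lin a j.+1 w + t) + (a' * Y' j w + t') by ring.
    have -> : - a' * Y' j w + lin a j.+1 w + (t - t') =
      (lin a j.+1 w + t) - (a' * Y' j w + t') by ring.
    move: (lin a j.+1 w + t) (a' * Y' j w + t') => A0 B0.
    by rewrite cosD cosB; field.
  rewrite !IHj !sE sqrrN cosD cosB /c.
  have -> : - (a' ^+ 2 + \sum_(j.+1 <= i < N) a i ^+ 2) / 2 =
    - (\sum_(j.+1 <= i < N) a i ^+ 2) / 2 + - a' ^+ 2 / 2 by field.
  by rewrite expRD; field.
have := Ex_indic_ray_of_cos bgg (mY' j) Hc (b j).
rewrite -/(Phi _) big_nat_recr//= => E.
transitivity (Ex P (fun w => gg w * \1_`]-oo, (b j)]%classic (Y' j w))).
  by apply: eq_Ex => w; rewrite [pr b j.+1 w]big_nat_recr// -/(pr b j w) /gg mulrAC.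
by rewrite E /c; ring.
Qed.

Lemma cramer_wold_normal (B : nat -> set R) : (forall i, measurable (B i)) ->
  Pr P [set w | forall i, (i < N)%N -> B i (Y i w)] =
  \prod_(i < N) Pr stdN (B i).
Proof.
pose G : set (set R) := [set A | exists x : R, A = `]-oo, x]%classic].
have mG : @measurable _ R = <<s G>>.
  rewrite [LHS](RGenOInfty.measurableE R); apply/seteqP; split.
    apply: smallest_sub; first exact: smallest_sigma_algebra.
    move=> _ [x ->]; rewrite -setCitvl; apply: sigma_algebraC.
    by apply: sub_sigma_algebra; exists x.
  apply: smallest_sub; first exact: smallest_sigma_algebra.
  move=> _ [x ->]; have -> : `]-oo, x]%classic = ~` `]x, +oo[%classic :> set R.
    by rewrite setCitvr.
  by apply: sigma_algebraC; apply: sub_sigma_algebra; exists x.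
apply: (@indep_upgrade R _ T P _ R G (fun k => `]-oo, k%:R]%classic) mG
  _ _ _ N Y (fun=> stdN)).
- move=> _ _ [x ->] [y ->]; exists (Num.min x y).
  by apply/seteqP; split => z /=; rewrite !in_itv/= le_min => /andP.
- by move=> i; exists i%:R.
- apply/seteqP; split => // x _.
  exists (Num.truncn `|x|).+1 => //=.
  rewrite in_itv/= (le_trans (ler_norm _))// ltW//.
  by rewrite truncnS_gt.
- exact: mY.
- move=> C GC.
  have /choice[b bE] : forall i, exists x : R, C i = `]-oo, x]%classic by [].
  (* When no coordinate is left, phase 0 makes the cosine equal to 1. *)
  have := Ex_rays_cos (leqnn N) b (fun=> 0) 0.
  rewrite [\sum_(N <= i < N) _]big_geq// oppr0 mul0r expR0 mul1r cos0 mulr1.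
  rewrite big_mkord => E.
  rewrite (eq_bigr (fun i : 'I_N => Phi (b i))); last first.
    by move=> i _; rewrite /Pr bE.
  rewrite -E Pr_Ex; last first.
    apply: measurable_forall_lt => i iN; rewrite bE -[X in measurable X]setTI.
    by apply: mY => //; exact: measurable_itv.
  apply: eq_Ex => w; rewrite /lin big_geq// add0r cos0 mulr1 /pr big_mkord.
  rewrite indicE; case: (boolP (w \in _)) => wC.
    rewrite big1// => i _; rewrite indicE mem_set//.
    by move: wC; rewrite inE/= => /(_ i (ltn_ord i)); rewrite bE /Y' ltn_ord.
  apply/esym/eqP/prodf_eq0.
  move: wC; rewrite notin_setE/= => /existsNP[i /not_implyP[iN nC]].
  exists (Ordinal iN) => //=; rewrite indicE memNset//.
  by move: nC; rewrite bE /Y' iN.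
Qed.

End cramer_wold.

(** * Passing from Gaussian rows to independent Gaussian columns *)

Section law_eq.
Context {R : realType} d1 (T1 : measurableType d1) (P1 : probability T1 R).
Context d2 (T2 : measurableType d2) (P2 : probability T2 R).
Context d (S : measurableType d) (W1 : T1 -> S) (W2 : T2 -> S).
Hypotheses (mW1 : measurable_fun setT W1) (mW2 : measurable_fun setT W2).

Lemma Ex_eq_law (f : S -> R) :
  (forall B, measurable B -> P1 (W1 @^-1` B) = P2 (W2 @^-1` B)) ->
  bmf f -> Ex P1 (fun w => f (W1 w)) = Ex P2 (fun w => f (W2 w)).
Proof.
move=> H bf.
pose X1 : {mfun T1 >-> S} := mfun_Sub (mem_set mW1).
pose X2 : {mfun T2 >-> S} := mfun_Sub (mem_set mW2).
have E1 := Ex_distribution P1 X1 bf.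
have E2 := Ex_distribution P2 X2 bf.
transitivity (Ex (distribution P1 X1) f); first by rewrite E1.
transitivity (Ex (distribution P2 X2) f); last by rewrite E2.
rewrite /Ex /Rintegral; congr fine; apply: eq_measure_integral => A mA _.
exact: H.
Qed.

End law_eq.

Lemma Pr_Ex_preimage {R : realType} d (T : measurableType d) (P : probability T R)
  d' (S : measurableType d') (W : T -> S) (A : set S) :
  measurable_fun setT W -> measurable A ->
  Pr P [set w | A (W w)] = Ex P (fun w => \1_A (W w)).
Proof.
move=> mW mA; rewrite Pr_Ex; last by rewrite -[X in measurable X]setTI; exact: mW.
by apply: eq_Ex => w; rewrite !indicE.
Qed.

Section normal_rows.
Context {R : realType} d (T : measurableType d) (P : probability T R).

Lemma Ex_cos_normal (W : T -> R) (v t : R) : measurable_fun setT W -> 0 <= v ->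
  centered_normal_law P W v ->
  Ex P (fun w => cos (W w + t)) = expR (- v / 2) * cos t.
Proof.
move=> mW v0 [H0 H1].
have mWt : measurable_fun setT (fun w => W w + t) by exact: measurable_funD.
(* In the degenerate case the two cosines differ by at most 2, and only on a null event. *)
have [vz|vn] := eqVneq v 0.
  rewrite vz oppr0 mul0r expR0 mul1r.
  have mA : measurable [set w | W w = 0].
    by rewrite -[X in measurable X]setTI; exact: (mW measurableT [set 0]).
  have bc := bmf_cos mWt; have bt := @bmf_cst R _ T (cos t).
  apply/eqP; rewrite -subr_eq0 -normr_le0 -[X in _ - X](Ex_cst P) -ExB//.
  rewrite (le_trans (Ex_norm _ (bmfB bc bt)))//.
  have b2 : bmf (fun w : T => 2 * \1_(~` [set w | W w = 0]) w : R).
    by apply: bmfZ; apply: bmf_indic; exact: measurableC.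
  apply: (@le_trans _ _ (Ex P (fun w : T => 2 * \1_(~` [set w | W w = 0]) w))).
    apply: Ex_le => //; first by apply: bmf_norm; exact: bmfB.
    move=> w; rewrite indicE; case: (boolP (w \in _)).
      move=> _; rewrite mulr1 (le_trans (ler_normB _ _))//.
      by rewrite mulr2n lerD// ler_norml cos_geN1 cos_le1.
    rewrite notin_setE/= => /contrapT ->.
    by rewrite add0r subrr normr0 mulr0.
  rewrite ExZ; last by apply: bmf_indic; exact: measurableC.
  by rewrite Ex_indic ?probability_setC ?H0 ?subee ?mulr0//; exact: measurableC.
have vp : 0 < v by rewrite lt_def vn.
have sp : 0 < Num.sqrt v by rewrite sqrtr_gt0.
have ms : measurable_fun setT (fun z : R => Num.sqrt v * z) by exact: measurable_funM.
have bc : bmf (fun z : R => cos (z + t)).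
  by apply: bmf_cos; exact: measurable_funD.
rewrite (@Ex_eq_law R _ _ P _ _ (@stdN R) _ _ W _ mW ms _ _ bc); last first.
  move=> B mB; rewrite H1// normal_prob_stdN//.
  by congr (stdN _); apply/seteqP; split => z /=; rewrite add0r.
by rewrite Ex_cos_stdN sqr_sqrtr// ltW.
Qed.

Variables (n p : nat) (r : R) (x : nat -> nat -> T -> R).
Hypothesis HI : indep_vectors P n p x.
Hypothesis HN : forall k, (k < n)%N -> is_Np_AR P p r (x k).

Let x' k i := if (k < n)%N && (i < p)%N then x k i else cst 0.

Let mx' k i : measurable_fun setT (x' k i).
Proof.
by rewrite /x'; case: ifP => // /andP[kn ip]; have [/(_ _ ip)] := HN kn.
Qed.

Let row k w : p.-tuple R := [tuple x' k i w | i < p].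

Let mrow k : measurable_fun setT (row k).
Proof. by apply: measurable_mktuple => i. Qed.

Let nu k : probability (p.-tuple R) R :=
  distribution P (mfun_Sub (mem_set (mrow k)) : {mfun T >-> p.-tuple R}).

(** Independence is assumed on rectangles of entries; the orthonormal combinations need it for
    arbitrary events on whole rows. *)
Lemma rows_indep (C : nat -> set (p.-tuple R)) : (forall k, measurable (C k)) ->
  Pr P [set w | forall k, (k < n)%N -> C k (row k w)] =
  \prod_(k < n) Pr P [set w | C k (row k w)].
Proof.
move=> mC.
have cov : \bigcup_(k : nat) (setT : set (p.-tuple R)) = setT.
  by apply/seteqP; split => // v _; exists 0.
apply: (@indep_upgrade R _ T P _ _ (@rect _ R p) (fun=> setT)
  (measurable_tuple_rect R p) (@rect_setI _ R p) (fun=> @rect_setT _ R p) cov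
  n row nu) => //.
move=> D /= rD.
have /choice[B HB] : forall k, exists B : nat -> set R, (forall i, measurable (B i)) /\
    D k = [set v : p.-tuple R | forall i : 'I_p, B i (tnth v i)].
  by move=> k; have [B mB ->] := rD k; exists B.
have HBk k w : (k < n)%N ->
    D k (row k w) <-> forall i, (i < p)%N -> B k i (x k i w).
  move=> kn; rewrite (HB k).2/=; split => h i.
    move=> ip; have := h (Ordinal ip); rewrite tnth_mktuple/=.
    by rewrite /x' kn ip.
  by rewrite tnth_mktuple/= /x' kn ltn_ord; apply: h.
have := HI (fun k i => (HB k).1 i).
have -> : [set w | forall k, (k < n)%N -> forall i, (i < p)%N -> B k i (x k i w)] =
   [set w | forall k, (k < n)%N -> D k (row k w)].
  by apply/seteqP; split => w /= h k kn; have := h k kn; rewrite (HBk k w kn).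
move=> E; transitivity (fine (\prod_(k < n) (Pr P [set w | D k (row k w)])%:E)%E).
  rewrite /Pr; congr fine; rewrite [LHS]E; apply: eq_bigr => k _.
  rewrite fineK ?fin_num_measure//.
    by congr (P _); apply/seteqP; split => w /=; rewrite (HBk k w (ltn_ord k)).
  rewrite -[X in measurable X]setTI; apply: mrow => //.
  exact: measurable_rect (rD k).
by rewrite prodEFin/=.
Qed.

Variables (m : nat) (alpha : nat -> nat -> R).
Hypothesis orth : forall s t, (s < m)%N -> (t < m)%N ->
  \sum_(i < p) \sum_(j < p) alpha s i * alpha t j * Sigma_entry r i j = (s == t)%:R.

Let y k s w := \sum_(i < p) alpha s i * x k i w.

Lemma measurable_row_comb k s : (k < n)%N -> measurable_fun setT (y k s).
Proof.
move=> kn; apply: measurable_sum => i; apply: measurable_funM => //.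
by have [/(_ _ (ltn_ord i))] := HN kn.
Qed.

(** By [orth], a combination with coefficients [a] of the new variables has variance [|a|^2], so its
    cosine mean is the one that [cramer_wold_normal] asks for. *)
Lemma gauss_row k (B : nat -> set R) : (k < n)%N -> (forall s, measurable (B s)) ->
  Pr P [set w | forall s, (s < m)%N -> B s (y k s w)] =
  \prod_(s < m) Pr stdN (B s).
Proof.
move=> kn mB; apply: cramer_wold_normal => // [s sm|a t].
  exact: measurable_row_comb.
pose b i := \sum_(s < m) a s * alpha s i.
have E w : \sum_(s < m) a s * y k s w = \sum_(i < p) b i * x k i w.
  rewrite /y; under eq_bigr do rewrite mulr_sumr.
  rewrite exchange_big/=; apply: eq_bigr => i _.
  by rewrite mulr_suml; apply: eq_bigr => s _; rewrite mulrA.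
have V : \sum_(i < p) \sum_(j < p) b i * b j * Sigma_entry r i j =
    \sum_(s < m) a s ^+ 2.
  transitivity (\sum_(s < m) \sum_(t < m) a s * a t *
     (\sum_(i < p) \sum_(j < p) alpha s i * alpha t j * Sigma_entry r i j)).
    rewrite /b.
    transitivity (\sum_(i < p) \sum_(j < p) \sum_(s < m) \sum_(t < m)
        a s * a t * (alpha s i * alpha t j * Sigma_entry r i j)).
      apply: eq_bigr => i _; apply: eq_bigr => j _.
      rewrite big_distrlr/= mulr_suml; apply: eq_bigr => s _.
      by rewrite mulr_suml; apply: eq_bigr => u _; ring.
    under eq_bigr do rewrite exchange_big/=.
    rewrite exchange_big/=; apply: eq_bigr => s _.
    under eq_bigr do rewrite exchange_big/=.
    rewrite exchange_big/=; apply: eq_bigr => u _.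
    rewrite mulr_sumr; apply: eq_bigr => i _.
    by rewrite mulr_sumr.
  apply: eq_bigr => s _; rewrite (bigD1 s)//= orth// eqxx mulr1 big1 ?addr0//.
  by move=> u us; rewrite orth// eq_sym val_eqE (negbTE us) mulr0.
under eq_Ex do rewrite E.
rewrite -V; apply: Ex_cos_normal.
- apply: measurable_sum => i; apply: measurable_funM => //.
  by have [/(_ _ (ltn_ord i))] := HN kn.
- by rewrite V sumr_ge0// => s _; exact: sqr_ge0.
- by have [_] := HN kn; apply.
Qed.

Lemma gauss_rows (B : nat -> nat -> set R) : (forall k s, measurable (B k s)) ->
  Pr P [set w | forall k, (k < n)%N -> forall s, (s < m)%N -> B k s (y k s w)] =
  \prod_(k < n) \prod_(s < m) Pr stdN (B k s).
Proof.
move=> mB.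
pose C k : set (p.-tuple R) := [set v | forall s, (s < m)%N ->
   B k s (\sum_(i < p) alpha s i * tnth v i)].
have mC k : measurable (C k).
  apply: measurable_forall_lt => s _.
  rewrite -[X in measurable X]setTI.
  have : measurable_fun setT (fun v : p.-tuple R => \sum_(i < p) alpha s i * tnth v i).
    apply: measurable_sum => i; apply: measurable_funM => //.
    exact: measurable_tnth.
  exact.
have CE k w : (k < n)%N ->
    C k (row k w) <-> forall s, (s < m)%N -> B k s (y k s w).
  move=> kn; have e s : \sum_(i < p) alpha s i * tnth (row k w) i = y k s w.
    by apply: eq_bigr => i _; rewrite tnth_mktuple/= /x' kn ltn_ord.
  by rewrite /C/=; split => h s sm; have := h s sm; rewrite e.
have -> : [set w | forall k, (k < n)%N -> forall s, (s < m)%N -> B k s (y k s w)] =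
   [set w | forall k, (k < n)%N -> C k (row k w)].
  by apply/seteqP; split => w /= h k kn; have := h k kn; rewrite (CE k w kn).
rewrite rows_indep//; apply: eq_bigr => k _; rewrite -(gauss_row (ltn_ord k))//.
by congr (Pr P _); apply/seteqP; split => w /=; rewrite (CE k w (ltn_ord k)).
Qed.

End normal_rows.

Section columns.
Context {R : realType} d (T : measurableType d) (P : probability T R).
Variables (n m : nat) (y : nat -> nat -> T -> R).
Hypothesis my : forall k s, (k < n)%N -> (s < m)%N -> measurable_fun setT (y k s).
Hypothesis H : forall B : nat -> nat -> set R, (forall k s, measurable (B k s)) ->
  Pr P [set w | forall k, (k < n)%N -> forall s, (s < m)%N -> B k s (y k s w)] =
  \prod_(k < n) \prod_(s < m) Pr stdN (B k s).

Definition col_of s w : n.-tuple R := [tuple y k s w | k < n].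

Let mcol s : (s < m)%N -> measurable_fun setT (col_of s).
Proof. by move=> sm; apply: measurable_mktuple => k; exact: my. Qed.

Lemma measurable_cols : measurable_fun setT (fun w => [tuple col_of s w | s < m]).
Proof. by apply: measurable_mktuple => s; exact: mcol. Qed.

(** The product rule for single entries is symmetric in rows and columns: exchanging the two
    products turns independent rows with independent entries into independent columns. *)
Lemma law_columns (A : set (m.-tuple (n.-tuple R))) : measurable A ->
  P [set w | A [tuple col_of s w | s < m]] = tprod (tprod stdN n) m A.
Proof.
move: A; apply: (law_tprod measurable_cols) => B mB.
have -> : [set w | forall i : 'I_m, B i (tnth [tuple col_of s w | s < m] i)] =
    [set w | forall s, (s < m)%N -> B s (col_of s w)].
  apply/seteqP; split => w /= h s.
    by move=> sm; have := h (Ordinal sm); rewrite tnth_mktuple.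
  by rewrite tnth_mktuple; exact: h.
have cov : \bigcup_(k : nat) (setT : set (n.-tuple R)) = setT.
  by apply/seteqP; split => // v _; exists 0.
apply: (@indep_upgrade R _ T P _ _ (@rect _ R n) (fun=> setT)
  (measurable_tuple_rect R n) (@rect_setI _ R n) (fun=> @rect_setT _ R n) cov
  m col_of (fun=> tprod stdN n)) => //.
move=> D rD.
have /choice[E HE] : forall s, exists E : nat -> set R, (forall k, measurable (E k)) /\
    D s = [set v : n.-tuple R | forall k : 'I_n, E k (tnth v k)].
  by move=> s; have [E mE ->] := rD s; exists E.
have -> : [set w | forall s, (s < m)%N -> D s (col_of s w)] =
  [set w | forall k, (k < n)%N -> forall s, (s < m)%N -> E s k (y k s w)].
  apply/seteqP; split => w /= h.
    move=> k kn s sm; have := h s sm; rewrite (HE s).2/= => /(_ (Ordinal kn)).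
    by rewrite tnth_mktuple.
  by move=> s sm; rewrite (HE s).2/= => k; rewrite tnth_mktuple; exact: h.
rewrite (H (B := fun k s => E s k)); last by move=> k s; exact: (HE s).1.
rewrite exchange_big/=; apply: eq_bigr => s _.
rewrite (HE s).2 tprod_rect//; exact: (HE s).1.
Qed.

End columns.

Lemma law_pair {R : realType} d (T : measurableType d) (P : probability T R)
    (n : nat) (y : nat -> nat -> T -> R) (f : n.-tuple R * n.-tuple R -> R) :
  (forall k s, (k < n)%N -> (s < 2)%N -> measurable_fun setT (y k s)) ->
  (forall B : nat -> nat -> set R, (forall k s, measurable (B k s)) ->
    Pr P [set w | forall k, (k < n)%N -> forall s, (s < 2)%N -> B k s (y k s w)] =
    \prod_(k < n) \prod_(s < 2) Pr stdN (B k s)) ->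
  bmf f ->
  Ex P (fun w => f (col_of n y 0 w, col_of n y 1 w)) =
  Ex (tprod stdN n \x tprod stdN n)%E f.
Proof.
move=> my H bf.
pose g (v : 2.-tuple (n.-tuple R)) := f (tnth v ord0, tnth v (lift ord0 ord0)).
have mg2 : measurable_fun setT (fun v : 2.-tuple (n.-tuple R) =>
    (tnth v ord0, tnth v (lift ord0 ord0))).
  by apply: measurable_fun_pair; exact: measurable_tnth.
have bg : bmf g := bmf_comp bf mg2.
have mid : measurable_fun setT (@id (2.-tuple (n.-tuple R))) by [].
transitivity (Ex P (fun w => g [tuple col_of n y s w | s < 2])).
  by apply: eq_Ex => w; rewrite /g !tnth_mktuple.
rewrite (@Ex_eq_law R _ _ P _ _ (tprod (tprod stdN n) 2) _ _ _ id
  (measurable_cols my) mid g _ bg); last first.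
  by move=> B mB; rewrite -(law_columns my H).
rewrite Ex_tprodS// [RHS]Ex_prod1//; apply: eq_Ex => u.
rewrite Ex_tprodS; last first.
  apply: (bmf_comp bg); apply: measurableT_comp; first exact: measurable_tcons.
  exact: pair1_measurable.
apply: eq_Ex => v.
rewrite -[RHS](Ex_cst (tprod (tprod stdN n) 0)); apply: eq_Ex => e.
by rewrite /g tnthS.
Qed.

Section canonical.
Context {R : realType} (n : nat).
Local Notation gam := (tprod (@stdN R) n).

Lemma Ex_cos_tprod (c : nat -> R) (t : R) :
  Ex gam (fun v => cos (\sum_(k < n) c k * tnth v k + t)) =
  expR (- (\sum_(k < n) c k ^+ 2) / 2) * cos t.
Proof.
elim: n c t => [|l IH] c t.
  rewrite !big_ord0 oppr0 mul0r expR0 mul1r -[RHS](Ex_cst (tprod (@stdN R) 0)).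
  by apply: eq_Ex => v; rewrite big_ord0 add0r.
rewrite Ex_tprodS; last first.
  apply: bmf_cos; apply: measurable_funD => //; apply: measurable_sum => i.
  by apply: measurable_funM => //; exact: measurable_tnth.
pose E := expR (- (\sum_(k < l) c k.+1 ^+ 2) / 2).
transitivity (Ex stdN (fun x => E * cos (c 0 * x + t))).
  apply: eq_Ex => x; rewrite -(IH (fun k => c k.+1) (c 0 * x + t)).
  apply: eq_Ex => v; congr cos; rewrite big_ord_recl/=.
  rewrite (_ : tnth (tcons (x, v)) ord0 = x)//.
  rewrite (eq_bigr (fun i : 'I_l => c i.+1 * tnth v i)); last first.
    by move=> i _; rewrite tnthS.
  by ring.
rewrite ExZ; last first.
  by apply: bmf_cos; apply: measurable_funD => //; exact: measurable_funM.
rewrite Ex_cos_stdN /E big_ord_recl/= mulrA -expRD; congr (expR _ * _).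
by field.
Qed.

(** The two vectors are listed as one family [Z] of [n + n] scalars, to which [cramer_wold_normal]
    applies, and are then read back as two columns. *)
Lemma law_pair_of_cos d (T : measurableType d) (P : probability T R)
    (U V : T -> n.-tuple R) (f : n.-tuple R * n.-tuple R -> R) :
  measurable_fun setT U -> measurable_fun setT V ->
  (forall (a b : nat -> R) t, Ex P (fun w => cos (\sum_(k < n) a k * tnth (U w) k +
      \sum_(k < n) b k * tnth (V w) k + t)) =
    expR (- (\sum_(k < n) a k ^+ 2 + \sum_(k < n) b k ^+ 2) / 2) * cos t) ->
  bmf f -> Ex P (fun w => f (U w, V w)) = Ex (gam \x gam)%E f.
Proof.
move=> mU mV H bf.
pose nthU k w := nth 0 (U w) k; pose nthV k w := nth 0 (V w) k.
pose y (k s : nat) := if s == 0%N then nthU k else nthV k.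
have UE k w (kn : (k < n)%N) : nthU k w = tnth (U w) (Ordinal kn).
  by rewrite (tnth_nth 0).
have VE k w (kn : (k < n)%N) : nthV k w = tnth (V w) (Ordinal kn).
  by rewrite (tnth_nth 0).
have mnU k : (k < n)%N -> measurable_fun setT (nthU k).
  move=> kn; rewrite (_ : nthU k = fun w => tnth (U w) (Ordinal kn)).
    exact: (measurableT_comp (@measurable_tnth _ R n (Ordinal kn)) mU).
  by apply/funext => w; rewrite (UE _ _ kn).
have mnV k : (k < n)%N -> measurable_fun setT (nthV k).
  move=> kn; rewrite (_ : nthV k = fun w => tnth (V w) (Ordinal kn)).
    exact: (measurableT_comp (@measurable_tnth _ R n (Ordinal kn)) mV).
  by apply/funext => w; rewrite (VE _ _ kn).
pose Z i := if (i < n)%N then nthU i else nthV (i - n)%N.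
have CW (C : nat -> set R) : (forall i, measurable (C i)) ->
   Pr P [set w | forall i, (i < n + n)%N -> C i (Z i w)] =
   \prod_(i < n + n) Pr stdN (C i).
  apply: cramer_wold_normal.
    move=> i inn; rewrite /Z; case: ltnP => ni; first exact: mnU.
    by apply: mnV; rewrite ltn_subLR.
  move=> a t; rewrite big_split_ord/=.
  rewrite -(H a (fun k => a (n + k)%N)); apply: eq_Ex => w.
  rewrite big_split_ord/=; congr (cos (_ + _ + _)); apply: eq_bigr => i _.
    by rewrite /Z ltn_ord (UE _ _ (ltn_ord i)); congr (_ * tnth _ _); exact: val_inj.
  rewrite /Z ltnNge leq_addr/= addKn (VE _ _ (ltn_ord i)).
  by congr (_ * tnth _ _); exact: val_inj.
transitivity (Ex P (fun w => f (col_of n y 0 w, col_of n y 1 w))).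
  apply: eq_Ex => w; congr (f (_, _)); apply: eq_from_tnth => k;
    rewrite tnth_mktuple /y/= ?(UE _ _ (ltn_ord k)) ?(VE _ _ (ltn_ord k)).
    by congr tnth; exact: val_inj.
  by congr tnth; exact: val_inj.
apply: law_pair => //.
  by move=> k s kn _; rewrite /y; case: ifP => _; [exact: mnU|exact: mnV].
move=> B mB.
pose C i := if (i < n)%N then B i 0 else B (i - n)%N 1.
have := CW C _; rewrite (_ : [set w | _] = [set w | forall k, (k < n)%N ->
    forall s, (s < 2)%N -> B k s (y k s w)]).
  move=> ->; last by move=> i; rewrite /C; case: ifP.
  rewrite big_split_ord/=.
  under [RHS]eq_bigr do rewrite !big_ord_recl big_ord0 mulr1/=.
  rewrite big_split/=; congr (_ * _); apply: eq_bigr => i _.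
    by rewrite /C ltn_ord.
  by rewrite /C ltnNge leq_addr/= addKn.
apply/seteqP; split => w /= h.
  move=> k kn [|[|//]] _; rewrite /y/=.
    have := h k; rewrite /C /Z kn; apply.
    by rewrite (leq_trans kn)// leq_addr.
  have nk : (n + k < n)%N = false by rewrite ltnNge leq_addr.
  have := h (n + k)%N; rewrite /C /Z nk addKn; apply.
  by rewrite ltn_add2l.
move=> i inn; rewrite /C /Z; case: ltnP => ni.
  exact: (h i ni 0).
by apply: (h (i - n)%N _ 1%N) => //; rewrite ltn_subLR.
Qed.

End canonical.

(** * The Ornstein-Uhlenbeck operator and its spectral gap *)

Definition sqnorm {R : realType} n (v : n.-tuple R) : R := \sum_(k < n) tnth v k ^+ 2.

Definition lincomb {R : realType} n (a b : R) (x e : n.-tuple R) : n.-tuple R :=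
  [tuple a * tnth x k + b * tnth e k | k < n].

Section lincomb_theory.
Context {R : realType} (n : nat).
Local Notation S := (n.-tuple R).
Local Notation gam := (tprod (@stdN R) n).

Lemma measurable_sqnorm : measurable_fun setT (@sqnorm R n).
Proof.
by apply: measurable_sum => k; apply: measurable_funX; exact: measurable_tnth.
Qed.

Lemma measurable_lincomb (a b : R) :
  measurable_fun setT (fun z : S * S => lincomb a b z.1 z.2).
Proof.
apply: measurable_mktuple => k; apply: measurable_funD.
  apply: measurable_funM => //.
  by apply: (measurableT_comp (@measurable_tnth _ R n k)).
apply: measurable_funM => //.
by apply: (measurableT_comp (@measurable_tnth _ R n k)).
Qed.

Lemma bmf_lincomb (a b : R) (f : S -> R) : bmf f ->
  bmf (fun z : S * S => f (lincomb a b z.1 z.2)).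
Proof. by move=> bf; apply: (bmf_comp bf); exact: measurable_lincomb. Qed.

Lemma bmf_lincomb1 (a b : R) (f : S -> R) x : bmf f ->
  bmf (fun e => f (lincomb a b x e)).
Proof.
move=> bf; apply: (bmf_comp (h := fun e => (x, e)) (bmf_lincomb a b bf)).
exact: pair1_measurable.
Qed.

(** The matrix with rows [(a, b)] and [(b, - a)] is orthogonal, hence preserves the quadratic form
    in the cosine transform. It is a reflection and so its own inverse, which [lincombK]
    exploits. *)
Lemma Ex_rotation (a b : R) (f : S * S -> R) : a ^+ 2 + b ^+ 2 = 1 -> bmf f ->
  Ex (gam \x gam)%E (fun z : S * S => f (lincomb a b z.1 z.2, lincomb b (- a) z.1 z.2)) =
  Ex (gam \x gam)%E f.
Proof.
move=> ab bf; apply: law_pair_of_cos => //; try exact: measurable_lincomb.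
move=> c d t.
pose al k := a * c k + b * d k; pose be k := b * c k - a * d k.
have bc : bmf (fun z : S * S => cos (\sum_(k < n) al k * tnth z.1 k +
    \sum_(k < n) be k * tnth z.2 k + t)).
  apply: bmf_cos; apply: measurable_funD => //; apply: measurable_funD;
    apply: measurable_sum => k; apply: measurable_funM => //.
    by apply: (measurableT_comp (@measurable_tnth _ R n k)).
  by apply: (measurableT_comp (@measurable_tnth _ R n k)).
transitivity (Ex (gam \x gam)%E (fun z : S * S =>
    cos (\sum_(k < n) al k * tnth z.1 k + \sum_(k < n) be k * tnth z.2 k + t))).
  apply: eq_Ex => z; congr (cos (_ + t)); rewrite -!big_split/=.
  by apply: eq_bigr => k _; rewrite !tnth_mktuple /al /be; ring.
rewrite Ex_prod1//=.
pose B : R := expR (- (\sum_(k < n) be k ^+ 2) / 2).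
transitivity (Ex gam (fun x => B * cos (\sum_(k < n) al k * tnth x k + t))).
  apply: eq_Ex => x.
  rewrite -[RHS](Ex_cos_tprod n be (\sum_(k < n) al k * tnth x k + t)).
  by apply: eq_Ex => y; congr cos; ring.
rewrite ExZ; last first.
  apply: bmf_cos; apply: measurable_funD => //; apply: measurable_sum => k.
  by apply: measurable_funM => //; exact: measurable_tnth.
rewrite Ex_cos_tprod /B mulrA -expRD; congr (expR _ * _).
rewrite -mulrDl -opprD -!big_split/=; congr (- _ / _).
apply: eq_bigr => k _; rewrite /al /be.
transitivity ((a ^+ 2 + b ^+ 2) * (c k ^+ 2 + d k ^+ 2)); first by ring.
by rewrite ab mul1r.
Qed.

Lemma Ex_stationary (a b : R) (f : S -> R) : a ^+ 2 + b ^+ 2 = 1 -> bmf f ->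
  Ex gam (fun x => Ex gam (fun e => f (lincomb a b x e))) = Ex gam f.
Proof.
move=> ab bf.
have bf1 : bmf (fun z : S * S => f z.1) by apply: (bmf_comp bf); exact: measurable_fst.
rewrite -(Ex_prod1 gam gam (bmf_lincomb a b bf)).
have := Ex_rotation ab bf1 => /= ->.
rewrite (Ex_prod1 gam gam bf1)/=; apply: eq_Ex => x.
by rewrite Ex_cst.
Qed.

Lemma lincombK (a b : R) (x e : S) : a ^+ 2 + b ^+ 2 = 1 ->
  lincomb a b (lincomb a b x e) (lincomb b (- a) x e) = x.
Proof.
move=> ab; apply: eq_from_tnth => k; rewrite !tnth_mktuple.
transitivity ((a ^+ 2 + b ^+ 2) * tnth x k); first by ring.
by rewrite ab mul1r.
Qed.

(** The reflection of [Ex_rotation] preserves the product law and exchanges a point with its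
    successor. *)
Lemma Ex_reversible (a b : R) (F : S * S -> R) : a ^+ 2 + b ^+ 2 = 1 -> bmf F ->
  Ex (gam \x gam)%E (fun z : S * S => F (z.1, lincomb a b z.1 z.2)) =
  Ex (gam \x gam)%E (fun z : S * S => F (lincomb a b z.1 z.2, z.1)).
Proof.
move=> ab bF.
have bG : bmf (fun z : S * S => F (lincomb a b z.1 z.2, z.1)).
  apply: (bmf_comp (h := fun z : S * S => (lincomb a b z.1 z.2, z.1)) bF).
  by apply: measurable_fun_pair => //; exact: measurable_lincomb.
rewrite -(Ex_rotation ab bG); apply: eq_Ex => z /=.
by rewrite lincombK.
Qed.

Definition sigr (r : R) : R := Num.sqrt (1 - r ^+ 2).

Lemma sigr_sqr r : 0 <= r <= 1 -> r ^+ 2 + sigr r ^+ 2 = 1.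
Proof. by move=> /andP[r0 r1]; rewrite sqr_sqrtr; [ring|nra]. Qed.

(** Mehler's formula, with the correlation [r = exp (- time)] as parameter, so that composition
    multiplies parameters. *)
Definition Pop (r : R) (f : S -> R) (x : S) : R :=
  Ex gam (fun e => f (lincomb r (sigr r) x e)).

Lemma bmf_Pop r f : bmf f -> bmf (Pop r f).
Proof. by move=> bf; exact: (bmf_Ex1 gam gam (bmf_lincomb r (sigr r) bf)). Qed.

Lemma Ex_Pop r f : 0 <= r <= 1 -> bmf f -> Ex gam (Pop r f) = Ex gam f.
Proof. by move=> r01 bf; apply: Ex_stationary => //; exact: sigr_sqr. Qed.

Lemma Pop_mono r f g x : bmf f -> bmf g -> (forall x, f x <= g x) ->
  Pop r f x <= Pop r g x.
Proof. by move=> bf bg fg; apply: Ex_le => //; exact: bmf_lincomb1. Qed.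

Lemma Pop_itv r f : bmf f -> (forall x, 0 <= f x <= 1) ->
  forall x, 0 <= Pop r f x <= 1.
Proof.
move=> bf f01 x; apply/andP; split.
  by apply: Ex_ge0 => e; have /andP[] := f01 (lincomb r (sigr r) x e).
rewrite -[leRHS](Ex_cst gam); apply: Ex_le; [exact: bmf_lincomb1|exact: bmf_cst|].
by move=> e; have /andP[] := f01 (lincomb r (sigr r) x e).
Qed.

(** Self-adjointness, from reversibility, moves one operator to the other side; the semigroup
    property then merges two steps of correlation [r] into one of correlation [r^2]. *)
Lemma Ex_PopM r f g : 0 <= r < 1 -> bmf f -> bmf g ->
  Ex gam (fun x => Pop r f x * Pop r g x) = Ex gam (fun x => f x * Pop (r ^+ 2) g x).
Proof.
move=> /andP[r0 r1] bf bg.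
have r01 : 0 <= r <= 1 by rewrite r0 ltW.
have ab := sigr_sqr r01; set s := sigr r in ab.
have bPg := bmf_Pop r bg.
have bF : bmf (fun z : S * S => f z.1 * Pop r g z.2).
  apply: bmfM; first by apply: (bmf_comp bf); exact: measurable_fst.
  by apply: (bmf_comp bPg); exact: measurable_snd.
transitivity (Ex (gam \x gam)%E (fun z : S * S =>
    f (lincomb r s z.1 z.2) * Pop r g z.1)).
  rewrite Ex_prod1/=; last first.
    apply: bmfM; first exact: bmf_lincomb.
    by apply: (bmf_comp bPg); exact: measurable_fst.
  apply: eq_Ex => x; rewrite mulrC -ExZ; last exact: bmf_lincomb1.
  by apply: eq_Ex => e; rewrite mulrC.
have bG : bmf (fun z : S * S => f z.2 * Pop r g z.1).
  apply: bmfM; first by apply: (bmf_comp bf); exact: measurable_snd.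
  by apply: (bmf_comp bPg); exact: measurable_fst.
rewrite (Ex_reversible ab bG)/= Ex_prod1/=; last first.
  apply: bmfM; first by apply: (bmf_comp bf); exact: measurable_fst.
  exact: bmf_lincomb.
apply: eq_Ex => x; rewrite ExZ; last exact: bmf_lincomb1.
congr (_ * _); rewrite /Pop -/s.
have s0 : 0 < s ^+ 2 by rewrite -[_ ^+ 2](addKr (r ^+ 2)) ab; nra.
set s2 := sigr (r ^+ 2).
have s2E : s2 ^+ 2 = 1 - r ^+ 4.
  by rewrite sqr_sqrtr -?exprM//; nra.
have s2p : 0 < s2 by rewrite sqrtr_gt0; nra.
(* The two independent innovations, of sizes [r s] and [s], add up to one of size [s2]; this is
   stationarity for the normalised weights. *)
have ab2 : (r * s / s2) ^+ 2 + (s / s2) ^+ 2 = 1.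
  rewrite !exprMn exprVn s2E (_ : s ^+ 2 = 1 - r ^+ 2); last by lra.
  by field; nra.
have bh : bmf (fun y => g (lincomb (r ^+ 2) s2 x y)) by exact: bmf_lincomb1.
rewrite -(Ex_stationary ab2 bh); apply: eq_Ex => w; apply: eq_Ex => e.
congr g; apply: eq_from_tnth => k; rewrite !tnth_mktuple.
by field; rewrite gt_eqF.
Qed.

End lincomb_theory.

(** * A lower bound for the Mehler kernel at small correlation *)

Section mehler.
Context {R : realType}.
Local Notation lb := (@lebesgue_measure R).
Local Notation phi := (normal_pdf (0:R) 1).

(** Relative to [stdN], the transition density is at least [exp (- r (x^2 + y^2))]: the prefactor
    [1 / sqrt (1 - r^2)] is at least 1, and for [r <= 1/2] the exponents compare by elementary
    algebra. *)
Lemma mehler_lower_bound1 (r x : R) (h : R -> R) : 0 <= r <= 1 / 2 -> bmf h ->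
  (forall y, 0 <= h y) ->
  Ex stdN (fun y => h y * expR (- r * (x ^+ 2 + y ^+ 2))) <=
  Ex stdN (fun e => h (r * x + sigr r * e)).
Proof.
move=> /andP[r0 r2] bh h0.
have r01 : 0 <= r <= 1 by rewrite r0; lra.
have sE := sigr_sqr r01; set s := sigr r in sE *.
have s0 : 0 < s by rewrite sqrtr_gt0; nra.
have s1 : s <= 1 by nra.
have mphi := @measurable_normal_pdf R 0 1.
have me : measurable_fun [set: R] (fun y : R => expR (- r * (x ^+ 2 + y ^+ 2))).
  apply: measurableT_comp => //; apply: measurable_funM => //.
  exact: measurable_funD.
have be : bmf (fun y : R => expR (- r * (x ^+ 2 + y ^+ 2))).
  split => //; exists 1 => y; rewrite ger0_norm ?expR_ge0// -[X in _ <= X]expR0.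
  by rewrite ler_expR; have := sqr_ge0 x; have := sqr_ge0 y; nra.
have b1 := bmfM bh be.
have ma : measurable_fun [set: R] (fun e => r * x + s * e).
  by apply: measurable_funD => //; exact: measurable_funM.
have b2 : bmf (fun e => h (r * x + s * e)) by exact: (bmf_comp bh ma).
have mai : measurable_fun [set: R] (fun y => (y - r * x) / s).
  by apply: measurable_funM => //; exact: measurable_funB.
pose F y := h y * (phi ((y - r * x) / s) / s).
have mF : measurable_fun [set: R] F.
  apply: measurable_funM; first exact: bh.1.
  apply: measurable_funM => //.
  exact: (measurableT_comp (f := phi) _ mai).
have F0 y : 0 <= F y by rewrite !mulr_ge0 ?normal_pdf_ge0// invr_ge0 ltW.
rewrite -lee_fin !ExE// !ge0_integral_stdN//; last 4 first.
- by apply/measurable_EFinP; exact: b2.1.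
- by move=> y; rewrite lee_fin.
- by apply/measurable_EFinP; exact: b1.1.
- by move=> y; rewrite lee_fin mulr_ge0// expR_ge0.
have -> : (\int[lb]_y ((h (r * x + s * y))%:E * (phi y)%:E) =
    \int[lb]_y (F y)%:E)%E.
  rewrite (ge0_integral_affine (r * x) s0 (f := fun y => (F y)%:E)); last 2 first.
  - exact/measurable_EFinP.
  - by move=> y; rewrite lee_fin.
  rewrite -ge0_integralZl//=.
  - apply: eq_integral => y _; rewrite -!EFinM; congr EFin; rewrite /F.
    have -> : (r * x + s * y - r * x) / s = y by field; rewrite gt_eqF.
    by field; rewrite gt_eqF.
  - by apply/measurable_EFinP; exact: (measurableT_comp mF).
  - by move=> y _; rewrite lee_fin.
  - by rewrite lee_fin ltW.
apply: ge0_le_integral => //=.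
- by move=> y _; rewrite lee_fin !mulr_ge0 ?expR_ge0 ?normal_pdf_ge0.
- by apply: emeasurable_funM; apply/measurable_EFinP => //; exact: b1.1.
- exact/measurable_EFinP.
move=> y _; rewrite -EFinM lee_fin /F -mulrA ler_wpM2l//.
rewrite !normal_pdf01E.
have c0 : 0 < (Num.sqrt (2 * pi))^-1 :> R.
  by rewrite invr_gt0 sqrtr_gt0 mulr_gt0// pi_gt0.
rewrite mulrCA -[leRHS]mulrA ler_pM2l// -expRD.
apply: (@le_trans _ _ (expR (- ((y - r * x) / s) ^+ 2 / 2))); last first.
  by rewrite ler_peMr ?expR_ge0// invf_ge1.
rewrite ler_expR exprMn exprVn.
have s2p : 0 < s ^+ 2 by rewrite exprn_gt0.
have -> : - ((y - r * x) ^+ 2 / s ^+ 2) / 2 = - ((y - r * x) ^+ 2 / (2 * s ^+ 2)).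
  by field; rewrite gt_eqF.
have -> : - r * (x ^+ 2 + y ^+ 2) + - y ^+ 2 / 2 =
  - ((r * (x ^+ 2 + y ^+ 2) + y ^+ 2 / 2)) by field.
rewrite lerN2 ler_pdivrMr ?mulr_gt0//.
have -> : s ^+ 2 = 1 - r ^+ 2 by lra.
have h1 : 0 <= r * (x + y) ^+ 2 by rewrite mulr_ge0// sqr_ge0.
have h2 : r ^+ 2 <= r / 2 by nra.
have h3 : 2 * r ^+ 3 <= r / 2 by nra.
have h4 : 0 <= x ^+ 2 + y ^+ 2 by rewrite addr_ge0// sqr_ge0.
nra.
Qed.

(** The one-dimensional bound tensorises, since squared norms add and the coordinates move
    independently. *)
Lemma mehler_lower_bound (n : nat) (r : R) (x : n.-tuple R) (f : n.-tuple R -> R) :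
  0 <= r <= 1 / 2 -> bmf f -> (forall y, 0 <= f y) ->
  Ex (tprod stdN n) (fun y => f y * expR (- r * (sqnorm x + sqnorm y))) <= Pop r f x.
Proof.
move=> r2; elim: n x f => [|n IH] x f bf f0.
  rewrite /Pop le_eqVlt; apply/orP; left; apply/eqP; apply: eq_Ex => y.
  rewrite /sqnorm !big_ord0 addr0 mulr0 expR0 mulr1; congr f.
  by apply: eq_from_tnth => -[].
have r0 : 0 <= r by case/andP: r2.
have sn0 l (v : l.-tuple R) : 0 <= sqnorm v by apply: sumr_ge0 => k _; exact: sqr_ge0.
pose x0 := tnth x ord0; pose xt : n.-tuple R := [tuple of behead x].
have xE : x = tcons (x0, xt) by apply: eq_from_tnth => k; rewrite [in LHS](tuple_eta x).
have snE (z : R) (v : n.-tuple R) : sqnorm (tcons (z, v)) = z ^+ 2 + sqnorm v.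
  by rewrite /sqnorm big_ord_recl; congr (_ + _); apply: eq_bigr => k _; rewrite tnthS.
have be l (c : R) : bmf (fun y : l.-tuple R => expR (- r * (`|c| + sqnorm y))).
  split.
    apply: measurableT_comp => //; apply: measurable_funM => //.
    by apply: measurable_funD => //; exact: measurable_sqnorm.
  exists 1 => y; rewrite ger0_norm ?expR_ge0// -[X in _ <= X]expR0 ler_expR.
  by rewrite mulNr oppr_le0 mulr_ge0// addr_ge0.
have be' l (v : l.-tuple R) : bmf (fun y : l.-tuple R => expR (- r * (sqnorm v + sqnorm y))).
  by have := be l (sqnorm v); rewrite ger0_norm.
have bfc : bmf (fun z : R * n.-tuple R => f (tcons z)).
  by apply: (bmf_comp bf); exact: measurable_tcons.
have bfc1 z : bmf (fun v => f (tcons (z, v))).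
  by apply: (bmf_comp bfc); exact: pair1_measurable.
pose h z := Ex (tprod stdN n) (fun v => f (tcons (z, v)) * expR (- r * (sqnorm xt + sqnorm v))).
have bH : bmf (fun zv : R * n.-tuple R =>
    f (tcons zv) * expR (- r * (sqnorm xt + sqnorm zv.2))).
  by apply: bmfM => //; apply: (bmf_comp (be' n xt)); exact: measurable_snd.
have bh : bmf h by exact: (bmf_Ex1 stdN (tprod stdN n) bH).
have h0 z : 0 <= h z by apply: Ex_ge0 => v; rewrite mulr_ge0// expR_ge0.
rewrite Ex_tprodS; last exact: bmfM.
apply: (@le_trans _ _ (Ex stdN (fun z => h z * expR (- r * (x0 ^+ 2 + z ^+ 2))))).
  rewrite le_eqVlt; apply/orP; left; apply/eqP; apply: eq_Ex => z.
  rewrite [RHS]mulrC -ExZ; last by apply: bmfM => //; exact: be'.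
  apply: eq_Ex => v; rewrite xE !snE mulrCA -expRD; congr (_ * expR _); ring.
apply: le_trans (mehler_lower_bound1 x0 r2 bh h0) _.
rewrite /Pop Ex_tprodS; last exact: bmf_lincomb1.
have bcc : bmf (fun e : R => Ex (tprod stdN n)
    (fun v => f (lincomb r (sigr r) x (tcons (e, v))))).
  apply: (bmf_Ex1 stdN (tprod stdN n) (f := fun ev => f (lincomb r (sigr r) x (tcons ev)))).
  by apply: (bmf_comp (bmf_lincomb1 r (sigr r) x bf)); exact: measurable_tcons.
apply: Ex_le => //.
  apply: (bmf_comp bh (h := fun e => r * x0 + sigr r * e)).
  by apply: measurable_funD => //; exact: measurable_funM.
move=> e; apply: le_trans (IH xt _ (bfc1 (r * x0 + sigr r * e)) _) _ => //.
rewrite /Pop le_eqVlt; apply/orP; left; apply/eqP; apply: eq_Ex => v; congr f.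
apply: eq_from_tnth => k; rewrite [RHS]tnth_mktuple xE.
by case: (unliftP ord0 k) => [j ->|->]; rewrite ?tnthS ?tnth_mktuple.
Qed.

Lemma Ex_expR_sqnorm (n : nat) (r : R) : 0 <= r ->
  Ex (tprod stdN n) (fun y => expR (- r * sqnorm y)) = (Num.sqrt (1 + 2 * r))^-1 ^+ n.
Proof.
move=> r0; elim: n => [|n IH].
  rewrite expr0 -[RHS](Ex_cst (tprod (@stdN R) 0)); apply: eq_Ex => y.
  by rewrite /sqnorm big_ord0 mulr0 expR0.
have be l : bmf (fun y : l.-tuple R => expR (- r * sqnorm y)).
  split.
    apply: measurableT_comp => //; apply: measurable_funM => //.
    exact: measurable_sqnorm.
  exists 1 => y; rewrite ger0_norm ?expR_ge0// -[X in _ <= X]expR0 ler_expR.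
  rewrite mulNr oppr_le0 mulr_ge0//.
  by apply: sumr_ge0 => k _; exact: sqr_ge0.
have b1 : bmf (fun y : R => expR (- r * y ^+ 2)).
  split; first by apply: measurableT_comp => //; exact: measurable_funM.
  exists 1 => y; rewrite ger0_norm ?expR_ge0// -[X in _ <= X]expR0 ler_expR.
  by rewrite mulNr oppr_le0 mulr_ge0// sqr_ge0.
rewrite Ex_tprodS// exprS -IH.
transitivity (Ex stdN (fun x : R => Ex (tprod stdN n) (fun y => expR (- r * sqnorm y)) *
   expR (- r * x ^+ 2))).
  apply: eq_Ex => x; rewrite /= [RHS]mulrC -(ExZ _ _ (be n)); apply: eq_Ex => v.
  rewrite -expRD -mulrDr; congr (expR (_ * _)).
  by rewrite /sqnorm big_ord_recl; congr (_ + _); apply: eq_bigr => k _; rewrite tnthS.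
rewrite ExZ// mulrC; congr (_ * _); apply: EFin_inj; rewrite ExE//.
by rewrite ge0_expR_sqr_stdN; [congr (_^-1)%:E; congr Num.sqrt; ring|lra].
Qed.

End mehler.

(** * Dimension-free contraction of the centred part *)

Section spectral_gap.
Context {R : realType} (n : nat).
Local Notation S := (n.-tuple R).
Local Notation gam := (tprod (@stdN R) n).
Implicit Types f : S -> R.

(** The kernel bound is applied to [1 - f]: a lower bound on its image is an upper bound on the
    image of [f]. *)
Lemma Pop_mixing (r : R) f x : 0 <= r <= 1 / 2 -> bmf f -> (forall x, 0 <= f x <= 1) ->
  Pop r f x - Ex gam f <= 1 - (Num.sqrt (1 + 2 * r))^-1 ^+ n * expR (- r * sqnorm x).
Proof.
move=> r2 bf f01; have r0 : 0 <= r by case/andP: r2.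
have be : bmf (fun y : S => expR (- r * sqnorm y)).
  split.
    apply: measurableT_comp => //; apply: measurable_funM => //.
    exact: measurable_sqnorm.
  exists 1 => y; rewrite ger0_norm ?expR_ge0// -[X in _ <= X]expR0 ler_expR.
  rewrite mulNr oppr_le0 mulr_ge0//.
  by apply: sumr_ge0 => k _; exact: sqr_ge0.
have bg : bmf (fun y => 1 - f y) by apply: bmfB => //; exact: bmf_cst.
have g0 y : 0 <= 1 - f y by rewrite subr_ge0; case/andP: (f01 y).
have := mehler_lower_bound x r2 bg g0.
have -> : Pop r (fun y => 1 - f y) x = 1 - Pop r f x.
  by rewrite /Pop ExB ?Ex_cst//; [exact: bmf_cst|exact: bmf_lincomb1].
set c := expR (- r * sqnorm x).
have c01 : c <= 1.
  rewrite -[X in _ <= X]expR0 ler_expR mulNr oppr_le0 mulr_ge0//.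
  by apply: sumr_ge0 => k _; exact: sqr_ge0.
have c0 : 0 < c by exact: expR_gt0.
have -> : Ex gam (fun y => (1 - f y) * expR (- r * (sqnorm x + sqnorm y))) =
    c * (Ex gam (fun y => expR (- r * sqnorm y)) -
         Ex gam (fun y => f y * expR (- r * sqnorm y))).
  rewrite -ExB//; last exact: bmfM.
  rewrite -ExZ; last by apply: bmfB => //; exact: bmfM.
  by apply: eq_Ex => y; rewrite mulrDr expRD -/c; ring.
rewrite Ex_expR_sqnorm//.
set q := _ ^+ n; set u := Ex gam (fun y => _ * _) => H.
have u1 : u <= Ex gam f.
  apply: Ex_le => //; first exact: bmfM.
  move=> y; rewrite ler_piMr//; first by case/andP: (f01 y).
  rewrite -[X in _ <= X]expR0 ler_expR mulNr oppr_le0 mulr_ge0//.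
  by apply: sumr_ge0 => k _; exact: sqr_ge0.
have u0 : 0 <= u.
  by apply: Ex_ge0 => y; rewrite mulr_ge0 ?expR_ge0//; case/andP: (f01 y).
nra.
Qed.

(** Averaging [Pop_mixing] over [x] squares the normalising factor, and
    [(1 + 2 r)^(- n) >= 1 - 2 n r]. The dimension in the constant is harmless; what matters is that
    the bound vanishes linearly in [r]. *)
Lemma cov_Pop_le (r : R) f : 0 <= r <= 1 / 2 -> bmf f -> (forall x, 0 <= f x <= 1) ->
  Ex gam (fun x => f x * Pop r f x) - Ex gam f ^+ 2 <= 2 * n%:R * r.
Proof.
move=> r2 bf f01; have r0 : 0 <= r by case/andP: r2.
set q := (Num.sqrt (1 + 2 * r))^-1 ^+ n.
have bP := bmf_Pop r bf.
have be : bmf (fun y : S => expR (- r * sqnorm y)).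
  split.
    apply: measurableT_comp => //; apply: measurable_funM => //.
    exact: measurable_sqnorm.
  exists 1 => y; rewrite ger0_norm ?expR_ge0// -[X in _ <= X]expR0 ler_expR.
  rewrite mulNr oppr_le0 mulr_ge0//.
  by apply: sumr_ge0 => k _; exact: sqr_ge0.
have e1 (x : S) : expR (- r * sqnorm x) <= 1.
  rewrite -[X in _ <= X]expR0 ler_expR mulNr oppr_le0 mulr_ge0//.
  by apply: sumr_ge0 => k _; exact: sqr_ge0.
have s1 : 1 <= Num.sqrt (1 + 2 * r).
  by rewrite -[leLHS]sqrtr1 ler_sqrt//; lra.
have q01 : 0 <= q <= 1.
  by rewrite exprn_ge0 ?invr_ge0 ?sqrtr_ge0//= exprn_ile1// ?invr_ge0 ?sqrtr_ge0// invf_le1//; lra.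
have -> : Ex gam (fun x => f x * Pop r f x) - Ex gam f ^+ 2 =
    Ex gam (fun x => f x * (Pop r f x - Ex gam f)).
  rewrite expr2 -ExZ// -ExB; [|exact: bmfM|exact: bmfZ].
  by apply: eq_Ex => x; ring.
apply: (@le_trans _ _ (Ex gam (fun x => 1 - q * expR (- r * sqnorm x)))).
  apply: Ex_le.
  - by apply: bmfM => //; apply: bmfB => //; exact: bmf_cst.
  - by apply: bmfB; [exact: bmf_cst|exact: bmfZ].
  move=> x; have /andP[f0 f1] := f01 x.
  have h := Pop_mixing x r2 bf f01; rewrite -/q in h.
  have h2 : 0 <= 1 - q * expR (- r * sqnorm x).
    rewrite subr_ge0 mulr_ile1 ?expR_ge0//; by case/andP: q01.
  have [p0|p0] := leP 0 (Pop r f x - Ex gam f); first by nra.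
  by rewrite (le_trans _ h2)// mulr_ge0_le0// ltW.
rewrite ExB ?Ex_cst ?ExZ ?Ex_expR_sqnorm//; last 2 first.
- exact: bmf_cst.
- exact: bmfZ.
rewrite -/q -expr2 /q -exprM mulnC exprM exprVn sqr_sqrtr; last by lra.
have q2 : 1 - 2 * r <= (1 + 2 * r)^-1.
  by rewrite -[leRHS]mul1r ler_pdivlMr; nra.
have pw (k : nat) : 1 - 2 * k%:R * r <= (1 + 2 * r)^-1 ^+ k.
  elim: k => [|k IH]; first by rewrite mulr0 mul0r subr0 expr0.
  have i0 : 0 < (1 + 2 * r)^-1 by rewrite invr_gt0; lra.
  have i1 : (1 + 2 * r)^-1 <= 1 by rewrite invf_le1; lra.
  have k0 : 0 <= k%:R * r by rewrite mulr_ge0.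
  by rewrite exprS -natr1; nra.
by have := pw n; lra.
Qed.

Lemma Ex_sqr_center f : bmf f ->
  Ex gam (fun x => (f x - Ex gam f) ^+ 2) = Ex gam (fun x => f x ^+ 2) - Ex gam f ^+ 2.
Proof.
move=> bf; have b2 := bmfX 2 bf; set m := Ex gam f.
have bm := bmfZ (2 * m) bf.
transitivity (Ex gam (fun x => f x ^+ 2 - 2 * m * f x + m ^+ 2)).
  by apply: eq_Ex => x; ring.
rewrite ExD; [|exact: bmfB|exact: bmf_cst].
by rewrite ExB// ExZ// Ex_cst -/m; ring.
Qed.

(** Iterating the squaring inequality amounts to taking the [2^k]-th root of the linear bound
    [cov_Pop_le]: its constant disappears in the limit and the sharp rate [r] is left. *)
Lemma cov_Pop_gap (r : R) f : 0 <= r < 1 -> bmf f -> (forall x, 0 <= f x <= 1) ->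
  Ex gam (fun x => f x * Pop r f x) - Ex gam f ^+ 2 <=
  r * (Ex gam (fun x => (f x - Ex gam f) ^+ 2)).
Proof.
move=> /andP[r0 r1] bf f01.
pose b t := Ex gam (fun x => f x * Pop t f x) - Ex gam f ^+ 2.
set V := Ex gam (fun x => (f x - Ex gam f) ^+ 2); rewrite -/(b r).
have V0 : 0 <= V by apply: Ex_ge0 => x; exact: sqr_ge0.
set m := Ex gam f in V V0 b *.
have bE t : 0 <= t <= 1 -> b t = Ex gam (fun x => (f x - m) * (Pop t f x - m)).
  move=> t01; have bP := bmf_Pop t bf; have bfP := bmfM bf bP.
  transitivity (Ex gam (fun x => f x * Pop t f x - m * f x - m * Pop t f x + m ^+ 2)).
    have bmf1 := bmfZ m bf; have bmP := bmfZ m bP.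
    have b12 := bmfB bfP bmf1.
    rewrite ExD; [|exact: bmfB|exact: bmf_cst].
    rewrite Ex_cst ExB// ExB// (ExZ _ m bf) (ExZ _ m bP) Ex_Pop// -/m /b -/m; ring.
  by apply: eq_Ex => x; ring.
have b2E t : 0 <= t < 1 -> Ex gam (fun x => (Pop t f x - m) ^+ 2) = b (t ^+ 2).
  move=> /andP[t0 t1]; have bP := bmf_Pop t bf.
  have t01 : 0 <= t <= 1 by rewrite t0 ltW.
  have := Ex_sqr_center bP; rewrite (Ex_Pop t01 bf) -/m => ->.
  transitivity (Ex gam (fun x => Pop t f x * Pop t f x) - m ^+ 2).
    by congr (_ - _); apply: eq_Ex => x; rewrite expr2.
  by rewrite Ex_PopM ?t0.
have covb t : 0 <= t <= 1 / 2 -> b t <= 2 * n%:R * t.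
  by move=> t2; exact: cov_Pop_le.
move: b bE b2E covb => b bE b2E covb.
have bsq t : 0 <= t < 1 -> b t ^+ 2 <= V * b (t ^+ 2).
  move=> t01; have t01' : 0 <= t <= 1 by case/andP: t01 => -> /ltW ->.
  rewrite bE// -b2E//; apply: Ex_CS; apply: bmfB => //; try exact: bmf_cst.
  exact: bmf_Pop.
have [Vz|Vn] := eqVneq V 0.
  have := bsq r; rewrite r0 r1 Vz mul0r mulr0 => /(_ isT).
  by move=> h; nra.
have Vp : 0 < V by rewrite lt_def Vn.
rewrite leNgt; apply/negP => rVb.
have rp : 0 < r.
  rewrite lt_def r0 andbT; apply/eqP => rz.
  move: rVb; rewrite rz mul0r => b0.
  have : b 0 <= 2 * n%:R * 0 by apply: covb; rewrite lexx/=; lra.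
  by rewrite mulr0 leNgt b0.
have t01 k : 0 <= r ^+ (2 ^ k) < 1.
  by rewrite exprn_ge0//= exprn_ilt1// -lt0n expn_gt0.
(* Each squaring of the covariance squares the parameter, which thus reaches the range of the linear
   bound. *)
have pw k : (b r) ^+ (2 ^ k) <= V ^+ (2 ^ k).-1 * b (r ^+ (2 ^ k)).
  elim: k => [|k IH]; first by rewrite !expn0 !expr1 expr0 mul1r.
  have b0 : 0 <= (b r) ^+ (2 ^ k).
    by rewrite exprn_ge0// ltW// (le_lt_trans _ rVb)// mulr_ge0.
  have h1 : ((b r) ^+ (2 ^ k)) ^+ 2 <= (V ^+ (2 ^ k).-1 * b (r ^+ (2 ^ k))) ^+ 2.
    by rewrite lerXn2r// nnegrE// (le_trans b0).
  rewrite expnSr exprM (le_trans h1)// exprMn -exprM.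
  have -> : V ^+ (2 ^ k * 2).-1 = V ^+ ((2 ^ k).-1 * 2) * V.
    rewrite -exprSr; congr (_ ^+ _).
    by case: (2 ^ k)%N (expn_gt0 2 k) => // a _; rewrite /= mulSn.
  rewrite -[leRHS]mulrA ler_wpM2l ?exprn_ge0// exprM.
  exact: bsq.
(* If this ratio exceeded 1, its powers [a^(2^k)] would still be bounded by [2 n / V], because the
   factor [r^(2^k)] of the linear bound cancels exactly. Bernoulli's inequality refutes this. *)
pose a := b r / (r * V).
have rV : 0 < r * V by rewrite mulr_gt0.
have a1 : 1 < a by rewrite ltr_pdivlMr// mul1r.
have bnd k : r ^+ (2 ^ k) <= 1 / 2 -> a ^+ (2 ^ k) * V <= 2 * n%:R.
  move=> rk2; have := covb (r ^+ (2 ^ k)); rewrite rk2 exprn_ge0//= => /(_ isT) h.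
  have := pw k; rewrite /a expr_div_n exprMn => h2.
  have V2 : V ^+ (2 ^ k) = V ^+ (2 ^ k).-1 * V.
    by rewrite -exprSr prednK// expn_gt0.
  have rkp : 0 < r ^+ (2 ^ k) by rewrite exprn_gt0.
  have Vkp : 0 < V ^+ (2 ^ k).-1 by rewrite exprn_gt0.
  rewrite V2 mulrAC ler_pdivrMr ?mulr_gt0//.
  rewrite [leRHS](_ : _ = (V ^+ (2 ^ k).-1 * (2 * n%:R * r ^+ (2 ^ k))) * V); last by ring.
  rewrite ler_pM2r// (le_trans h2)// ler_pM2l//.
have ge1 (c : R) (k : nat) : 1 + c * k%:R <= (1 + c) ^+ k \/ c < 0.
  have [c0|] := leP 0 c; last by right.
  left; elim: k => [|k IH]; first by rewrite mulr0 addr0.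
  have : 0 <= c * k%:R by rewrite mulr_ge0.
  by rewrite exprS -natr1; nra.
have [K1 HK1] : exists K : nat, forall k, (K <= k)%N -> r ^+ k <= 1 / 2.
  have := cvg_expr (z := r); rewrite ger0_norm// => /(_ r1) /cvgr0_norm_le.
  move=> /(_ (1 / 2)) [|K _ HK]; first by lra.
  by exists K => k Kk; have := HK k Kk; rewrite /= ger0_norm// exprn_ge0.
pose K2 := (Num.truncn (2 * n%:R / V / (a - 1))).+1.
pose k := maxn K1 K2.
have kk : (k <= 2 ^ k)%N by apply: ltnW; exact: ltn_expl.
have := bnd k; rewrite HK1 ?(leq_trans _ kk) ?leq_maxl// => /(_ isT).
apply/negP; rewrite -ltNge -ltr_pdivrMr//.
have a0 : 0 < a - 1 by rewrite subr_gt0.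
have K2h : 2 * n%:R / V / (a - 1) < K2%:R by exact: truncnS_gt.
have K2k : (K2 <= 2 ^ k)%N by rewrite (leq_trans _ kk)// leq_maxr.
move: (2 ^ k)%N K2k => N K2k.
have := ge1 (a - 1) N; rewrite (addrC 1 (a - 1)) subrK => -[h|]; last by rewrite ltNge ltW.
apply: lt_le_trans h; rewrite ltr_pdivrMr// in K2h.
apply: (lt_le_trans K2h); rewrite mulrC.
apply: (@le_trans _ _ ((a - 1) * N%:R)); first by rewrite ler_pM2l// ler_nat.
by rewrite lerDr ler01.
Qed.

Lemma Pop_contraction (r : R) f : 0 <= r < 1 -> bmf f -> (forall x, 0 <= f x <= 1) ->
  Ex gam (fun x => (Pop r f x - Ex gam f) ^+ 2) <=
  r ^+ 2 * Ex gam (fun x => (f x - Ex gam f) ^+ 2).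
Proof.
move=> /andP[r0 r1] bf f01; have bP := bmf_Pop r bf.
have r01 : 0 <= r <= 1 by rewrite r0 ltW.
have := Ex_sqr_center bP; rewrite (Ex_Pop r01 bf) => ->.
have -> : Ex gam (fun x => Pop r f x ^+ 2) = Ex gam (fun x => f x * Pop (r ^+ 2) f x).
  by rewrite -Ex_PopM ?r0//; apply: eq_Ex => x; rewrite expr2.
by apply: cov_Pop_gap => //; rewrite exprn_ge0//= exprn_ilt1.
Qed.

(** The contraction is available for functions with values in [[0, 1]], so this range and the mean
    are carried through the induction. *)
Lemma iter_Pop_contraction (r : R) f h : 0 <= r < 1 -> bmf f ->
  (forall x, 0 <= f x <= 1) ->
  [/\ bmf (iter h (Pop r) f), (forall x, 0 <= iter h (Pop r) f x <= 1),
   Ex gam (iter h (Pop r) f) = Ex gam f &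
   Ex gam (fun x => (iter h (Pop r) f x - Ex gam f) ^+ 2) <= (r ^+ h) ^+ 2].
Proof.
move=> r01 bf f01; have r01' : 0 <= r <= 1 by case/andP: r01 => -> /ltW ->.
elim: h => [|h [b1 b2 b3 b4]] /=.
  split => //; rewrite expr0 expr1n -[leRHS](Ex_cst gam); apply: Ex_le.
  - by apply: bmfX; apply: bmfB => //; exact: bmf_cst.
  - exact: bmf_cst.
  move=> x; have /andP[f0 f1] := f01 x.
  have m0 : 0 <= Ex gam f by apply: Ex_ge0 => y; case/andP: (f01 y).
  have m1 : Ex gam f <= 1.
    rewrite -[leRHS](Ex_cst gam); apply: Ex_le => //; first exact: bmf_cst.
    by move=> y; case/andP: (f01 y).
  nra.
have b3' : Ex gam (Pop r (iter h (Pop r) f)) = Ex gam f by rewrite Ex_Pop.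
split => //; [exact: bmf_Pop|exact: Pop_itv|].
have := Pop_contraction r01 b1 b2; rewrite b3 => /le_trans; apply.
by rewrite [r ^+ h.+1]exprS exprMn ler_wpM2l// sqr_ge0.
Qed.

End spectral_gap.

(** * Survival probabilities of the stationary chain *)

Section poisson.
Context {R : realType} (n : nat).
Local Notation S := (n.-tuple R).
Local Notation gam := (tprod (@stdN R) n).
Variables (r : R) (D : set (S * S)).
Hypotheses (r01 : 0 <= r < 1) (mD : measurable D).
Hypothesis symD : forall x y, D (x, y) -> D (y, x).

Local Notation d := (\1_D : S * S -> R).
Local Notation step := (lincomb r (sigr r)).

Definition hit_prob (x : S) : R := Ex gam (fun e => d (x, step x e)).

Fixpoint survival (j : nat) (x : S) : R :=
  if j is j'.+1 then Ex gam (fun e => (1 - d (x, step x e)) * survival j' (step x e))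
  else 1.

Let r1 : 0 <= r <= 1. Proof. by case/andP: r01 => -> /ltW ->. Qed.

Lemma bmf_step (F : S * S -> R) : bmf F ->
  bmf (fun z : S * S => F (z.1, step z.1 z.2)).
Proof.
move=> bF; apply: (bmf_comp (h := fun z : S * S => (z.1, step z.1 z.2)) bF).
by apply: measurable_fun_pair => //; exact: measurable_lincomb.
Qed.

Lemma bmf_step1 (F : S * S -> R) x : bmf F -> bmf (fun e => F (x, step x e)).
Proof.
move=> bF; apply: (bmf_comp (h := fun e => (x, e)) (bmf_step bF)).
exact: pair1_measurable.
Qed.

Lemma bmf_Ex_step (F : S * S -> R) : bmf F ->
  bmf (fun x => Ex gam (fun e => F (x, step x e))).
Proof. by move=> bF; exact: (bmf_Ex1 gam gam (bmf_step bF)). Qed.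

Let bd : bmf d. Proof. exact: bmf_indic. Qed.

Let d01 z : 0 <= d z <= 1.
Proof. by rewrite indicE; case: (_ \in _); rewrite lexx ler01. Qed.

Let bnd : bmf (fun z => 1 - d z).
Proof. by apply: bmfB => //; exact: bmf_cst. Qed.

Lemma bmf_hit_prob : bmf hit_prob.
Proof. exact: (bmf_Ex_step bd). Qed.

Lemma Ex_itv (T' : S -> R) : bmf T' -> (forall x, 0 <= T' x <= 1) -> 0 <= Ex gam T' <= 1.
Proof.
move=> bT T01; apply/andP; split; first by apply: Ex_ge0 => x; case/andP: (T01 x).
rewrite -[leRHS](Ex_cst gam); apply: Ex_le => //; first exact: bmf_cst.
by move=> x; case/andP: (T01 x).
Qed.

Lemma hit_prob_itv x : 0 <= hit_prob x <= 1.
Proof. by apply: Ex_itv => [|e]; [exact: (bmf_step1 _ bd)|exact: d01]. Qed.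

Let bmf_snd (W : S -> R) : bmf W -> bmf (fun z : S * S => W z.2).
Proof. by move=> bW; apply: (bmf_comp bW); exact: measurable_snd. Qed.

Lemma survival_bmf_itv j : bmf (survival j) /\ forall x, 0 <= survival j x <= 1.
Proof.
elim: j => [|j [bW W01]]; first by split=> [|x]; [exact: bmf_cst|rewrite /= ler01 lexx].
have bF : bmf (fun z : S * S => (1 - d z) * survival j z.2).
  by apply: bmfM => //; exact: bmf_snd.
split; first exact: (bmf_Ex_step bF).
move=> x; apply: Ex_itv => [|e]; first exact: (bmf_step1 _ bF).
have /andP[d0 d1] := d01 (x, step x e); have /andP[w0 w1] := W01 (step x e).
by rewrite mulr_ge0 ?subr_ge0//= mulr_ile1 ?subr_ge0// gerBl.
Qed.

Let bW j := (survival_bmf_itv j).1.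
Let W01 j := (survival_bmf_itv j).2.

Lemma survivalS_le j x : survival j.+1 x <= Pop r (survival j) x.
Proof.
have bF : bmf (fun z : S * S => (1 - d z) * survival j z.2).
  by apply: bmfM => //; exact: bmf_snd.
apply: Ex_le; [exact: (bmf_step1 _ bF)|exact: bmf_lincomb1|].
move=> e; have /andP[d0 d1] := d01 (x, step x e).
by have /andP[w0 w1] := W01 j (step x e); rewrite ler_piMl// gerBl.
Qed.

Lemma survivalS_ge j x : Pop r (survival j) x - hit_prob x <= survival j.+1 x.
Proof.
have bF : bmf (fun z : S * S => (1 - d z) * survival j z.2).
  by apply: bmfM => //; exact: bmf_snd.
rewrite -ExB; [|exact: bmf_lincomb1|exact: (bmf_step1 _ bd)].
apply: Ex_le; [|exact: (bmf_step1 _ bF)|].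
  by apply: bmfB; [exact: bmf_lincomb1|exact: (bmf_step1 _ bd)].
move=> e; have /andP[d0 d1] := d01 (x, step x e).
by have /andP[w0 w1] := W01 j (step x e); rewrite mulrBl mul1r lerB// ler_piMr.
Qed.

Lemma bmf_iter_Pop (f : S -> R) h : bmf f -> bmf (iter h (Pop r) f).
Proof. by move=> bf; elim: h => //= h bh; exact: bmf_Pop. Qed.

(** Dropping the constraint of no hit during the initial [h] steps can only increase survival, and
    by at most the sum of the hit probabilities of those steps. *)
Lemma survival_sandwich j h x :
  survival (h + j) x <= iter h (Pop r) (survival j) x /\
  iter h (Pop r) (survival j) x - \sum_(i < h) iter i (Pop r) hit_prob x
    <= survival (h + j) x.
Proof.
elim: h x => [|h IH] x; first by rewrite big_ord0 subr0.
have bI := bmf_iter_Pop h (bW j).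
have bS : bmf (fun x => \sum_(i < h) iter i (Pop r) hit_prob x).
  by apply: bmf_sum => i; apply: bmf_iter_Pop; exact: bmf_hit_prob.
split.
  apply: (le_trans (survivalS_le _ _)); apply: Pop_mono => // y.
  by case: (IH y).
apply: le_trans (survivalS_ge _ _).
have -> : \sum_(i < h.+1) iter i (Pop r) hit_prob x =
    hit_prob x + Pop r (fun x => \sum_(i < h) iter i (Pop r) hit_prob x) x.
  rewrite big_ord_recl; congr (_ + _).
  rewrite /Pop Ex_sum// => i; apply: bmf_lincomb1; apply: bmf_iter_Pop.
  exact: bmf_hit_prob.
rewrite opprD addrA addrAC lerD2r iterS.
rewrite /Pop -(ExB gam (bmf_lincomb1 r (sigr r) x bI) (bmf_lincomb1 r (sigr r) x bS)).
apply: Ex_le; last by move=> e; case: (IH (step x e)).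
  by apply: bmfB; [exact: (bmf_lincomb1 _ _ x bI)|exact: (bmf_lincomb1 _ _ x bS)].
exact: (bmf_lincomb1 _ _ x (bW (h + j))).
Qed.

(** The loss is a hit in the initial step followed by survival. Reversing that step makes hit and
    survival start from the same point with independent innovations, so their joint probability is
    the mean of a product. *)
Lemma Ex_survivalS j :
  Ex gam (survival j.+1) = Ex gam (survival j) - Ex gam (fun x => hit_prob x * survival j x).
Proof.
have bF : bmf (fun z : S * S => (1 - d z) * survival j z.2).
  by apply: bmfM => //; exact: bmf_snd.
have bG : bmf (fun z : S * S => d z * survival j z.2).
  by apply: bmfM => //; exact: bmf_snd.
have bG' : bmf (fun z : S * S => d z * survival j z.1).
  by apply: bmfM => //; apply: (bmf_comp (bW j)); exact: measurable_fst.
have ab := sigr_sqr r1.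
transitivity (Ex gam (fun x => Pop r (survival j) x -
    Ex gam (fun e => d (x, step x e) * survival j (step x e)))).
  apply: eq_Ex => x /=; rewrite -ExB; [|exact: bmf_lincomb1|exact: (bmf_step1 _ bG)].
  by apply: eq_Ex => e; rewrite mulrBl mul1r.
rewrite ExB; [|exact: bmf_Pop|exact: (bmf_Ex_step bG)].
rewrite Ex_Pop//; congr (_ - _).
transitivity (Ex (gam \x gam)%E (fun z : S * S =>
    d (z.1, step z.1 z.2) * survival j (step z.1 z.2))).
  by rewrite Ex_prod1//; exact: (bmf_step bG).
rewrite (Ex_reversible ab bG)/=.
transitivity (Ex (gam \x gam)%E (fun z : S * S =>
    d (z.1, step z.1 z.2) * survival j z.1)).
  apply: eq_Ex => z; congr (_ * _); rewrite !indicE; congr (_%:R).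
  by congr nat_of_bool; apply/idP/idP; rewrite !inE; exact: symD.
rewrite Ex_prod1/=; last exact: (bmf_step bG').
apply: eq_Ex => x; rewrite [RHS]mulrC /hit_prob -ExZ; last exact: (bmf_step1 _ bd).
by apply: eq_Ex => e; rewrite mulrC.
Qed.

Lemma Ex_sqr_Pop_le (f : S -> R) : bmf f ->
  Ex gam (fun x => Pop r f x ^+ 2) <= Ex gam (fun x => f x ^+ 2).
Proof.
move=> bf; have b2 := bmfX 2 bf; have bP := bmfX 2 (bmf_Pop r bf).
rewrite -(Ex_Pop r1 b2); apply: Ex_le => //; first exact: bmf_Pop.
move=> x; have bl := bmf_lincomb1 r (sigr r) x bf.
have CS := Ex_CS gam bl (@bmf_cst R _ S 1).
have E1 : Ex gam (fun e => f (step x e) * 1) = Pop r f x.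
  by apply: eq_Ex => e; rewrite mulr1.
by rewrite E1 expr1n Ex_cst mulr1 in CS.
Qed.

(** Cauchy-Schwarz, together with the fact that averaging does not increase the second moment. *)
Lemma Ex_iter_Pop_le (f : S -> R) h : bmf f -> (forall x, 0 <= f x) ->
  Ex gam (fun x => f x * iter h (Pop r) f x) <= Ex gam (fun x => f x ^+ 2).
Proof.
move=> bf f0; set N := Ex gam (fun x => f x ^+ 2).
have N0 : 0 <= N by apply: Ex_ge0 => x; exact: sqr_ge0.
have hN : Ex gam (fun x => iter h (Pop r) f x ^+ 2) <= N.
  elim: h => [|h IH]; first by rewrite lexx.
  by rewrite (le_trans _ IH)//; apply: Ex_sqr_Pop_le; exact: bmf_iter_Pop.
have CS := Ex_CS gam bf (bmf_iter_Pop h bf); rewrite -/N in CS.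
have {CS} : Ex gam (fun x => f x * iter h (Pop r) f x) ^+ 2 <= N ^+ 2.
  by rewrite (le_trans CS)// expr2 ler_wpM2l.
by move: (Ex gam _) => E hE; nra.
Qed.

Local Notation b := (Ex gam hit_prob).
Local Notation f2 := (Ex gam (fun x => hit_prob x ^+ 2)).

Lemma sqr_Ex_hit_le : b ^+ 2 <= f2.
Proof.
have := Ex_sqr_center bmf_hit_prob; have : 0 <= Ex gam (fun x => (hit_prob x - b) ^+ 2).
  by apply: Ex_ge0 => x; exact: sqr_ge0.
by move=> h e; rewrite -subr_ge0 -e.
Qed.

(** Forgetting [h] constraints moves the mean of the product by at most [h f2] and the product of
    the means by at most [h b^2], which is at most [h f2]. *)
Lemma hit_survival_shift j h :
  `|Ex gam (fun x => hit_prob x * survival (h + j) x) - b * Ex gam (survival (h + j))|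
  <= `|Ex gam (fun x => hit_prob x * iter h (Pop r) (survival j) x) - b * Ex gam (survival j)|
     + 2 * h%:R * f2.
Proof.
have bf := bmf_hit_prob; have bI := bmf_iter_Pop h (bW j).
have f0 x : 0 <= hit_prob x by case/andP: (hit_prob_itv x).
have b0 : 0 <= b by exact: Ex_ge0.
have bS : bmf (fun x => \sum_(i < h) iter i (Pop r) hit_prob x).
  by apply: bmf_sum => i; exact: bmf_iter_Pop.
have E1 : Ex gam (fun x => hit_prob x * survival (h + j) x) <=
    Ex gam (fun x => hit_prob x * iter h (Pop r) (survival j) x).
  apply: Ex_le; [exact: bmfM|exact: bmfM|].
  by move=> x; rewrite ler_wpM2l//; case: (survival_sandwich j h x).
have E2 : Ex gam (fun x => hit_prob x * iter h (Pop r) (survival j) x) - h%:R * f2 <=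
    Ex gam (fun x => hit_prob x * survival (h + j) x).
  have bfS := bmfM bf bS; have bfI := bmfM bf bI.
  apply: (@le_trans _ _ (Ex gam (fun x => hit_prob x * iter h (Pop r) (survival j) x
    - hit_prob x * \sum_(i < h) iter i (Pop r) hit_prob x))).
    rewrite ExB// lerB//.
    under eq_Ex => x do rewrite mulr_sumr.
    rewrite Ex_sum; last by move=> i; apply: bmfM => //; exact: bmf_iter_Pop.
    apply: (@le_trans _ _ (\sum_(i < h) f2)).
      by apply: ler_sum => i _; exact: Ex_iter_Pop_le.
    by rewrite sumr_const card_ord mulr_natl.
  apply: Ex_le; [exact: bmfB|exact: bmfM|].
  by move=> x; rewrite -mulrBr ler_wpM2l//; case: (survival_sandwich j h x).
have EI k g : bmf g -> Ex gam (iter k (Pop r) g) = Ex gam g.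
  move=> bg; elim: k => [|k IH]; first by [].
  by rewrite iterS (Ex_Pop r1 (bmf_iter_Pop k bg)).
have E3 : Ex gam (survival (h + j)) <= Ex gam (survival j).
  rewrite -(EI h _ (bW j)); apply: Ex_le => // x.
  by case: (survival_sandwich j h x).
have E4 : Ex gam (survival j) - h%:R * b <= Ex gam (survival (h + j)).
  rewrite -(EI h _ (bW j)).
  have -> : h%:R * b = Ex gam (fun x => \sum_(i < h) iter i (Pop r) hit_prob x).
    rewrite Ex_sum; last by move=> i; exact: bmf_iter_Pop.
    transitivity (\sum_(i < h) b); first by rewrite sumr_const card_ord mulr_natl.
    by apply: eq_bigr => i _; rewrite (EI i _ bf).
  rewrite -ExB//; apply: Ex_le => //; first exact: bmfB.
  by move=> x; case: (survival_sandwich j h x).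
have b2 := sqr_Ex_hit_le.
move: E1 E2 E3 E4 b0 b2.
move: (Ex gam (fun x => hit_prob x * survival (h + j) x)) => e1.
move: (Ex gam (fun x => hit_prob x * iter h (Pop r) (survival j) x)) => e2.
move: (Ex gam (survival j)) (Ex gam (survival (h + j))) => w w' E1 E2 E3 E4 b0 b2.
move: f2 E2 b2 => N E2 b2; move: b E4 b0 b2 => B E4 b0 b2.
have h0 : 0 <= h%:R :> R by [].
move: (h%:R : R) h0 E2 E4 => H h0 E2 E4.
have E5 : B * w' <= B * w by rewrite ler_wpM2l.
have E6 : B * w - H * B ^+ 2 <= B * w'.
  have -> : B * w - H * B ^+ 2 = B * (w - H * B) by ring.
  by rewrite ler_wpM2l.
have E7 : H * B ^+ 2 <= H * N by rewrite ler_wpM2l.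
rewrite ler_norml; have := ler_norm (e2 - B * w); have := ler_norm (- (e2 - B * w)).
by rewrite normrN => ? ?; apply/andP; split; lra.
Qed.

Lemma hit_survival_approx (H j : nat) :
  `|Ex gam (fun x => hit_prob x * survival j x) - b * Ex gam (survival j)|
  <= r ^+ H + 2 * H%:R * f2.
Proof.
have bf := bmf_hit_prob.
have rH : 0 <= r ^+ H by rewrite exprn_ge0//; case/andP: r1.
have f20 : 0 <= f2 by apply: Ex_ge0 => x; exact: sqr_ge0.
(* With fewer than [H] steps all constraints are forgotten: survival over 0 steps is the constant 1,
   so there is no covariance left to decorrelate. *)
have [jH|Hj] := ltnP j H.
  have := hit_survival_shift 0 j; rewrite addn0 => /le_trans; apply.
  have i1 x : iter j (Pop r) (survival 0) x = 1.
    have : iter j (Pop r) (survival 0) =1 cst 1.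
      elim: (j : nat) => //= k IH y; rewrite /Pop -[RHS](Ex_cst gam).
      by apply: eq_Ex => e; rewrite IH.
    by move=> ->.
  under eq_Ex => x do rewrite i1 mulr1.
  rewrite /= Ex_cst mulr1 subrr normr0 add0r.
  apply: (@le_trans _ _ (2 * H%:R * f2)); last by rewrite lerDr.
  by rewrite ler_wpM2r// ler_wpM2l// ler_nat ltnW.
have := hit_survival_shift (j - H) H; rewrite subnKC// => /le_trans; apply.
rewrite lerD2r.
have [bI I01 EI cI] := iter_Pop_contraction H r01 (bW (j - H)) (W01 (j - H)).
set w := Ex gam (survival (j - H)) in EI cI *.
set g := iter H (Pop r) (survival (j - H)) in bI I01 EI cI *.
have bgw : bmf (fun x => g x - w) by apply: bmfB => //; exact: bmf_cst.
have -> : Ex gam (fun x => hit_prob x * g x) - b * w =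
    Ex gam (fun x => hit_prob x * (g x - w)).
  have bfg := bmfM bf bI; have bwf := bmfZ w bf.
  rewrite (mulrC b) -(ExZ _ w bf) -ExB//; apply: eq_Ex => x; ring.
have CS := Ex_CS gam bf bgw.
have f21 : f2 <= 1.
  rewrite -[leRHS](Ex_cst gam); apply: Ex_le; [exact: bmfX|exact: bmf_cst|].
  by move=> x; rewrite exprn_ile1//; case/andP: (hit_prob_itv x).
have {CS} : Ex gam (fun x => hit_prob x * (g x - w)) ^+ 2 <= (r ^+ H) ^+ 2.
  apply: (le_trans CS); apply: le_trans cI; rewrite ler_piMl//.
  by apply: Ex_ge0 => x; exact: sqr_ge0.
move: (Ex gam _) => E hE; rewrite ler_norml.
by apply/andP; split; nra.
Qed.

(** The one-step errors add up without amplification, because they are propagated by the factor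
    [1 - b], which lies in [[0, 1]]. *)
Lemma survival_approx (H m : nat) :
  `|Ex gam (survival m) - (1 - b) ^+ m| <= m%:R * (r ^+ H + 2 * H%:R * f2).
Proof.
have /andP[b0 b1] : 0 <= b <= 1.
  by apply: Ex_itv; [exact: bmf_hit_prob|exact: hit_prob_itv].
elim: m => [|m IH]; first by rewrite /= Ex_cst expr0 subrr normr0 mul0r.
have := hit_survival_approx H m; rewrite Ex_survivalS exprS.
move: (Ex gam (fun x => hit_prob x * survival m x)) => e.
move: (Ex gam (survival m)) IH => w IH he.
have -> : w - e - (1 - b) * (1 - b) ^+ m =
    (1 - b) * (w - (1 - b) ^+ m) - (e - b * w) by ring.
apply: (le_trans (ler_normB _ _)); rewrite -[m.+1%:R]natr1 [leRHS]mulrDl mul1r lerD//.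
rewrite normrM (le_trans _ IH)// ler_piMl//.
by rewrite ger0_norm ?subr_ge0// gerBl.
Qed.

(** The pathwise counterpart of [survival], driven by explicit innovations, so that it can be
    compared with the given columns outcome by outcome. *)
Fixpoint chain_indic (m : nat) (x : S) (e : nat -> S) : R :=
  if m is m'.+1 then
    (1 - d (x, step x (e 0%N))) * chain_indic m' (step x (e 0%N)) (fun i => e i.+1)
  else 1.

Lemma bmf_chain_indic d0 (T : measurableType d0) m (X : T -> S) (E : nat -> T -> S) :
  measurable_fun setT X -> (forall i, measurable_fun setT (E i)) ->
  bmf (fun w => chain_indic m (X w) (fun i => E i w)).
Proof.
elim: m X E => [|m IH] X E mX mE /=; first exact: bmf_cst.
have ms : measurable_fun setT (fun w => step (X w) (E 0%N w)).
  apply: (measurableT_comp (f := fun z : S * S => step z.1 z.2)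
    (g := fun w => (X w, E 0%N w))); first exact: measurable_lincomb.
  exact: measurable_fun_pair.
apply: bmfM; last by apply: (IH _ (fun i => E i.+1)).
apply: (bmf_comp bnd (h := fun w => (X w, step (X w) (E 0%N w)))).
exact: measurable_fun_pair.
Qed.

Lemma measurable_nth (x0 : S) l i :
  measurable_fun setT (fun v : l.-tuple S => nth x0 v i).
Proof.
have [il|li] := ltnP i l.
  rewrite (_ : (fun _ => _) = (fun v : l.-tuple S => tnth v (Ordinal il))).
    exact: measurable_tnth.
  by apply/funext => v; rewrite (tnth_nth x0).
rewrite (_ : (fun _ => _) = cst x0)//.
by apply/funext => v; rewrite nth_default// size_tuple.
Qed.

Lemma Ex_chain_indic (x0 : S) m x :
  Ex (tprod gam m) (fun v => chain_indic m x (nth x0 v)) = survival m x.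
Proof.
elim: m x => [|m IH] x /=; first exact: Ex_cst.
have bc k y : bmf (fun v : k.-tuple S => chain_indic k y (nth x0 v)).
  by apply: (@bmf_chain_indic _ _ k (cst y) (fun i (v : k.-tuple S) => nth x0 v i)) => // i; exact: measurable_nth.
rewrite (Ex_tprodS gam (bc m.+1 x)); apply: eq_Ex => e /=.
by rewrite (ExZ _ _ (bc m (step x e))) IH.
Qed.

Lemma Ex_chain_indicS (x0 : S) m :
  Ex (tprod gam m.+1) (fun v => chain_indic m (nth x0 v 0) (fun i => nth x0 v i.+1)) =
  Ex gam (survival m).
Proof.
rewrite Ex_tprodS; last first.
  apply: (@bmf_chain_indic _ _ m (fun v : m.+1.-tuple S => nth x0 v 0)
    (fun i (v : m.+1.-tuple S) => nth x0 v i.+1)) => [|i];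
  exact: measurable_nth.
by apply: eq_Ex => x; exact: Ex_chain_indic.
Qed.

(** An indicator on the one-point type is used to turn a proposition into a number 0 or 1. *)
Lemma chain_indicE m (X : nat -> S) (e : nat -> S) :
  (forall i, (i < m)%N -> step (X i) (e i) = X i.+1) ->
  chain_indic m (X 0%N) e = \1_[set z | forall i, (i < m)%N -> ~ D (X i, X i.+1)] tt.
Proof.
elim: m X e => [|m IH] X e HX.
  by rewrite /= indicE mem_set.
rewrite /= HX// (IH (fun i => X i.+1)); last by move=> i im; exact: HX.
rewrite !indicE; have [D0|D0] := pselect (D (X 0%N, X 1%N)).
  rewrite (mem_set D0) subrr mul0r memNset// => /(_ 0%N (ltn0Sn _)); exact.
rewrite (memNset D0) subr0 mul1r; congr (_%:R); congr nat_of_bool.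
apply/idP/idP; rewrite !inE => H; last by move=> i im; exact: H.
by case=> [_|i im]; [exact: D0|exact: H].
Qed.

End poisson.

(** * The columns form a stationary chain *)

Section transfer.
Context {R : realType}.

(** Coefficient vectors supported on two indices. The indices may coincide, and a zero second
    coefficient encodes a vector with a single entry. *)
Lemma sum_pick (p : nat) (a1 a2 : R) (i1 i2 : nat) (F : nat -> R) :
  (i1 < p)%N -> (i2 < p)%N ->
  \sum_(i < p) (a1 * (i == i1 :> nat)%:R + a2 * (i == i2 :> nat)%:R) * F i =
  a1 * F i1 + a2 * F i2.
Proof.
have pick1 a k : (k < p)%N -> \sum_(i < p) a * (i == k :> nat)%:R * F i = a * F k.
  move=> kp; rewrite (bigD1 (Ordinal kp))//= eqxx mulr1 big1 ?addr0// => i ik.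
  by rewrite (_ : (i == k :> nat) = false) ?mulr0 ?mul0r//; exact: negbTE.
move=> i1p i2p; rewrite -(pick1 a1 i1)// -(pick1 a2 i2)// -big_split/=.
by apply: eq_bigr => i _; rewrite mulrDl.
Qed.

Lemma Sigma_pick (p : nat) (r a1 a2 b1 b2 : R) (i1 i2 j1 j2 : nat) :
  (i1 < p)%N -> (i2 < p)%N -> (j1 < p)%N -> (j2 < p)%N ->
  \sum_(i < p) \sum_(j < p) (a1 * (i == i1 :> nat)%:R + a2 * (i == i2 :> nat)%:R) *
    (b1 * (j == j1 :> nat)%:R + b2 * (j == j2 :> nat)%:R) * Sigma_entry r i j =
  a1 * (b1 * Sigma_entry r i1 j1 + b2 * Sigma_entry r i1 j2) +
  a2 * (b1 * Sigma_entry r i2 j1 + b2 * Sigma_entry r i2 j2).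
Proof.
move=> i1p i2p j1p j2p.
have E (i : nat) : \sum_(j < p) (b1 * (j == j1 :> nat)%:R + b2 * (j == j2 :> nat)%:R) *
    Sigma_entry r i j = b1 * Sigma_entry r i j1 + b2 * Sigma_entry r i j2.
  exact: (@sum_pick p b1 b2 j1 j2 (Sigma_entry r i)).
rewrite -(@sum_pick p a1 a2 i1 i2
  (fun i => b1 * Sigma_entry r i j1 + b2 * Sigma_entry r i j2))//.
apply: eq_bigr => i _; rewrite -E mulr_sumr.
by apply: eq_bigr => j _; rewrite mulrA.
Qed.

Lemma Sigma_entryC (r : R) i j : Sigma_entry r i j = Sigma_entry r j i.
Proof. by rewrite /Sigma_entry; case: ltngtP => // ->. Qed.

Lemma Sigma_entryD (r : R) i k : Sigma_entry r i (i + k) = r ^+ k.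
Proof. by rewrite /Sigma_entry leq_addr addKn. Qed.

Context d (T : measurableType d) (P : probability T R).
Variables (n p : nat) (r : R) (x : nat -> nat -> T -> R).
Hypothesis HI : indep_vectors P n p x.
Hypothesis HN : forall k, (k < n)%N -> is_Np_AR P p r (x k).
Hypothesis r01 : 0 <= r < 1.
Local Notation S := (n.-tuple R).
Local Notation gam := (tprod (@stdN R) n).
Local Notation xcol := (col_of n x).

Lemma measurable_xcol i : (i < p)%N -> measurable_fun setT (xcol i).
Proof. by move=> ip; apply: measurable_mktuple => k; have [+ _] := HN (ltn_ord k); apply. Qed.

Lemma sigr_gt0 (u : R) : 0 <= u < 1 -> 0 < sigr u.
Proof. by move=> /andP[u0 u1]; rewrite sqrtr_gt0; nra. Qed.

(** The rows of the inverse Cholesky factor of the covariance matrix: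
    [(x_s - r x_(s-1)) / sqrt (1 - r^2)], and [x_0] itself for [s = 0]. The dummy zero term keeps
    the two-term shape of [Sigma_pick]. *)
Definition innov (s i : nat) : R :=
  if s is s'.+1 then (sigr r)^-1 * (i == s'.+1)%:R + (- (r / sigr r)) * (i == s')%:R
  else 1 * (i == 0%N)%:R + 0 * (i == 0%N)%:R.

Lemma innov_orth s t : (s < p)%N -> (t < p)%N ->
  \sum_(i < p) \sum_(j < p) innov s i * innov t j * Sigma_entry r i j = (s == t)%:R.
Proof.
have s0 := sigr_gt0 r01; have s2 : sigr r ^+ 2 = 1 - r ^+ 2.
  rewrite -(@sigr_sqr _ r); first by ring.
  by case/andP: r01 => -> /ltW ->.
have sn : sigr r != 0 by rewrite gt_eqF.
have S0 i : Sigma_entry r i i = 1 by rewrite -[X in Sigma_entry r i X]addn0 Sigma_entryD.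
have key s' k : (s'.+1 + k < p)%N ->
    \sum_(i < p) \sum_(j < p) innov s'.+1 i * innov (s'.+1 + k) j * Sigma_entry r i j =
    (k == 0%N)%:R.
  rewrite addSn => skp; have sp : (s'.+1 < p)%N by rewrite (leq_ltn_trans _ skp)// ltnS leq_addr.
  rewrite /innov Sigma_pick//; try exact: ltnW.
  have -> : Sigma_entry r s' (s' + k).+1 = r ^+ k.+1 by rewrite -addnS Sigma_entryD.
  have -> : Sigma_entry r s'.+1 (s' + k).+1 = r ^+ k by rewrite -addSn Sigma_entryD.
  rewrite Sigma_entryD; case: k skp => [_|k _].
    rewrite addn0 Sigma_entryC -{1}addn1 Sigma_entryD !expr0 expr1.
    transitivity ((1 - r ^+ 2) / sigr r ^+ 2); first by field.
    by rewrite -s2 divff// expf_neq0.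
  have -> : Sigma_entry r s'.+1 (s' + k.+1) = r ^+ k by rewrite addnS -addSn Sigma_entryD.
  by rewrite /= !exprS; field.
have key0 t' : (t'.+1 < p)%N ->
    \sum_(i < p) \sum_(j < p) innov 0 i * innov t'.+1 j * Sigma_entry r i j = 0.
  move=> tp; have p0 : (0 < p)%N by rewrite (leq_ltn_trans _ tp).
  rewrite /innov Sigma_pick//; last exact: ltnW.
  have E k : Sigma_entry r 0 k = r ^+ k by rewrite -[k in LHS]add0n Sigma_entryD.
  by rewrite !E exprS; ring.
have sym u v : \sum_(i < p) \sum_(j < p) innov u i * innov v j * Sigma_entry r i j =
    \sum_(i < p) \sum_(j < p) innov v i * innov u j * Sigma_entry r i j.
  rewrite exchange_big/=; apply: eq_bigr => j _; apply: eq_bigr => i _.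
  by rewrite Sigma_entryC mulrAC mulrC mulrA.
wlog st : s t / (s <= t)%N.
  move=> W sp tp; have [st|/ltnW ts] := leqP s t; first exact: W.
  by rewrite sym eq_sym W.
move=> sp tp; case: s st sp => [|s] st sp.
  case: t st tp => [|t] st tp; last by rewrite key0.
  by rewrite /innov Sigma_pick// S0/=; ring.
rewrite -(subnKC st) key; last by rewrite subnKC.
congr (nat_of_bool _)%:R; rewrite subnKC// subn_eq0 eqn_leq st.
by [].
Qed.

Local Notation y := (fun k s w => \sum_(i < p) innov s i * x k i w).

Lemma innov_step i w : (i.+1 < p)%N ->
  lincomb r (sigr r) (xcol i w) (col_of n y i.+1 w) = xcol i.+1 w.
Proof.
move=> ip; apply: eq_from_tnth => k; rewrite !tnth_mktuple /innov.
have sn : sigr r != 0 by rewrite gt_eqF// sigr_gt0.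
rewrite (@sum_pick p _ _ i.+1 i (fun i => x k i w))//; last exact: ltnW.
by field.
Qed.

(** The innovations form independent standard columns, and [innov_step] rebuilds the given columns
    from them; on each outcome the event is therefore [chain_indic] evaluated at the innovations. *)
Lemma Pr_no_adjacent_hit (D : set (S * S)) : measurable D ->
  (forall a b, D (a, b) -> D (b, a)) -> (0 < p)%N ->
  Pr P [set w | forall i, (i < p.-1)%N -> ~ D (xcol i w, xcol i.+1 w)] =
  Ex gam (survival r D p.-1).
Proof.
move=> mD symD p0; pose x0 : S := [tuple 0 | _ < n].
have my k s : (k < n)%N -> (s < p)%N -> measurable_fun setT (y k s).
  by move=> kn _; exact: (measurable_row_comb HN).
have mcols := measurable_cols my.
have law := law_columns my (gauss_rows HI HN innov_orth).
set Y := (fun w => [tuple col_of n y s w | s < p]) in mcols.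
pose F (v : p.-tuple S) := chain_indic r D p.-1 (nth x0 v 0) (fun i => nth x0 v i.+1).
have bF : bmf F.
  by apply: (@bmf_chain_indic _ n r D mD _ _ p.-1 (fun v : p.-tuple S => nth x0 v 0)
    (fun i (v : p.-tuple S) => nth x0 v i.+1)) => [|i]; exact: measurable_nth.
have E1 : Ex P (fun w => F (Y w)) = Ex (tprod gam p) F.
  by apply: (Ex_eq_law mcols (@measurable_id _ _ _) _ bF) => B mB; exact: law.
have E2 : Ex (tprod gam p) F = Ex gam (survival r D p.-1).
  rewrite /F; case: (p) p0 => // q _; exact: Ex_chain_indicS.
rewrite -E2 -E1 Pr_Ex; last first.
  apply: measurable_forall_lt => i ip.
  have ip1 : (i.+1 < p)%N by rewrite -(prednK p0).
  have mp : measurable_fun setT (fun w => (xcol i w, xcol i.+1 w)).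
    by apply: measurable_fun_pair; apply: measurable_xcol => //; exact: ltnW.
  have := mp measurableT _ (measurableC mD); rewrite setTI; exact.
have nthY w s (sp : (s < p)%N) : nth x0 (Y w) s = col_of n y s w.
  exact: (nth_mktuple (fun s : 'I_p => col_of n y s w) x0 (Ordinal sp)).
apply: eq_Ex => w; rewrite /F nthY//.
have -> : col_of n y 0 w = xcol 0 w.
  apply: eq_from_tnth => k; rewrite !tnth_mktuple /innov.
  by rewrite (@sum_pick p _ _ 0 0 (fun i => x k i w))// mul1r mul0r addr0.
rewrite (@chain_indicE _ n r D p.-1 (fun i => xcol i w)).
  by rewrite !indicE; congr (nat_of_bool _)%:R; apply/idP/idP; rewrite !inE.
move=> i ip; have ip1 : (i.+1 < p)%N by rewrite -(prednK p0).
by rewrite nthY// innov_step.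
Qed.

(** Only the correlation [u = r^(j - i)] of the two columns matters: column [i] and the normalised
    residual of column [j] on it are orthonormal combinations. *)
Lemma Ex_pair (i j : nat) (g : S * S -> R) : (i < j)%N -> (j < p)%N -> bmf g ->
  Ex P (fun w => g (xcol i w, xcol j w)) =
  Ex (gam \x gam)%E (fun z : S * S =>
    g (z.1, lincomb (r ^+ (j - i)) (sigr (r ^+ (j - i))) z.1 z.2)).
Proof.
move=> ij jp bg; have ip := ltn_trans ij jp.
set u := r ^+ (j - i).
have u01 : 0 <= u < 1.
  case/andP: r01 => r0 r1; rewrite exprn_ge0//= exprn_ilt1//.
  by rewrite subn_eq0 -ltnNge.
have s0 := sigr_gt0 u01; have sn : sigr u != 0 by rewrite gt_eqF.
have s2 : sigr u ^+ 2 = 1 - u ^+ 2.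
  rewrite -(@sigr_sqr _ u); first by ring.
  by case/andP: u01 => -> /ltW ->.
pose al (s k : nat) : R := if s is 0 then 1 * (k == i)%:R + 0 * (k == i)%:R
  else (sigr u)^-1 * (k == j)%:R + (- (u / sigr u)) * (k == i)%:R.
have S0 k : Sigma_entry r k k = 1 by rewrite -[X in Sigma_entry r k X]addn0 Sigma_entryD.
have Sij : Sigma_entry r i j = u by rewrite -[in LHS](subnKC (ltnW ij)) Sigma_entryD.
have orth s t : (s < 2)%N -> (t < 2)%N ->
    \sum_(a < p) \sum_(b < p) al s a * al t b * Sigma_entry r a b = (s == t)%:R.
  case: s => [|[|//]] _; case: t => [|[|//]] _; rewrite /al Sigma_pick// ?S0 ?Sij.
  - by rewrite /=; ring.
  - by rewrite /=; ring.
  - by rewrite (Sigma_entryC r j i) Sij/=; ring.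
  - rewrite (Sigma_entryC r j i) Sij/=.
    transitivity ((1 - u ^+ 2) / sigr u ^+ 2); first by field.
    by rewrite -s2 divff// expf_neq0.
pose y k s w := \sum_(a < p) al s a * x k a w.
have my k s : (k < n)%N -> (s < 2)%N -> measurable_fun setT (y k s).
  by move=> kn _; exact: (measurable_row_comb HN).
pose f (z : S * S) := g (z.1, lincomb u (sigr u) z.1 z.2).
have bf : bmf f by exact: bmf_step.
rewrite -(law_pair my (gauss_rows HI HN orth) bf); apply: eq_Ex => w.
rewrite /f /=; congr (g (_, _)); apply: eq_from_tnth => k; rewrite !tnth_mktuple /y /al.
  by rewrite (@sum_pick p _ _ i i (fun a => x k a w))// mul1r mul0r addr0.
rewrite (@sum_pick p _ _ i i (fun a => x k a w))//.
rewrite (@sum_pick p _ _ j i (fun a => x k a w))//.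
by field.
Qed.

End transfer.

(** * Chi-square deviations *)

Section chi_square.
Context {R : realType}.

Lemma expR_ge_quadratic (y : R) : 0 <= y -> 1 + y + y ^+ 2 / 2 <= expR y.
Proof.
move=> y0; have nd : nondecreasing_seq (series (exp_coeff y)).
  by apply: nondecreasing_series => n _ _; exact: exp_coeff_ge0.
have := nondecreasing_cvgn_le nd (is_cvg_series_exp_coeff y) 3%N.
rewrite [X in _ <= X -> _](_ : _ = expR y) ?unlock//; apply: le_trans.
rewrite /series/= !big_nat_recr//= big_nil /exp_coeff/= !factS fact0.
by rewrite le_eqVlt; apply/orP; left; apply/eqP; field.
Qed.

Lemma chi_square_mgf_upper (t : R) : 0 <= t <= 1 / 3 ->
  (Num.sqrt (1 - t))^-1 <= expR ((t + t ^+ 2 / 2 + t ^+ 3) / 2).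
Proof.
move=> /andP[t0 t3]; set y := t + t ^+ 2 / 2 + t ^+ 3.
have y0 : 0 <= y by rewrite !addr_ge0 ?mulr_ge0 ?exprn_ge0 ?invr_ge0.
have t1 : 0 < 1 - t by lra.
have key : 1 <= (1 - t) * expR y.
  have /(ler_wpM2l (ltW t1)) := expR_ge_quadratic y0; apply: le_trans.
  have y2 : t ^+ 2 + t ^+ 3 <= y ^+ 2.
    have -> : y ^+ 2 = t ^+ 2 + t ^+ 3 + t ^+ 4 * (2^-1 ^+ 2 + 2) + t ^+ 5 + t ^+ 6.
      by rewrite /y; field.
    have [h4 h5 h6] : [/\ 0 <= t ^+ 4, 0 <= t ^+ 5 & 0 <= t ^+ 6] by split; exact: exprn_ge0.
    by rewrite -!addrA lerD2l lerDl !addr_ge0// mulr_ge0.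
  apply: (@le_trans _ _ ((1 - t) * (1 + y + (t ^+ 2 + t ^+ 3) / 2))); last first.
    by rewrite ler_wpM2l ?(ltW t1)// lerD2l ler_pM2r.
  (* The cubic term of [y] leaves the surplus [t^3 (1 - 3 t) / 2]; this is where [t <= 1/3] is
     used. *)
  have -> : (1 - t) * (1 + y + (t ^+ 2 + t ^+ 3) / 2) = 1 + t ^+ 3 * (1 - 3 * t) / 2.
    by rewrite /y; field.
  by rewrite lerDl mulr_ge0// mulr_ge0 ?exprn_ge0//; lra.
have e2 : expR (y / 2) = Num.sqrt (expR y).
  have -> : expR y = expR (y / 2) ^+ 2.
    by rewrite expr2 -expRD; congr expR; field.
  by rewrite sqrtr_sqr ger0_norm// expR_ge0.
rewrite e2 -[leLHS]mul1r ler_pdivrMr ?sqrtr_gt0//.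
rewrite -sqrtrM ?expR_ge0// -[leLHS]sqrtr1 ler_sqrt; first by rewrite mulrC.
by rewrite mulr_ge0// ?expR_ge0// ltW.
Qed.

Lemma chi_square_mgf_lower (t : R) : 0 <= t <= 1 ->
  (Num.sqrt (1 + t))^-1 <= expR (- (t - 3 / 4 * t ^+ 2) / 2).
Proof.
move=> /andP[t0 t1]; set y := t - 3 / 4 * t ^+ 2.
have y2 : y / 2 <= t / 2.
  by have := sqr_ge0 t; rewrite /y; lra.
have s0 : 0 < 1 - y / 2 by lra.
have key : expR (y / 2) <= (1 - y / 2)^-1.
  have := expR_ge1Dx (- (y / 2)); rewrite expRN -[1 + _]/(1 - y / 2) => h.
  by rewrite -[leLHS]invrK lef_pV2// posrE ?invr_gt0 expR_gt0.
have {key} : expR (y / 2) <= Num.sqrt (1 + t).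
  rewrite (le_trans key)// -[leLHS]ger0_norm ?invr_ge0 ?(ltW s0)// -sqrtr_sqr.
  rewrite ler_sqrt; last by lra.
  rewrite exprVn -[leLHS]mul1r ler_pdivrMr ?exprn_gt0//.
  have -> : (1 + t) * (1 - y / 2) ^+ 2 = 1 + t ^+ 3 * (5 / 8 - 15 / 64 * t + 9 / 64 * t ^+ 2).
    by rewrite /y; field.
  rewrite lerDl mulr_ge0 ?exprn_ge0//.
  by have := sqr_ge0 t; lra.
move=> h; rewrite mulNr expRN lef_pV2// posrE ?expR_gt0//.
by rewrite sqrtr_gt0; lra.
Qed.

Section fixed_n.
Variable n : nat.
Local Notation S := (n.-tuple R).
Local Notation gam := (tprod (@stdN R) n).

Lemma sqnorm_tcons l (z : R) (v : l.-tuple R) : sqnorm (tcons (z, v)) = z ^+ 2 + sqnorm v.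
Proof.
by rewrite /sqnorm big_ord_recl; congr (_ + _); apply: eq_bigr => k _; rewrite tnthS.
Qed.

Lemma sqnorm_ge0 l (v : l.-tuple R) : 0 <= sqnorm v.
Proof. by apply: sumr_ge0 => k _; exact: sqr_ge0. Qed.

Lemma measurable_expR_sqnorm l (s : R) :
  measurable_fun setT (fun v : l.-tuple R => (expR (s * sqnorm v))%:E).
Proof.
apply/measurable_EFinP; apply: measurableT_comp => //; apply: measurable_funM => //.
exact: measurable_sqnorm.
Qed.

Lemma ge0_expR_sqnorm l (s : R) : s < 1 / 2 ->
  (\int[tprod stdN l]_v (expR (s * sqnorm v))%:E = ((Num.sqrt (1 - 2 * s))^-1 ^+ l)%:E)%E.
Proof.
move=> s2; elim: l => [|l IH].
  rewrite expr0; transitivity (\int[tprod (@stdN R) 0]_v 1%:E)%E.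
    by apply: eq_integral => v _; rewrite /sqnorm big_ord0 mulr0 expR0.
  by rewrite integral_cst// mul1e; exact: probability_setT.
rewrite ge0_integral_tprodS; [|exact: measurable_expR_sqnorm|by move=> v; rewrite lee_fin expR_ge0].
have mexp : measurable_fun setT (fun x : R => (expR (s * x ^+ 2))%:E).
  by apply/measurable_EFinP; apply: measurableT_comp => //; exact: measurable_funM.
transitivity (\int[stdN]_x ((expR (s * x ^+ 2))%:E * ((Num.sqrt (1 - 2 * s))^-1 ^+ l)%:E))%E.
  apply: eq_integral => x _; rewrite -IH -ge0_integralZl//; last first.
    exact: measurable_expR_sqnorm.
  by apply: eq_integral => v _; rewrite -EFinM -expRD sqnorm_tcons mulrDr.
rewrite ge0_integralZr//.
by rewrite ge0_expR_sqr_stdN// -EFinM exprS.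
Qed.

Lemma measurable_sqnorm_ge (s a : R) : measurable [set v : S | a <= s * sqnorm v].
Proof.
have m : measurable_fun setT (fun v : S => s * sqnorm v).
  by apply: measurable_funM => //; exact: measurable_sqnorm.
have := m measurableT _ (measurable_itv `[a, +oo[); rewrite setTI.
by congr measurable; apply/seteqP; split => v /=; rewrite in_itv/= andbT.
Qed.

(** Exponential Markov inequality. The parameter [s] may be negative, so one statement covers both
    tails. *)
Lemma chi_square_chernoff (s a : R) : s < 1 / 2 ->
  Pr gam [set v | a <= s * sqnorm v] <= expR (- a) * (Num.sqrt (1 - 2 * s))^-1 ^+ n.
Proof.
move=> s2; set A := [set v | _]; have mA : measurable A by exact: measurable_sqnorm_ge.
rewrite expRN mulrC ler_pdivlMr ?expR_gt0// -lee_fin -ge0_expR_sqnorm//.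
rewrite EFinM PrE// muleC -integral_cst//.
apply: (@le_trans _ _ (\int[gam]_(v in A) (expR (s * sqnorm v))%:E)%E).
  apply: ge0_le_integral => //=.
  - by apply: measurable_funTS; exact: measurable_expR_sqnorm.
  - by move=> v Av; rewrite lee_fin ler_expR.
by apply: ge0_subset_integral => //; exact: measurable_expR_sqnorm.
Qed.

(** Chernoff with parameter [t / 2]. The leading constant 1/4 is sharp, and this matters: for
    deviations [11/5 e] the exponent must exceed [e^2 n], which 121/100 barely does. *)
Lemma chi_square_upper (t : R) : 0 <= t <= 1 / 3 ->
  Pr gam [set v | n%:R * (1 + t) <= sqnorm v] <=
  expR (- (n%:R * (t ^+ 2 / 4 - t ^+ 3 / 2))).
Proof.
move=> t03; have /andP[t0 t3] := t03.
have [->|tp] := eqVneq t 0.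
  rewrite !expr0n/= !mul0r subrr mulr0 oppr0 expR0; apply: Pr_le1.
  have := measurable_sqnorm_ge 1 (n%:R * (1 + 0)).
  by congr measurable; apply/seteqP; split => v /=; rewrite mul1r.
have t0' : 0 < t by rewrite lt_def tp.
have -> : [set v : S | n%:R * (1 + t) <= sqnorm v] =
    [set v | t / 2 * (n%:R * (1 + t)) <= t / 2 * sqnorm v].
  by apply/seteqP; split => v /=; rewrite ler_pM2l// divr_gt0.
apply: (le_trans (chi_square_chernoff _ _)); first by lra.
have -> : 1 - 2 * (t / 2) = 1 - t by field.
apply: (@le_trans _ _ (expR (- (t / 2 * (n%:R * (1 + t)))) *
    expR ((t + t ^+ 2 / 2 + t ^+ 3) / 2) ^+ n)).
  rewrite ler_wpM2l ?expR_ge0// lerXn2r// ?nnegrE ?invr_ge0 ?sqrtr_ge0 ?expR_ge0//.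
  exact: chi_square_mgf_upper.
rewrite -expRM_natl -expRD ler_expR le_eqVlt; apply/orP; left; apply/eqP.
by field.
Qed.

Lemma chi_square_lower (t : R) : 0 <= t <= 1 ->
  Pr gam [set v | sqnorm v <= n%:R * (1 - t)] <= expR (- (n%:R * t ^+ 2 / 8)).
Proof.
move=> t01; have /andP[t0 t1] := t01.
have [->|tp] := eqVneq t 0.
  rewrite !expr0n/= mulr0 mul0r oppr0 expR0; apply: Pr_le1.
  have := measurable_sqnorm_ge (-1) (- (n%:R * (1 + 0))).
  by congr measurable; apply/seteqP; split => v /=; rewrite mulN1r lerN2.
have t0' : 0 < t by rewrite lt_def tp.
have -> : [set v : S | sqnorm v <= n%:R * (1 - t)] =
    [set v | - (t / 2 * (n%:R * (1 - t))) <= - (t / 2) * sqnorm v].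
  by apply/seteqP; split => v /=; rewrite mulNr lerN2 ler_pM2l// divr_gt0.
apply: (le_trans (chi_square_chernoff _ _)); first by lra.
have -> : 1 - 2 * (- (t / 2)) = 1 + t by field.
apply: (@le_trans _ _ (expR (- - (t / 2 * (n%:R * (1 - t)))) *
    expR (- (t - 3 / 4 * t ^+ 2) / 2) ^+ n)).
  rewrite ler_wpM2l ?expR_ge0// lerXn2r// ?nnegrE ?invr_ge0 ?sqrtr_ge0 ?expR_ge0//.
  exact: chi_square_mgf_lower.
rewrite -expRM_natl -expRD ler_expR le_eqVlt; apply/orP; left; apply/eqP.
by field.
Qed.

Definition near_sqnorm (t : R) : set S :=
  [set v | n%:R * (1 - t) < sqnorm v < n%:R * (1 + t)].

Lemma measurable_near_sqnorm t : measurable (near_sqnorm t).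
Proof.
have := @measurable_sqnorm R n measurableT _ (measurable_itv `](n%:R * (1 - t)), (n%:R * (1 + t))[).
by rewrite setTI; congr measurable; apply/seteqP; split => v /=; rewrite in_itv.
Qed.

Lemma chi_square_concentration (t : R) : 0 <= t <= 1 / 4 ->
  Pr gam (~` near_sqnorm t) <= 2 * expR (- (n%:R * t ^+ 2 / 8)).
Proof.
move=> /andP[t0 t4].
have m1 := measurable_sqnorm_ge 1 (n%:R * (1 + t)).
have m2 := measurable_sqnorm_ge (-1) (- (n%:R * (1 - t))).
have e1 : [set v : S | n%:R * (1 + t) <= 1 * sqnorm v] = [set v | n%:R * (1 + t) <= sqnorm v].
  by apply/seteqP; split => v /=; rewrite mul1r.
have e2 : [set v : S | - (n%:R * (1 - t)) <= -1 * sqnorm v] = [set v | sqnorm v <= n%:R * (1 - t)].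
  by apply/seteqP; split => v /=; rewrite mulN1r lerN2.
rewrite e1 in m1; rewrite e2 in m2.
apply: (@le_trans _ _ (Pr gam ([set v | n%:R * (1 + t) <= sqnorm v] `|`
    [set v | sqnorm v <= n%:R * (1 - t)]))).
  apply: Pr_le; first exact: measurableC (measurable_near_sqnorm t).
    exact: measurableU.
  move=> v /=; rewrite /near_sqnorm/= => /negP; rewrite negb_and -!leNgt => /orP[]; by [right|left].
apply: (le_trans (PrU _ m1 m2)); rewrite mulr2n mulrDl mul1r lerD//.
  apply: (le_trans (chi_square_upper _)); first by apply/andP; split; lra.
  rewrite ler_expR lerN2 -[_ * _ / 8]mulrA ler_wpM2l//.
  have : t ^+ 3 <= t ^+ 2 / 4 by rewrite exprS mulrC ler_wpM2l ?sqr_ge0//; lra.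
  by have := sqr_ge0 t; lra.
by apply: (le_trans (chi_square_lower _)) => //; apply/andP; split; lra.
Qed.

Definition dotp (v w : S) : R := \sum_(k < n) tnth v k * tnth w k.

Lemma measurable_dotp : measurable_fun setT (fun z : S * S => dotp z.1 z.2).
Proof.
apply: measurable_sum => k; apply: measurable_funM.
  by apply: (measurableT_comp (@measurable_tnth _ R n k)).
by apply: (measurableT_comp (@measurable_tnth _ R n k)).
Qed.

Lemma dotp_law (c : S) (s : R) (B : set R) : s ^+ 2 * sqnorm c = 1 -> measurable B ->
  Pr gam [set e | B (s * dotp c e)] = Pr stdN B.
Proof.
move=> sc mB.
(* The vector [s c] as a sequence, the form in which [Ex_cos_tprod] takes coefficients; the default
   0 is never reached. *)
pose c' (k : nat) := if insub k is Some i then s * tnth c i else 0.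
have c'E (i : 'I_n) : c' i = s * tnth c i by rewrite /c' valK.
have mY : forall i, (i < 1)%N -> measurable_fun setT (fun e => s * dotp c e).
  move=> _ _; apply: measurable_funM => //.
  apply: (measurableT_comp measurable_dotp (g := fun e => (c, e))).
  exact: pair1_measurable.
have H (a : nat -> R) (t : R) : Ex gam (fun e => cos (\sum_(i < 1) a i * (s * dotp c e) + t)) =
    expR (- (\sum_(i < 1) a i ^+ 2) / 2) * cos t.
  rewrite !big_ord1; pose b k := a 0%N * c' k.
  transitivity (Ex gam (fun v => cos (\sum_(k < n) b k * tnth v k + t))).
    apply: eq_Ex => v; rewrite big_ord1 /dotp !mulr_sumr; congr (cos (_ + t)).
    by apply: eq_bigr => k _; rewrite /b c'E; ring.
  rewrite Ex_cos_tprod; congr (expR (- _ / 2) * _).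
  transitivity (a 0%N ^+ 2 * (s ^+ 2 * sqnorm c)); last by rewrite sc mulr1.
  by rewrite /sqnorm !mulr_sumr; apply: eq_bigr => k _; rewrite /b c'E; ring.
have := @cramer_wold_normal _ _ _ gam 1 (fun _ e => s * dotp c e) mY H (fun=> B) (fun=> mB).
rewrite big_ord1 => <-; congr Pr; apply/seteqP; split => e /=; first by move=> Be [].
by move=> /(_ 0%N isT).
Qed.

Lemma dotp_tail (c : S) (u : R) : 0 < sqnorm c ->
  Pr gam [set e | u * Num.sqrt (sqnorm c) <= dotp c e] = Qtail u.
Proof.
move=> c0; set s := Num.sqrt (sqnorm c); have s0 : 0 < s by rewrite sqrtr_gt0.
have h : s^-1 ^+ 2 * sqnorm c = 1.
  by rewrite exprVn sqr_sqrtr ?(ltW c0)// mulVf// gt_eqF.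
transitivity (Pr stdN `[u, +oo[%classic); last by [].
rewrite -(dotp_law h (measurable_itv `[u, +oo[)); congr Pr.
by apply/seteqP; split => e /=; rewrite in_itv/= andbT ler_pdivlMl// mulrC.
Qed.

Lemma dotp_tailN (c : S) (u : R) : 0 < sqnorm c ->
  Pr gam [set e | dotp c e <= - (u * Num.sqrt (sqnorm c))] = Qtail u.
Proof.
move=> c0; set s := Num.sqrt (sqnorm c); have s0 : 0 < s by rewrite sqrtr_gt0.
have h : (- s^-1) ^+ 2 * sqnorm c = 1.
  by rewrite sqrrN exprVn sqr_sqrtr ?(ltW c0)// mulVf// gt_eqF.
transitivity (Pr stdN `[u, +oo[%classic); last by [].
rewrite -(dotp_law h (measurable_itv `[u, +oo[)); congr Pr.
have E e : (u <= - s^-1 * dotp c e) = (dotp c e <= - (u * s)).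
  by rewrite mulNr lerNr ler_pdivrMl// mulrN mulrC.
by apply/seteqP; split => e /=; rewrite in_itv/= andbT E.
Qed.

End fixed_n.
End chi_square.

(** * Deterministic correlation inequalities *)

Section correlation_inequalities.
Context {R : realType}.
Implicit Types rho tau N M Q : R.

Lemma sqrtr_sub_ge (A B : R) : 0 < A -> 0 <= B -> A - B / A <= Num.sqrt (A ^+ 2 - B).
Proof.
move=> A0 B0; have [h|h] := leP (A - B / A) 0; first by rewrite (le_trans h)// sqrtr_ge0.
have BA : B <= A ^+ 2.
  by rewrite expr2 -ler_pdivrMr// ltW// -subr_gt0.
rewrite -[leLHS]ger0_norm ?(ltW h)// -sqrtr_sqr ler_sqrt ?subr_ge0//.
have -> : (A - B / A) ^+ 2 = A ^+ 2 - B - B * (1 - B / A ^+ 2) by field; rewrite gt_eqF.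
by rewrite gerBl mulr_ge0// subr_ge0 ler_pdivrMr ?exprn_gt0// mul1r.
Qed.

(** [N], [M] and [Q] stand for the sum and the difference of the squared norms and for the inner
    product of the rotated pair. Bounding the root from below leaves an inequality linear in [Q], in
    which the difference [M] occurs only as [M^2 / N]. *)
Lemma corr_upper rho tau N M Q : 0 <= rho <= 1 -> 0 <= tau -> 0 < N ->
  `|2 * Q| <= N / 2 ->
  tau * Num.sqrt ((N + 2 * rho * Q) ^+ 2 - (1 - rho ^+ 2) * M ^+ 2) < rho * N + 2 * Q ->
  (tau - rho) * N - 2 * tau * ((1 - rho ^+ 2) * M ^+ 2 / N) < 2 * Q * (1 - tau * rho).
Proof.
move=> /andP[r0 r1] t0 N0; rewrite ler_norml => /andP[Q1 Q2].
set A := N + _; set B := _ * M ^+ 2.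
have A0 : N / 2 <= A.
  have [q0|q0] := leP 0 Q; first by rewrite /A; nra.
  by rewrite /A; nra.
have Ap : 0 < A by lra.
have B0 : 0 <= B by rewrite mulr_ge0 ?sqr_ge0//; nra.
have h1 := sqrtr_sub_ge Ap B0.
have h2 : B / A <= 2 * (B / N).
  rewrite mulrCA ler_wpM2l// -[leLHS]mul1r ler_pdivrMr// mulrAC ler_pdivlMr//; lra.
have h3 : tau * (A - 2 * (B / N)) <= tau * Num.sqrt (A ^+ 2 - B).
  by rewrite ler_wpM2l//; lra.
move=> /(le_lt_trans h3); rewrite /A.
have -> : 2 * tau * (B / N) = tau * (2 * (B / N)) by ring.
by move: (2 * (B / N)) => b; lra.
Qed.

Lemma corr_lower rho tau N M Q : 0 <= rho <= 1 -> 0 <= tau -> 0 <= N -> 0 <= Q ->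
  (tau - rho) * N < 2 * Q * (1 - tau * rho) ->
  tau * Num.sqrt ((N + 2 * rho * Q) ^+ 2 - (1 - rho ^+ 2) * M ^+ 2) < rho * N + 2 * Q.
Proof.
move=> /andP[r0 r1] t0 N0 Q0 h.
have A0 : 0 <= N + 2 * rho * Q by rewrite addr_ge0// !mulr_ge0.
apply: (@le_lt_trans _ _ (tau * (N + 2 * rho * Q))); last by lra.
rewrite ler_wpM2l// -[leRHS]ger0_norm// -sqrtr_sqr ler_sqrt ?sqr_ge0// gerBl.
by rewrite mulr_ge0 ?sqr_ge0//; nra.
Qed.

Lemma tau_itv (e r v tau : R) : e <= 1 / 1000 -> 0 <= v <= 2 * e -> 0 <= r < 1 ->
  tau = r + (1 - r ^+ 2) * v -> r <= tau <= 1.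
Proof.
move=> e1 /andP[v0 v1] /andP[r0 r1] ->.
have s2 : 0 < 1 - r ^+ 2 by rewrite subr_gt0 exprn_ilt1.
rewrite lerDl (mulr_ge0 (ltW s2) v0)/=.
have h : (1 + r) * v <= 1 by clear -e1 v0 v1 r0 r1; nra.
have -> : (1 - r ^+ 2) * v = (1 - r) * ((1 + r) * v) by ring.
have h1 : (1 - r) * ((1 + r) * v) <= (1 - r) * 1.
  by rewrite ler_wpM2l//; clear -r1; lra.
by clear -h1; lra.
Qed.

Lemma tau_sqr_ge (r v tau : R) : tau = r + (1 - r ^+ 2) * v ->
  1 - tau ^+ 2 <= (1 - r ^+ 2) * (1 - 2 * r * v).
Proof.
move=> ->.
have -> : (1 - r ^+ 2) * (1 - 2 * r * v) = 1 - r ^+ 2 - 2 * r * ((1 - r ^+ 2) * v) by ring.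
by have := sqr_ge0 ((1 - r ^+ 2) * v); lra.
Qed.

(** After division by [1 - r^2], a hit reads [v (a + b) < 2 Q] up to errors of order [e^2 n]: from
    [(a - b)^2 / (a + b)], from [v (a + b - 2 n)] and from replacing [sqrt a] by [sn]. The shift
    [50 e^2] of [v] leaves room for all of them. *)
Lemma bulk_upper (sn n e r v tau a b Q : R) : 0 < sn -> n = sn ^+ 2 ->
  0 < e <= 1 / 1000 -> 50 * e ^+ 2 <= v <= 2 * e -> 0 <= r < 1 ->
  tau = r + (1 - r ^+ 2) * v ->
  n * (1 - 4 * e) < a < n * (1 + 4 * e) -> n * (1 - 4 * e) < b < n * (1 + 4 * e) ->
  `|2 * Q| <= (a + b) / 2 ->
  tau * Num.sqrt ((a + b + 2 * r * Q) ^+ 2 - (1 - r ^+ 2) * (a - b) ^+ 2) <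
    r * (a + b) + 2 * Q ->
  (v - 50 * e ^+ 2) * sn * Num.sqrt a <= Q.
Proof.
move=> sn0 nE /andP[e0 e1] /andP[v50 v1] r01 tauE /andP[a1 a2] /andP[b1 b2] Qab hit.
have /andP[r0 r1] := r01.
have v0 : 0 <= v by rewrite (le_trans _ v50)// mulr_ge0 ?sqr_ge0.
have n0 : 0 < n by rewrite nE exprn_gt0.
have s2 : 0 < 1 - r ^+ 2 by rewrite subr_gt0 exprn_ilt1.
have en : e * n <= n / 1000 by rewrite mulrC ler_wpM2l//; [exact: ltW|clear -e1; lra].
have en0 : 0 < e * n by rewrite mulr_gt0.
have N0 : 199 / 100 * n <= a + b by clear -a1 b1 en n0; lra.
have Np : 0 < a + b by clear -N0 n0; lra.
have v02 : 0 <= v <= 2 * e by rewrite v0.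
have /andP[t0 t1] := tau_itv e1 v02 r01 tauE.
have r01' : 0 <= r <= 1 by rewrite r0 ltW.
have := corr_upper r01' (le_trans r0 t0) Np Qab hit.
have -> : tau - r = (1 - r ^+ 2) * v by rewrite tauE; ring.
have -> : 1 - tau * r = (1 - r ^+ 2) * (1 - r * v) by rewrite tauE; ring.
have M2 : (a - b) ^+ 2 / (a + b) <= 34 * (e ^+ 2 * n).
  rewrite ler_pdivrMr//.
  have Mle : (a - b) ^+ 2 <= (8 * (e * n)) ^+ 2.
    have h8 : 0 <= 8 * (e * n) by rewrite mulr_ge0// ltW.
    rewrite -[leLHS]real_normK ?num_real// lerXn2r ?nnegrE//.
    by rewrite ler_norml; apply/andP; split; clear -a1 a2 b1 b2; lra.
  rewrite (le_trans Mle)//.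
  have -> : (8 * (e * n)) ^+ 2 = e ^+ 2 * n * (64 * n) by ring.
  have -> : 34 * (e ^+ 2 * n) * (a + b) = e ^+ 2 * n * (34 * (a + b)) by ring.
  apply: ler_wpM2l; last by clear -N0 n0; lra.
  by rewrite mulr_ge0 ?sqr_ge0 ?(ltW n0).
have -> : (1 - r ^+ 2) * (a - b) ^+ 2 / (a + b) = (1 - r ^+ 2) * ((a - b) ^+ 2 / (a + b)).
  exact: esym (mulrA _ _ _).
have M0 : 0 <= (a - b) ^+ 2 / (a + b) by rewrite divr_ge0 ?sqr_ge0 ?(ltW Np).
move: ((a - b) ^+ 2 / (a + b)) M0 M2 => m M0 M2 h.
have {h} h1 : v * (a + b) - 2 * tau * m < 2 * Q * (1 - r * v).
  by rewrite -(ltr_pM2l s2); apply: le_lt_trans (lt_le_trans h _);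
    rewrite le_eqVlt; apply/orP; left; apply/eqP; ring.
have tm : 2 * tau * m <= 68 * (e ^+ 2 * n).
  have h2 : tau * m <= 1 * m by rewrite ler_wpM2r.
  by clear -h2 M2; lra.
have vn : 50 * (e ^+ 2 * n) <= v * n by rewrite mulrA ler_wpM2r// ltW.
have ven : v * (e * n) <= 2 * (e ^+ 2 * n).
  have : v * (e * n) <= 2 * e * (e * n) by rewrite ler_wpM2r// ltW.
  by rewrite expr2 -!mulrA.
have vN : 2 * (v * n) - 16 * (e ^+ 2 * n) <= v * (a + b).
  have h2 : v * (n * (2 - 8 * e)) <= v * (a + b).
    by rewrite ler_wpM2l//; clear -a1 b1; lra.
  by clear -ven h2; lra.
have e2n : 0 <= e ^+ 2 * n by rewrite mulr_ge0 ?sqr_ge0// ltW.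
have h2 : 2 * (v * n) - 84 * (e ^+ 2 * n) < 2 * (Q * (1 - r * v)).
  by clear -h1 tm vN; lra.
have rv0 : 0 <= r * v by rewrite mulr_ge0.
have rv1 : r * v <= 1 * (2 * e) by apply: ler_pM => //; exact: ltW.
have rv : 0 < 1 - r * v by clear -rv1 e1; lra.
have Q0 : 0 < Q.
  rewrite -(pmulr_lgt0 _ rv); by clear -h2 vn e2n; lra.
have h3 : v * n - 42 * (e ^+ 2 * n) <= Q.
  have h4 : Q * (1 - r * v) <= Q * 1 by rewrite ler_wpM2l ?(ltW Q0)// gerBl.
  by clear -h4 h2; lra.
apply: le_trans h3.
have sa : Num.sqrt a <= sn * (1 + 2 * e).
  have h : 0 <= sn * (1 + 2 * e) by rewrite mulr_ge0 ?(ltW sn0)//; clear -e0; lra.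
  rewrite -[leRHS]ger0_norm// -sqrtr_sqr ler_sqrt ?sqr_ge0// (le_trans (ltW a2))//.
  rewrite exprMn -nE ler_wpM2l ?(ltW n0)//.
  by have := sqr_ge0 e; clear; lra.
apply: (@le_trans _ _ ((v - 50 * e ^+ 2) * sn * (sn * (1 + 2 * e)))).
  by rewrite ler_wpM2l// mulr_ge0 ?(ltW sn0)// subr_ge0.
have -> : (v - 50 * e ^+ 2) * sn * (sn * (1 + 2 * e)) =
    v * n + 2 * (v * (e * n)) - 50 * (e ^+ 2 * n) * (1 + 2 * e) by rewrite nE; ring.
have h5 : 50 * (e ^+ 2 * n) <= 50 * (e ^+ 2 * n) * (1 + 2 * e).
  apply: ler_peMr; first by rewrite mulr_ge0.
  by clear -e0; lra.
by clear -ven h5 e2n; lra.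
Qed.

Lemma bulk_lower (sn n e r v tau a b Q : R) : 0 < sn -> n = sn ^+ 2 ->
  0 < e <= 1 / 1000 -> 0 <= v <= 2 * e -> 0 <= r < 1 ->
  tau = r + (1 - r ^+ 2) * v ->
  n * (1 - 4 * e) < a < n * (1 + 4 * e) -> n * (1 - 4 * e) < b < n * (1 + 4 * e) ->
  (v + 50 * e ^+ 2) * sn * Num.sqrt a <= Q ->
  tau * Num.sqrt ((a + b + 2 * r * Q) ^+ 2 - (1 - r ^+ 2) * (a - b) ^+ 2) <
    r * (a + b) + 2 * Q.
Proof.
move=> sn0 nE /andP[e0 e1] v02 r01 tauE /andP[a1 a2] /andP[b1 b2] hQ.
have /andP[r0 r1] := r01; have /andP[v0 v1] := v02.
have n0 : 0 < n by rewrite nE exprn_gt0.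
have s2 : 0 < 1 - r ^+ 2 by rewrite subr_gt0 exprn_ilt1.
have en : e * n <= n / 1000 by rewrite mulrC ler_wpM2l//; [exact: ltW|clear -e1; lra].
have en0 : 0 < e * n by rewrite mulr_gt0.
have Np : 0 < a + b by clear -a1 b1 n0 en; lra.
have /andP[t0 t1] := tau_itv e1 v02 r01 tauE.
have r01' : 0 <= r <= 1 by rewrite r0 ltW.
have ua : 0 <= v + 50 * e ^+ 2 by rewrite addr_ge0// mulr_ge0 ?sqr_ge0.
have us : 0 <= (v + 50 * e ^+ 2) * sn by rewrite mulr_ge0 ?(ltW sn0).
have Q0 : 0 <= Q by rewrite (le_trans _ hQ)// mulr_ge0// sqrtr_ge0.
apply: corr_lower => //; [exact: (le_trans r0)|exact: ltW|].
have -> : tau - r = (1 - r ^+ 2) * v by rewrite tauE; ring.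
have -> : 1 - tau * r = (1 - r ^+ 2) * (1 - r * v) by rewrite tauE; ring.
have -> : 2 * Q * ((1 - r ^+ 2) * (1 - r * v)) = (1 - r ^+ 2) * (2 * (Q * (1 - r * v))) by ring.
rewrite -mulrA ltr_pM2l//.
have sa : sn * (1 - 4 * e) <= Num.sqrt a.
  have h : 0 <= sn * (1 - 4 * e) by rewrite mulr_ge0 ?(ltW sn0)//; clear -e1; lra.
  rewrite -[leLHS]ger0_norm// -sqrtr_sqr ler_sqrt; last first.
    by rewrite (le_trans _ (ltW a1))// mulr_ge0 ?(ltW n0)//; clear -e1; lra.
  apply: le_trans (ltW a1); rewrite exprMn -nE ler_wpM2l ?(ltW n0)//.
  by clear -e0 e1; nra.
have rv1 : r * v <= 1 * (2 * e) by apply: ler_pM => //; exact: ltW.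
have h4 : (v + 50 * e ^+ 2) * sn * (sn * (1 - 4 * e)) <= Q.
  by rewrite (le_trans _ hQ)// ler_wpM2l.
have h5 : (v + 50 * e ^+ 2) * sn * (sn * (1 - 4 * e)) * (1 - 2 * e) <= Q * (1 - r * v).
  apply: ler_pM => //; [|clear -e1; lra|clear -rv1; lra].
  by rewrite mulr_ge0// mulr_ge0 ?(ltW sn0)//; clear -e1; lra.
have e2n : 0 < e ^+ 2 * n by rewrite mulr_gt0 ?exprn_gt0.
have ven : v * (e * n) <= 2 * (e ^+ 2 * n).
  have : v * (e * n) <= 2 * e * (e * n) by rewrite ler_wpM2r// ltW.
  by rewrite expr2 -!mulrA.
have vN : v * (a + b) <= 2 * (v * n) + 16 * (e ^+ 2 * n).
  have h6 : v * (a + b) <= v * (n * (2 + 8 * e)).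
    by rewrite ler_wpM2l//; clear -a2 b2; lra.
  by clear -h6 ven; lra.
apply: (le_lt_trans vN).
apply: (@lt_le_trans _ _ (2 * ((v * n + 50 * (e ^+ 2 * n)) * (1 - 6 * e)))); last first.
  rewrite ler_pM2l// (le_trans _ h5)//.
  have -> : (v + 50 * e ^+ 2) * sn * (sn * (1 - 4 * e)) * (1 - 2 * e) =
    (v * n + 50 * (e ^+ 2 * n)) * ((1 - 4 * e) * (1 - 2 * e)) by rewrite nE; ring.
  rewrite ler_wpM2l//.
    by rewrite addr_ge0//; apply: mulr_ge0 => //; exact: ltW.
  by have := sqr_ge0 e; clear; lra.
have h7 : 0 <= e ^+ 2 * n * (1 / 1000 - e).
  by apply: mulr_ge0; [exact: ltW|clear -e1; lra].
by clear -h7 ven e2n; lra.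
Qed.

(* A point whose squared norm is at most [n (1 + 2.2 e)] hits only if its
   innovation is unusually large or has an unusually small norm. *)
Lemma heavy_point (n e r v tau s a w E : R) : 0 < n -> 0 < e <= 1 / 1000 -> 0 <= r < 1 ->
  1 - r ^+ 2 <= 1 / 10000 -> s ^+ 2 = 1 - r ^+ 2 -> 0 <= s ->
  7 / 5 * e <= v <= 2 * e -> r <= tau <= 1 -> 1 - tau ^+ 2 <= s ^+ 2 * (1 - 2 * r * v) ->
  0 < a < n * (1 + 11 / 5 * e) ->
  n * (1 - e / 2) < E -> w ^+ 2 <= a * (e ^+ 2 * n) ->
  0 <= r ^+ 2 * a + 2 * r * s * w + s ^+ 2 * E ->
  r * a + s * w <=
    tau * Num.sqrt (a * (r ^+ 2 * a + 2 * r * s * w + s ^+ 2 * E)).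
Proof.
move=> n0 /andP[e0 e1] /andP[r0 r1] r99 sE s0 /andP[v75 v2] /andP[t0 t1] T1.
move=> /andP[a0 an] En wa Y0.
have s2 : 0 < s ^+ 2 by rewrite sE subr_gt0 exprn_ilt1.
have r2 : 9999 / 10000 <= r ^+ 2 by clear -r99; lra.
have r9 : 99 / 100 <= r.
  by rewrite -(ler_pXn2r (ltn0Sn 1)) ?nnegrE// (le_trans _ r2)//; clear; lra.
have s1 : s <= 1 / 100.
  by rewrite -(ler_pXn2r (ltn0Sn 1)) ?nnegrE// sE (le_trans r99)//; clear; lra.
have en0 : 0 < e * n by rewrite mulr_gt0.
have L0 : 0 < e ^+ 2 * n by rewrite mulr_gt0 ?exprn_gt0.
have Len : e ^+ 2 * n <= e * n / 1000.
  have : e * n * e <= e * n * (1 / 1000) by rewrite ler_wpM2l// ltW.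
  by clear; rewrite expr2; lra.
set K := r ^+ 2 * a + 2 * r * s * w in Y0 *.
rewrite leNgt; apply/negP => hit.
have p0 : 0 < r * a + s * w.
  by apply: le_lt_trans hit; rewrite mulr_ge0 ?sqrtr_ge0// (le_trans r0).
have {hit} : tau ^+ 2 * (a * (K + s ^+ 2 * E)) < (r * a + s * w) ^+ 2.
  rewrite -[X in _ * X < _]sqr_sqrtr; last by rewrite mulr_ge0// ltW.
  by rewrite -exprMn ltrXn2r// mulr_ge0 ?sqrtr_ge0// (le_trans r0).
(* With the squared inner product in this form, [K] occurs on both sides and survives only with the
   factor [1 - tau^2]. That factor is at most [s^2 (1 - 2 r v)], so [s^2] divides out and the bound
   is uniform as [r] tends to 1. *)
have -> : (r * a + s * w) ^+ 2 = a * K + s ^+ 2 * w ^+ 2 by rewrite /K; ring.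
have h1 : s ^+ 2 * w ^+ 2 <= s ^+ 2 * (a * (e ^+ 2 * n)) by rewrite ler_wpM2l// ltW.
have Kle0 : K <= r ^+ 2 * a + 2 * (r * s * w) by rewrite /K le_eqVlt; apply/orP; left; apply/eqP; ring.
move: K Kle0 {Y0 p0} => K Kle0 h2.
have {h1 h2} : a * (tau ^+ 2 * (K + s ^+ 2 * E)) < a * (K + s ^+ 2 * (e ^+ 2 * n)).
  by clear -h1 h2; lra.
rewrite ltr_pM2l// => h.
have T2 : r ^+ 2 <= tau ^+ 2 by rewrite lerXn2r// nnegrE// (le_trans r0).
have E0 : 0 < E by apply: lt_trans En; rewrite mulr_gt0//; clear -e1; lra.
have TE : s ^+ 2 * (r ^+ 2 * E) <= tau ^+ 2 * (s ^+ 2 * E).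
  by rewrite mulrCA ler_wpM2r// mulr_ge0 ?(ltW s2) ?(ltW E0).
have rE : r ^+ 2 * (n * (1 - e / 2)) <= r ^+ 2 * E by rewrite ler_wpM2l ?sqr_ge0// ltW.
have h3 : s ^+ 2 * (r ^+ 2 * E) < (1 - tau ^+ 2) * K + s ^+ 2 * (e ^+ 2 * n).
  by clear -h TE; lra.
have enn : e * n <= n / 1000 by rewrite mulrC ler_wpM2l//; [exact: ltW|clear -e1; lra].
have [K0|K0] := leP 0 K; last first.
  have t2 : 0 <= 1 - tau ^+ 2 by rewrite subr_ge0 exprn_ile1// (le_trans r0).
  have h4 : (1 - tau ^+ 2) * K <= 0 by rewrite mulr_ge0_le0// ltW.
  have : s ^+ 2 * (r ^+ 2 * E) < s ^+ 2 * (e ^+ 2 * n) by clear -h3 h4; lra.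
  rewrite ltr_pM2l// => h5.
  have h6 : 9999 / 10000 * (n * (1 - e / 2)) <= r ^+ 2 * (n * (1 - e / 2)).
    by rewrite ler_wpM2r// mulr_ge0 ?(ltW n0)//; clear -e1; lra.
  by clear -h5 h6 rE Len enn n0; lra.
have h4 : r ^+ 2 * E < (1 - 2 * r * v) * K + e ^+ 2 * n.
  rewrite -(ltr_pM2l s2); apply: (lt_le_trans h3); rewrite mulrDr lerD2r mulrA.
  by rewrite ler_wpM2r.
have wn : `|w| <= 21 / 20 * (e * n).
  have h0 : 0 <= 21 / 20 * (e * n) by rewrite mulr_ge0// ltW.
  rewrite -(ler_pXn2r (ltn0Sn 1)) ?nnegrE// real_normK ?num_real// (le_trans wa)//.
  have h5 : a * (e ^+ 2 * n) <= n * (11 / 10) * (e ^+ 2 * n).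
    rewrite ler_wpM2r ?(ltW L0)// (le_trans (ltW an))// ler_wpM2l ?(ltW n0)//.
    by clear -e1; lra.
  have h6 : 0 <= n * (e ^+ 2 * n) by rewrite mulr_ge0 ?(ltW n0) ?(ltW L0).
  have -> : (21 / 20 * (e * n)) ^+ 2 = 441 / 400 * (n * (e ^+ 2 * n)) by field.
  by clear -h5 h6; lra.
have sw : r * s * w <= 1 / 100 * (21 / 20 * (e * n)).
  have rs0 : 0 <= r * s by rewrite mulr_ge0.
  have rs1 : r * s <= 1 / 100 by rewrite (le_trans _ s1)// ler_piMl// ltW.
  apply: (@le_trans _ _ (r * s * `|w|)); first by rewrite ler_wpM2l ?ler_norm.
  exact: ler_pM.
have Kle : K <= r ^+ 2 * (n * (1 + 11 / 5 * e)) + 21 / 1000 * (e * n).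
  have h5 : r ^+ 2 * a <= r ^+ 2 * (n * (1 + 11 / 5 * e)) by rewrite ler_wpM2l ?sqr_ge0// ltW.
  by clear -h5 Kle0 sw; lra.
have rv0 : 99 / 100 * (7 / 5 * e) <= r * v by rewrite ler_pM// mulr_ge0// ltW.
have rv : 277 / 100 * e <= 2 * r * v by rewrite -mulrA; clear -rv0 e0; lra.
have rv1 : 2 * r * v <= 1.
  have h5 : r * v <= 1 * (2 * e).
    by apply: ler_pM => //; [|exact: ltW]; clear -v75 e0; lra.
  by rewrite -mulrA; clear -h5 e1; lra.
have h5 : (1 - 2 * r * v) * K <=
    (1 - 277 / 100 * e) * (r ^+ 2 * (n * (1 + 11 / 5 * e)) + 21 / 1000 * (e * n)).
  by apply: ler_pM => //; clear -rv rv1; lra.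
have r2n : r ^+ 2 * (e * n) <= e * n.
  by rewrite ler_piMl ?(ltW en0)// exprn_ile1// ltW.
have r2n' : 9999 / 10000 * (e * n) <= r ^+ 2 * (e * n) by rewrite ler_wpM2r// ltW.
have e2r : 0 <= r ^+ 2 * (e ^+ 2 * n) by rewrite mulr_ge0 ?sqr_ge0// ltW.
by clear -h4 h5 rE r2n' e2r Len L0 en0; lra.
Qed.

(** Every term is proportional to [k = 1 - rho]: the gap [tau - rho] is at least [9/20 k], because
    [rho <= r^2] and [tau >= r], while the fluctuations carry factors at most [8/5 k] and [2 k].
    Hence deviations by a fixed fraction of [n] are affordable even when [k] is small. *)
Lemma distant_upper (n r rho tau a b Q : R) : 0 < n -> 9 / 10 <= r < 1 -> r <= tau <= 1 ->
  0 <= rho <= r ^+ 2 -> n * (9 / 10) < a < n * (11 / 10) ->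
  n * (9 / 10) < b < n * (11 / 10) -> `|2 * Q| <= n / 5 ->
  rho * (a + b) + 2 * Q <=
  tau * Num.sqrt ((a + b + 2 * rho * Q) ^+ 2 - (1 - rho ^+ 2) * (a - b) ^+ 2).
Proof.
move=> n0 /andP[r9 r1] /andP[t0 t1] /andP[p0 pr] /andP[a1 a2] /andP[b1 b2] hQ.
have p1 : rho < 1 by rewrite (le_lt_trans pr)// exprn_ilt1//; clear -r9; lra.
have Np : 0 < a + b by clear -a1 b1 n0; lra.
rewrite leNgt; apply/negP => hit.
have p01 : 0 <= rho <= 1 by rewrite p0 ltW.
have tau0 : 0 <= tau by clear -r9 t0; lra.
have hQ' : `|2 * Q| <= (a + b) / 2 by rewrite (le_trans hQ)//; clear -a1 b1 n0; lra.
have := corr_upper p01 tau0 Np hQ' hit.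
have -> : (1 - rho ^+ 2) * (a - b) ^+ 2 / (a + b) = (1 - rho ^+ 2) * ((a - b) ^+ 2 / (a + b)).
  exact: esym (mulrA _ _ _).
have m0 : 0 <= (a - b) ^+ 2 / (a + b) by rewrite divr_ge0 ?sqr_ge0 ?(ltW Np).
have m1 : (a - b) ^+ 2 / (a + b) <= n / 40.
  rewrite ler_pdivrMr//; have h : (a - b) ^+ 2 <= (n / 5) ^+ 2.
    rewrite -[leLHS]real_normK ?num_real// lerXn2r ?nnegrE ?divr_ge0 ?(ltW n0)//.
    by rewrite ler_norml; apply/andP; split; clear -a1 a2 b1 b2; lra.
  have h' : n * (n * (9 / 5)) <= n * (a + b).
    by rewrite ler_wpM2l ?(ltW n0)//; clear -a1 b1; lra.
  have := sqr_ge0 n.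
  by clear -h h'; lra.
move: ((a - b) ^+ 2 / (a + b)) m0 m1 => m m0 m1.
set k := 1 - rho; have k0 : 0 < k by rewrite /k; lra.
have h1 : 9 / 20 * k <= tau - rho.
  have h : 9 / 20 * k <= r - rho by rewrite /k; clear -r9 r1 p0 pr; nra.
  by clear -h t0; lra.
have h2 : 0 <= 1 - tau * rho <= 8 / 5 * k.
  have h : tau * rho <= 1 by rewrite mulr_ile1// ltW.
  rewrite subr_ge0 h/=.
  have h' : 1 - r * rho <= 8 / 5 * k.
    have g1 : rho * (8 / 5 - r) <= r ^+ 2 * (8 / 5 - r).
      by apply: ler_wpM2r => //; clear -r1; lra.
    have g2 : 0 <= (1 - r) * (3 / 5 + r * (3 / 5 - r)).
      by apply: mulr_ge0; clear -r9 r1; [lra|nra].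
    by rewrite /k; clear -g1 g2; lra.
  have h'' : r * rho <= tau * rho by rewrite ler_wpM2r.
  by clear -h' h''; lra.
have h3 : 0 <= 1 - rho ^+ 2 <= 2 * k by rewrite /k; apply/andP; split; clear -p0 p1; nra.
have h4 : 9 / 20 * k * (9 / 5 * n) <= (tau - rho) * (a + b).
  apply: ler_pM => //; [clear -k0; lra|clear -n0; lra|].
  by clear -a1 b1; lra.
have h5 : 2 * Q * (1 - tau * rho) <= n / 5 * (8 / 5 * k).
  apply: (@le_trans _ _ (`|2 * Q| * (1 - tau * rho))).
    by rewrite ler_wpM2r ?ler_norm//; case/andP: h2.
  by apply: ler_pM => //; case/andP: h2.
have h6 : tau * ((1 - rho ^+ 2) * m) <= 1 * (2 * k * (n / 40)).
  case/andP: h3 => h3 h3'; apply: ler_pM => //; first by rewrite mulr_ge0.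
  exact: ler_pM.
have kn : 0 < k * n by rewrite mulr_gt0.
rewrite -(mulrA 2 tau); clear -h4 h5 h6 kn.
by lra.
Qed.

End correlation_inequalities.

(** * Moderate deviations for a pair of columns *)

Section measurable_sets.
Context {R : realType} d (T : measurableType d).
Implicit Types f g : T -> R.

Lemma measurable_set_lt f g : measurable_fun setT f -> measurable_fun setT g ->
  measurable [set x | f x < g x].
Proof.
move=> mf mg; have := measurable_funB mg mf measurableT (measurable_itv `]0, +oo[).
rewrite setTI; congr measurable; apply/seteqP; split => x /=;
by rewrite in_itv/= andbT subr_gt0.
Qed.

Lemma measurable_set_le f g : measurable_fun setT f -> measurable_fun setT g ->
  measurable [set x | f x <= g x].
Proof.
move=> mf mg; have := measurable_funB mg mf measurableT (measurable_itv `[0, +oo[).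
rewrite setTI; congr measurable; apply/seteqP; split => x /=;
by rewrite in_itv/= andbT subr_ge0.
Qed.

Lemma measurable_preimage d' (S : measurableType d') (h : T -> S) (A : set S) :
  measurable_fun setT h -> measurable A -> measurable [set x | A (h x)].
Proof. by move=> mh mA; rewrite -[X in measurable X]setTI; exact: mh. Qed.

End measurable_sets.

Section Pr_prod_bounds.
Context {R : realType} d d' (T : measurableType d) (S : measurableType d').
Variables (P : probability T R) (Q : probability S R) (A : set (T * S)).
Hypothesis mA : measurable A.

Lemma Pr_prod_le (c : R) : (forall x, Pr Q [set y | A (x, y)] <= c) ->
  Pr (P \x Q)%E A <= c.
Proof.
move=> H; rewrite Pr_Ex// (Ex_prod1 P Q (bmf_indic mA)) -[leRHS](Ex_cst P).
apply: Ex_le; [exact: (bmf_Ex1 P Q (bmf_indic mA))|exact: bmf_cst|].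
by move=> x; rewrite -(Pr_Ex_preimage Q (pair1_measurable x) mA).
Qed.

Lemma Pr_prod_ge (c : R) : (forall x, c <= Pr Q [set y | A (x, y)]) ->
  c <= Pr (P \x Q)%E A.
Proof.
move=> H; rewrite Pr_Ex// (Ex_prod1 P Q (bmf_indic mA)) -[leLHS](Ex_cst P).
apply: Ex_le; [exact: bmf_cst|exact: (bmf_Ex1 P Q (bmf_indic mA))|].
by move=> x; rewrite -(Pr_Ex_preimage Q (pair1_measurable x) mA).
Qed.

End Pr_prod_bounds.

Section pair_estimates.
Context {R : realType} (n : nat).
Local Notation S := (n.-tuple R).
Local Notation gam := (tprod (@stdN R) n).
Local Notation gam2 := (gam \x gam)%E.
Implicit Types (x y e : S) (a b c : R).

Definition corr_hit (tau : R) : set (S * S) :=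
  [set z | tau * Num.sqrt (sqnorm z.1 * sqnorm z.2) < dotp z.1 z.2].

Lemma measurable_sqrt (f : S * S -> R) : measurable_fun setT f ->
  measurable_fun setT (fun z => Num.sqrt (f z)).
Proof.
move=> mf; apply: (measurableT_comp (f := @Num.sqrt R)) => //.
by apply: continuous_measurable_fun => w; exact: sqrt_continuous.
Qed.

Let msq1 : measurable_fun setT (fun z : S * S => sqnorm z.1).
Proof. by apply: (measurableT_comp (@measurable_sqnorm R n)); exact: measurable_fst. Qed.

Let msq2 : measurable_fun setT (fun z : S * S => sqnorm z.2).
Proof. by apply: (measurableT_comp (@measurable_sqnorm R n)); exact: measurable_snd. Qed.

Lemma measurable_corr_hit tau : measurable (corr_hit tau).
Proof.
apply: measurable_set_lt; last exact: measurable_dotp.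
apply: measurable_funM => //; apply: measurable_sqrt; exact: measurable_funM.
Qed.

Lemma dotpC x y : dotp x y = dotp y x.
Proof. by apply: eq_bigr => k _; rewrite mulrC. Qed.

Lemma corr_hit_sym tau x y : corr_hit tau (x, y) -> corr_hit tau (y, x).
Proof. by rewrite /corr_hit/= mulrC (dotpC y) mulrC [sqnorm y * _]mulrC. Qed.

Lemma sqnorm_lincomb a b x e :
  sqnorm (lincomb a b x e) = a ^+ 2 * sqnorm x + 2 * a * b * dotp x e + b ^+ 2 * sqnorm e.
Proof.
rewrite /sqnorm /dotp !mulr_sumr -!big_split/=.
by apply: eq_bigr => k _; rewrite tnth_mktuple; ring.
Qed.

Lemma dotp_lincomb a b a' b' x e : dotp (lincomb a b x e) (lincomb a' b' x e) =
  a * a' * sqnorm x + (a * b' + b * a') * dotp x e + b * b' * sqnorm e.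
Proof.
rewrite /sqnorm /dotp !mulr_sumr -!big_split/=.
by apply: eq_bigr => k _; rewrite !tnth_mktuple; ring.
Qed.

Lemma dotp_lincombr a b x e : dotp x (lincomb a b x e) = a * sqnorm x + b * dotp x e.
Proof.
rewrite /sqnorm /dotp !mulr_sumr -!big_split/=.
by apply: eq_bigr => k _; rewrite !tnth_mktuple; ring.
Qed.

Lemma sqr_dotp_eq0 x e : sqnorm x = 0 -> dotp x e = 0.
Proof.
move=> /eqP; rewrite psumr_eq0; last by move=> k _; exact: sqr_ge0.
move=> /allP h; rewrite /dotp big1// => k _.
have := h k (mem_index_enum k); rewrite sqrf_eq0 => /eqP ->.
by rewrite mul0r.
Qed.

(* Rotating the pair [(x, e)] by the half angle makes the two squared norms of
   [(x, rho x + sqrt(1 - rho^2) e)] depend on the new pair symmetrically. *)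
Definition rot_hit (tau rho : R) : set (S * S) :=
  [set z | tau * Num.sqrt ((sqnorm z.1 + sqnorm z.2 + 2 * rho * dotp z.1 z.2) ^+ 2 -
      (1 - rho ^+ 2) * (sqnorm z.1 - sqnorm z.2) ^+ 2) <
    rho * (sqnorm z.1 + sqnorm z.2) + 2 * dotp z.1 z.2].

Lemma measurable_rot_hit tau rho : measurable (rot_hit tau rho).
Proof.
have mN : measurable_fun setT (fun z : S * S => sqnorm z.1 + sqnorm z.2).
  exact: measurable_funD.
have mQ := @measurable_dotp R n.
apply: measurable_set_lt; last first.
  by apply: measurable_funD; exact: measurable_funM.
apply: measurable_funM => //; apply: measurable_sqrt; apply: measurable_funB.
  by apply: measurable_funX; apply: measurable_funD => //; exact: measurable_funM.
by apply: measurable_funM => //; apply: measurable_funX; exact: measurable_funB.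
Qed.

Lemma measurable_step_hit (tau rho : R) :
  measurable [set z : S * S | corr_hit tau (z.1, lincomb rho (sigr rho) z.1 z.2)].
Proof.
apply: (measurable_preimage (h := fun z : S * S => (z.1, lincomb rho (sigr rho) z.1 z.2))).
  by apply: measurable_fun_pair => //; exact: measurable_lincomb.
exact: measurable_corr_hit.
Qed.

Lemma Pr_rotation a b (A : set (S * S)) : a ^+ 2 + b ^+ 2 = 1 -> measurable A ->
  Pr gam2 [set z | A (lincomb a b z.1 z.2, lincomb b (- a) z.1 z.2)] = Pr gam2 A.
Proof.
move=> ab mA.
have mW : measurable_fun setT
    (fun z : S * S => (lincomb a b z.1 z.2, lincomb b (- a) z.1 z.2)).
  by apply: measurable_fun_pair; exact: measurable_lincomb.
rewrite (Pr_Ex_preimage gam2 mW mA).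
by rewrite (Pr_Ex gam2 mA) -(Ex_rotation ab (bmf_indic mA)).
Qed.

Lemma Pr_rot_hit (tau rho : R) : 0 <= rho < 1 ->
  Pr gam2 [set z | corr_hit tau (z.1, lincomb rho (sigr rho) z.1 z.2)] =
  Pr gam2 (rot_hit tau rho).
Proof.
move=> /andP[r0 r1]; set sg := sigr rho.
have sg2 : rho ^+ 2 + sg ^+ 2 = 1 by apply: sigr_sqr; rewrite r0 ltW.
have sg0 : 0 <= sg by exact: sqrtr_ge0.
have sg1 : sg <= 1 by clear -sg2 sg0; nra.
(* Half-angle formulas: with [rho] and [sg] the sine and cosine of an angle, [c] and [s] are the
   sine and cosine of its half. The rotated pair then becomes [(c u + s v, s u + c v)], symmetric in
   the two weights. *)
pose c := Num.sqrt ((1 - sg) / 2); pose s := Num.sqrt ((1 + sg) / 2).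
have c2 : c ^+ 2 = (1 - sg) / 2 by rewrite sqr_sqrtr// divr_ge0// subr_ge0.
have s2 : s ^+ 2 = (1 + sg) / 2 by rewrite sqr_sqrtr// divr_ge0// addr_ge0.
have cs : 2 * (c * s) = rho.
  have c0 : 0 <= c by exact: sqrtr_ge0.
  have s0 : 0 <= s by exact: sqrtr_ge0.
  apply: (@pexpIrn _ 2) => //; rewrite ?nnegrE ?mulr_ge0//.
  rewrite !exprMn c2 s2; apply: (addIr (sg ^+ 2)); rewrite sg2; by field.
have ab : c ^+ 2 + s ^+ 2 = 1 by rewrite c2 s2; field.
rewrite -(Pr_rotation ab (measurable_step_hit tau rho)); congr Pr.
have E (z : S * S) : lincomb rho sg (lincomb c s z.1 z.2) (lincomb s (- c) z.1 z.2) =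
    lincomb s c z.1 z.2.
  have e1 : rho * c + sg * s = s.
    rewrite -cs; transitivity (s * (2 * c ^+ 2 + sg)); first by ring.
    by rewrite c2; field.
  have e2 : rho * s - sg * c = c.
    rewrite -cs; transitivity (c * (2 * s ^+ 2 - sg)); first by ring.
    by rewrite s2; field.
  apply: eq_from_tnth => k; rewrite !tnth_mktuple.
  transitivity ((rho * c + sg * s) * tnth z.1 k + (rho * s - sg * c) * tnth z.2 k).
    by ring.
  by rewrite e1 e2.
apply/seteqP; suff H z : corr_hit tau (lincomb c s z.1 z.2, lincomb s c z.1 z.2) =
    rot_hit tau rho z by split => z; rewrite /= E H.
rewrite /corr_hit /rot_hit /= dotp_lincomb !sqnorm_lincomb.
move: (sqnorm z.1) (sqnorm z.2) (dotp z.1 z.2) => A B Q.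
set X := (X in Num.sqrt X); set Y := (A + B + 2 * rho * Q) ^+ 2 - _.
have XY : X = (1 / 2) ^+ 2 * Y.
  rewrite /X /Y.
  have -> : 2 * c * s = rho by rewrite -mulrA.
  have -> : 2 * s * c = rho by rewrite -mulrA (mulrC s).
  have -> : 1 - rho ^+ 2 = sg ^+ 2 by rewrite -sg2; ring.
  by rewrite c2 s2; field.
rewrite XY sqrtrM ?sqr_ge0// sqrtr_sqr ger0_norm ?divr_ge0//.
have -> : c * s * A + (c * c + s * s) * Q + s * c * B = 1 / 2 * (rho * (A + B) + 2 * Q).
  rewrite -cs -!expr2 ab; by field.
by rewrite mulrCA ltr_pM2l// divr_gt0.
Qed.

Definition bad_pair (t : R) : set (S * S) :=
  [set z | ~ (near_sqnorm t z.1 /\ near_sqnorm t z.2)].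

Lemma measurable_bad_pair t : measurable (bad_pair t).
Proof.
apply: measurableC; apply: (measurableI [set z : S * S | near_sqnorm t z.1]).
  exact: (measurable_preimage (@measurable_fst _ _ S S) (measurable_near_sqnorm t)).
exact: (measurable_preimage (@measurable_snd _ _ S S) (measurable_near_sqnorm t)).
Qed.

Lemma Pr_fst (A : set S) : measurable A -> Pr gam2 [set z | A z.1] = Pr gam A.
Proof.
move=> mA; rewrite (Pr_Ex_preimage gam2 (@measurable_fst _ _ S S) mA) (Pr_Ex gam mA).
rewrite Ex_prod1; last exact: (bmf_comp (bmf_indic mA) (@measurable_fst _ _ S S)).
by apply: eq_Ex => x /=; rewrite Ex_cst.
Qed.

Lemma Pr_snd (A : set S) : measurable A -> Pr gam2 [set z | A z.2] = Pr gam A.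
Proof.
move=> mA; rewrite (Pr_Ex_preimage gam2 (@measurable_snd _ _ S S) mA) (Pr_Ex gam mA).
rewrite Ex_prod2; last exact: (bmf_comp (bmf_indic mA) (@measurable_snd _ _ S S)).
by apply: eq_Ex => x /=; rewrite Ex_cst.
Qed.

Lemma Pr_bad_pair t : 0 <= t <= 1 / 4 ->
  Pr gam2 (bad_pair t) <= 4 * expR (- (n%:R * t ^+ 2 / 8)).
Proof.
move=> t4; have mn := @measurableC _ _ _ (@measurable_near_sqnorm R n t).
have m1 : measurable [set z : S * S | (~` near_sqnorm t) z.1].
  exact: (measurable_preimage (@measurable_fst _ _ S S) mn).
have m2 : measurable [set z : S * S | (~` near_sqnorm t) z.2].
  exact: (measurable_preimage (@measurable_snd _ _ S S) mn).
apply: (@le_trans _ _ (Pr gam2 ([set z | (~` near_sqnorm t) z.1] `|`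
    [set z | (~` near_sqnorm t) z.2]))).
  apply: Pr_le; [exact: measurable_bad_pair|exact: measurableU|].
  by move=> z /= /not_andP.
apply: (le_trans (PrU _ m1 m2)); rewrite Pr_fst// Pr_snd//.
have := chi_square_concentration n t4.
by move: (Pr gam _) (expR _) => p q; clear; lra.
Qed.

(** A rotation by 45 degrees writes the inner product as half the difference of two squared norms,
    so concentration of norms also controls inner products. *)
Definition bad_rot (t : R) : set (S * S) :=
  [set z | bad_pair t (lincomb (Num.sqrt (1 / 2)) (Num.sqrt (1 / 2)) z.1 z.2,
                       lincomb (Num.sqrt (1 / 2)) (- Num.sqrt (1 / 2)) z.1 z.2)].

Lemma measurable_bad_rot t : measurable (bad_rot t).
Proof.
apply: (measurable_preimage (h := fun z : S * S =>
  (lincomb (Num.sqrt (1 / 2)) (Num.sqrt (1 / 2)) z.1 z.2,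
   lincomb (Num.sqrt (1 / 2)) (- Num.sqrt (1 / 2)) z.1 z.2))).
  by apply: measurable_fun_pair; exact: measurable_lincomb.
exact: measurable_bad_pair.
Qed.

Lemma Pr_bad_rot t : 0 <= t <= 1 / 4 ->
  Pr gam2 (bad_rot t) <= 4 * expR (- (n%:R * t ^+ 2 / 8)).
Proof.
move=> t4; rewrite /bad_rot Pr_rotation; [exact: Pr_bad_pair| |exact: measurable_bad_pair].
by rewrite sqr_sqrtr ?divr_ge0//; field.
Qed.

Lemma not_bad_rot t z : 0 <= t -> ~ bad_rot t z -> `|2 * dotp z.1 z.2| <= 2 * t * n%:R /\
  2 * n%:R * (1 - t) <= sqnorm z.1 + sqnorm z.2.
Proof.
move=> t0 /contrapT[]; rewrite /near_sqnorm /= !sqnorm_lincomb sqrrN.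
rewrite sqr_sqrtr ?divr_ge0//.
have -> : 2 * Num.sqrt (1 / 2) * Num.sqrt (1 / 2) = 1 :> R.
  by rewrite -mulrA -expr2 sqr_sqrtr ?divr_ge0//; field.
have -> : 2 * Num.sqrt (1 / 2) * - Num.sqrt (1 / 2) = -1 :> R.
  by rewrite -mulrA mulrN -expr2 sqr_sqrtr ?divr_ge0//; field.
move: (sqnorm z.1) (sqnorm z.2) (dotp z.1 z.2) => A B Q.
move=> /andP[h1 h2] /andP[h3 h4]; rewrite ler_norml.
by split; [apply/andP; split|]; clear -h1 h2 h3 h4; lra.
Qed.

(** The slack in [distant_upper] allows deviations by the fixed fraction 1/10, so the bound is
    exponential in [n] and will beat a union over [p^2] pairs. *)
Lemma distant_hit (tau r rho : R) : (0 < n)%N -> 9 / 10 <= r < 1 -> r <= tau <= 1 ->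
  0 <= rho <= r ^+ 2 ->
  Pr gam2 [set z | corr_hit tau (z.1, lincomb rho (sigr rho) z.1 z.2)] <=
  8 * expR (- (n%:R / 800)).
Proof.
move=> n0 r9 rt rhor; have /andP[p0 pr] := rhor; have /andP[r9' r1] := r9.
have p1 : rho < 1 by rewrite (le_lt_trans pr)// exprn_ilt1//; clear -r9'; lra.
rewrite Pr_rot_hit ?p0//.
have t01 : 0 <= (1 / 10 : R) <= 1 / 4 by apply/andP; split; lra.
apply: (@le_trans _ _ (Pr gam2 (bad_pair (1 / 10) `|` bad_rot (1 / 10)))).
  apply: Pr_le; [exact: measurable_rot_hit| |].
    by apply: measurableU; [exact: measurable_bad_pair|exact: measurable_bad_rot].
  move=> z hit; apply: contrapT => /not_orP[/contrapT[/andP[g1 g2] /andP[g3 g4]] g].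
  have [q _] := not_bad_rot (andP t01).1 g.
  have nn : 0 < n%:R :> R by rewrite ltr0n.
  move: hit; rewrite /rot_hit/= ltNge => /negP; apply.
  apply: (@distant_upper _ n%:R r) => //.
  - by apply/andP; split; clear -g1 g2; lra.
  - by apply/andP; split; clear -g3 g4; lra.
  - by rewrite [leRHS](_ : _ = 2 * (1 / 10) * n%:R)//; field.
apply: (le_trans (PrU _ (measurable_bad_pair _) (measurable_bad_rot _))).
have := Pr_bad_pair t01; have := Pr_bad_rot t01.
have -> : n%:R * (1 / 10) ^+ 2 / 8 = n%:R / 800 :> R by field.
by move: (Pr gam2 _) (Pr gam2 _) (expR _) => p q w; clear; lra.
Qed.

Definition ray (t : R) : set (S * S) :=
  [set z | t * Num.sqrt (sqnorm z.1) <= dotp z.1 z.2].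

Lemma measurable_ray (t : R) : measurable (ray t).
Proof.
apply: measurable_set_le; last exact: measurable_dotp.
by apply: measurable_funM => //; exact: measurable_sqrt.
Qed.

Let mpos : measurable [set z : S * S | 0 < sqnorm z.1].
Proof. exact: measurable_set_lt. Qed.

Lemma Pr_ray_le (t : R) : Pr gam2 (ray t `&` [set z | 0 < sqnorm z.1]) <= Qtail t.
Proof.
apply: Pr_prod_le; first exact: measurableI (measurable_ray t) mpos.
move=> c; have [c0|c0] := ltP 0 (sqnorm c).
  rewrite -(dotp_tail t c0) le_eqVlt; apply/orP; left; apply/eqP; congr Pr.
  by apply/seteqP; split => e //= -[].
rewrite (_ : [set y | _] = set0); first by rewrite /Pr measure0 /Qtail fine_ge0.
by apply/seteqP; split => e //= -[_]; rewrite ltNge c0.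
Qed.

Lemma Pr_ray_ge (t : R) : Qtail t <= Pr gam2 (ray t).
Proof.
apply: Pr_prod_ge; first exact: measurable_ray.
move=> c; have [c0|c0] := ltP 0 (sqnorm c); first by rewrite -(dotp_tail t c0).
have {}c0 : sqnorm c = 0 by apply/eqP; rewrite eq_le c0 sqnorm_ge0.
rewrite (_ : [set y | _] = setT).
  have -> : Pr gam setT = 1 by rewrite Pr_Ex// indicT; exact: Ex_cst.
  have := Pr_le1 stdN (measurable_itv `[t, +oo[); exact.
by apply/seteqP; split => e //= _; rewrite /ray/= c0 sqr_dotp_eq0// sqrtr0 mulr0.
Qed.

Section bulk.
Variables (e v r tau : R).
Hypotheses (n0 : (0 < n)%N) (e01 : 0 < e <= 1 / 1000) (r01 : 0 <= r < 1).
Hypothesis tauE : tau = r + (1 - r ^+ 2) * v.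

Let nn : 0 < n%:R :> R. Proof. by rewrite ltr0n. Qed.
Let sn := Num.sqrt (n%:R : R).
Let sn0 : 0 < sn. Proof. by rewrite sqrtr_gt0. Qed.
Let nE : n%:R = sn ^+ 2. Proof. by rewrite sqr_sqrtr// ltW. Qed.

Let e4 : 0 <= 4 * e <= 1 / 4.
Proof. by case/andP: e01 => ? ?; apply/andP; split; lra. Qed.

Let t01 : 0 <= (1 / 10 : R) <= 1 / 4.
Proof. by apply/andP; split; lra. Qed.

(** Width [4 e] makes the exponent [2 e^2 n]; once [e^2 n = log p], this is of order [p^(-2)],
    negligible against a hit probability of order [1 / p]. *)
Let bad4 : Pr gam2 (bad_pair (4 * e)) <= 4 * expR (- (2 * (e ^+ 2 * n%:R))).
Proof.
apply: (le_trans (Pr_bad_pair e4)); rewrite ler_pM2l// ler_expR lerN2.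
by rewrite le_eqVlt; apply/orP; left; apply/eqP; field.
Qed.

Local Notation step_hit := [set z | corr_hit tau (z.1, lincomb r (sigr r) z.1 z.2)].

Lemma step_hit_upper : 50 * e ^+ 2 <= v <= 2 * e ->
  Pr gam2 step_hit <= Qtail ((v - 50 * e ^+ 2) * sn) +
    (4 * expR (- (2 * (e ^+ 2 * n%:R))) + 4 * expR (- (n%:R / 800))).
Proof.
move=> v01; rewrite Pr_rot_hit//.
have mb := measurable_bad_pair (4 * e); have mr := measurable_bad_rot (1 / 10).
have mray := measurableI _ _ (measurable_ray ((v - 50 * e ^+ 2) * sn)) mpos.
have mU := measurableU _ _ mb mr.
apply: (@le_trans _ _ (Pr gam2 ((ray ((v - 50 * e ^+ 2) * sn) `&` [set z | 0 < sqnorm z.1])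
    `|` (bad_pair (4 * e) `|` bad_rot (1 / 10))))).
  apply: Pr_le; [exact: measurable_rot_hit|exact: measurableU|].
  move=> z hit; have [b|g] := pselect (bad_pair (4 * e) z); first by right; left.
  have [b|g'] := pselect (bad_rot (1 / 10) z); first by right; right.
  left; move: g => /contrapT[]; rewrite /near_sqnorm/= => g1 g2.
  have [q1 q2] := not_bad_rot (andP t01).1 g'.
  have a0 : 0 < sqnorm z.1.
    case/andP: g1 => g1 _; apply: lt_trans g1; rewrite mulr_gt0//.
    by case/andP: e4 => ? ?; lra.
  split => //; rewrite /ray/=.
  apply: (@bulk_upper _ sn n%:R e r v tau (sqnorm z.1) (sqnorm z.2)) => //.
  by rewrite (le_trans q1)//; move: q2 nn; lra.
apply: (le_trans (PrU gam2 mray mU)); apply: lerD; first exact: Pr_ray_le.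
apply: (le_trans (PrU gam2 mb mr)); apply: lerD => //.
have := Pr_bad_rot t01.
by have -> : n%:R * (1 / 10) ^+ 2 / 8 = n%:R / 800 :> R by field.
Qed.

Lemma step_hit_lower : 0 <= v <= 2 * e ->
  Qtail ((v + 50 * e ^+ 2) * sn) - 4 * expR (- (2 * (e ^+ 2 * n%:R))) <= Pr gam2 step_hit.
Proof.
move=> v01; rewrite Pr_rot_hit// lerBlDr.
have mb := measurable_bad_pair (4 * e); have mh := measurable_rot_hit tau r.
apply: (le_trans (Pr_ray_ge _)).
apply: (@le_trans _ _ (Pr gam2 (rot_hit tau r `|` bad_pair (4 * e)))).
  apply: Pr_le; [exact: measurable_ray|exact: measurableU|].
  move=> z hit; have [b|g] := pselect (bad_pair (4 * e) z); first by right.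
  left; move: g => /contrapT[]; rewrite /near_sqnorm/= => g1 g2.
  exact: (@bulk_lower _ sn n%:R e r v tau (sqnorm z.1) (sqnorm z.2)).
by apply: (le_trans (PrU gam2 mh mb)); rewrite lerD2l.
Qed.

Local Notation f := (hit_prob r (corr_hit tau)).

(** By [heavy_point], a hit forces the innovation to have a projection on [x] beyond [e sqrt n] in
    absolute value, or a squared norm below [n (1 - e / 2)]. *)
Lemma hit_prob_light x : 1 - r ^+ 2 <= 1 / 10000 -> 7 / 5 * e <= v <= 2 * e ->
  sqnorm x < n%:R * (1 + 11 / 5 * e) ->
  f x <= 2 * Qtail (e * sn) + expR (- (e ^+ 2 * n%:R / 32)).
Proof.
move=> r99 v75 xn; have /andP[e0 e1] := e01; have /andP[r0 r1] := r01.
have mh := measurable_corr_hit tau.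
have mstep : measurable_fun setT (fun w : S => (x, lincomb r (sigr r) x w)).
  apply: measurable_fun_pair => //.
  apply: (measurableT_comp (f := fun z : S * S => lincomb r (sigr r) z.1 z.2)
    (g := fun w : S => (x, w))); first exact: measurable_lincomb.
  exact: pair1_measurable.
rewrite /hit_prob -(Pr_Ex_preimage gam mstep mh).
have [x0|x0] := ltP 0 (sqnorm x); last first.
  have {}x0 : sqnorm x = 0 by apply/eqP; rewrite eq_le x0 sqnorm_ge0.
  rewrite (_ : [set w | _] = set0).
    rewrite /Pr measure0/= addr_ge0 ?expR_ge0// mulr_ge0// /Qtail fine_ge0//.
  by apply/seteqP; split => w //=; rewrite /corr_hit/= x0 mul0r sqrtr0 mulr0 sqr_dotp_eq0// ltxx.
pose A1 := [set w | e * sn * Num.sqrt (sqnorm x) <= dotp x w].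
pose A2 := [set w | dotp x w <= - (e * sn * Num.sqrt (sqnorm x))].
pose A3 := [set w : S | sqnorm w <= n%:R * (1 - e / 2)].
have md : measurable_fun setT (fun w => dotp x w).
  apply: (measurableT_comp (@measurable_dotp R n) (g := fun w : S => (x, w))).
  exact: pair1_measurable.
have m1 : measurable A1 by exact: measurable_set_le.
have m2 : measurable A2 by exact: measurable_set_le.
have m3 : measurable A3 by apply: measurable_set_le => //; exact: measurable_sqnorm.
have m12 := measurableU _ _ m1 m2.
apply: (@le_trans _ _ (Pr gam ((A1 `|` A2) `|` A3))).
  apply: Pr_le; [exact: (measurable_preimage mstep mh)|exact: measurableU|].
  move=> w hit; apply: contrapT => /not_orP[/not_orP[/negP]].
  rewrite -ltNge => w1 /negP; rewrite -ltNge => w2 /negP; rewrite -ltNge => w3.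
  move: hit; rewrite /corr_hit/= ltNge => /negP; apply.
  rewrite dotp_lincombr sqnorm_lincomb.
  have v02 : 0 <= v <= 2 * e.
    by case/andP: v75 => v7 ->; rewrite (le_trans _ v7)// mulr_ge0// ltW.
  have Y0 := sqnorm_ge0 (lincomb r (sigr r) x w).
  rewrite sqnorm_lincomb in Y0.
  have sgE : sigr r ^+ 2 = 1 - r ^+ 2.
    by rewrite -(@sigr_sqr _ r); [ring|rewrite r0 ltW].
  apply: (@heavy_point _ n%:R e r v) => //.
  - exact: sqrtr_ge0.
  - exact: (tau_itv e1 v02 r01 tauE).
  - by rewrite sgE; exact: tau_sqr_ge.
  - by rewrite x0.
  have b0 : 0 <= e * sn * Num.sqrt (sqnorm x) by rewrite !mulr_ge0 ?sqrtr_ge0// ltW.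
  apply: (@le_trans _ _ ((e * sn * Num.sqrt (sqnorm x)) ^+ 2)); last first.
    by rewrite !exprMn (sqr_sqrtr (ltW x0)) -nE mulrC.
  rewrite -real_normK ?num_real// lerXn2r ?nnegrE// ler_norml.
  by rewrite (ltW w1) (ltW w2).
have h12 := PrU gam m1 m2.
apply: (le_trans (PrU gam m12 m3)); apply: lerD.
  apply: (le_trans h12); rewrite /A1 /A2 dotp_tail// dotp_tailN//.
  by rewrite mulr_natl mulr2n.
have t1 : 0 <= e / 2 <= 1 by apply/andP; split; move: e0 e1; lra.
apply: (le_trans (chi_square_lower n t1)); rewrite ler_expR lerN2.
by rewrite le_eqVlt; apply/orP; left; apply/eqP; field.
Qed.

(** Light points contribute their small hit probability times the mean; heavy points contribute at
    most the probability of their norm. The cut 11/5 is small enough for [heavy_point] and large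
    enough for the second term to be smaller than [exp (- e^2 n)] by a power. *)
Lemma Ex_hit_sqr_le : 1 - r ^+ 2 <= 1 / 10000 -> 7 / 5 * e <= v <= 2 * e ->
  Ex gam (fun x => f x ^+ 2) <=
  (2 * Qtail (e * sn) + expR (- (e ^+ 2 * n%:R / 32))) * Ex gam f +
  expR (- (6 / 5 * (e ^+ 2 * n%:R))).
Proof.
move=> r99 v75; have /andP[e0 e1] := e01.
set k := 2 * Qtail _ + _.
have mh := measurable_corr_hit tau.
have bf : bmf f by exact: bmf_hit_prob.
pose H := [set x : S | n%:R * (1 + 11 / 5 * e) <= sqnorm x].
have mH : measurable H by apply: measurable_set_le => //; exact: measurable_sqnorm.
have bk := bmfZ k bf; have bH := bmf_indic (R := R) mH.
apply: (@le_trans _ _ (Ex gam (fun x => k * f x + \1_H x))).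
  apply: Ex_le; [exact: bmfX|exact: bmfD|].
  move=> x; have /andP[f0 f1] := hit_prob_itv r mh x.
  have [xn|xn] := leP (n%:R * (1 + 11 / 5 * e)) (sqnorm x).
    rewrite indicE mem_set//= (@le_trans _ _ 1)//; first by rewrite exprn_ile1.
    rewrite lerDr mulr_ge0// addr_ge0 ?expR_ge0// mulr_ge0// /Qtail fine_ge0//.
  rewrite indicE memNset/=; last by rewrite /H/= leNgt xn.
  by rewrite addr0 expr2 ler_wpM2r//; exact: hit_prob_light.
rewrite ExD// ExZ// lerD2l -Pr_Ex//.
have t1 : 0 <= 11 / 5 * e <= 1 / 3 by apply/andP; split; move: e0 e1; lra.
apply: (le_trans (chi_square_upper n t1)); rewrite ler_expR lerN2.
(* The chi-square exponent is [121/100 e^2 n] minus a term cubic in [e]; [e <= 1/1000] leaves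
   [6/5]. *)
have en : 0 <= n%:R * e ^+ 2 * (1 / 1000 - e).
  by rewrite mulr_ge0 ?subr_ge0// mulr_ge0 ?sqr_ge0 ?(ltW nn).
have en0 : 0 <= n%:R * e ^+ 2 by rewrite mulr_ge0 ?sqr_ge0 ?(ltW nn).
by move: en en0; lra.
Qed.

End bulk.
End pair_estimates.

(** * Reduction to adjacent columns *)

Section max_event.
Context {R : realType} d (T : measurableType d) (P : probability T R).
Variables (n p : nat) (r tau : R) (x : nat -> nat -> T -> R).
Local Notation S := (n.-tuple R).
Local Notation gam := (tprod (@stdN R) n).
Local Notation xcol := (col_of n x).

Lemma rho_hat_le i j w : 0 <= tau ->
  (rho_hat n x i j w <= tau) <-> ~ corr_hit tau (xcol i w, xcol j w).
Proof.
move=> t0; rewrite /corr_hit/=.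
have -> : rho_hat n x i j w =
    dotp (xcol i w) (xcol j w) / Num.sqrt (sqnorm (xcol i w) * sqnorm (xcol j w)).
  rewrite /rho_hat /dotp /sqnorm; congr (_ / Num.sqrt (_ * _));
  by apply: eq_bigr => k _; rewrite !tnth_mktuple.
move: (xcol i w) (xcol j w) => a b.
have [s0|s0] := ltP 0 (Num.sqrt (sqnorm a * sqnorm b)).
  by rewrite ler_pdivrMr// leNgt; split=> [/negP|/negP].
(* For a zero column the quotient is 0 by convention, which is at most [tau], and the strict
   inequality of a hit reads [0 < 0]. *)
have s00 : Num.sqrt (sqnorm a * sqnorm b) = 0.
  by apply/eqP; rewrite eq_le s0 sqrtr_ge0.
rewrite s00 invr0 mulr0 mulr0; split => // _.
have /eqP : sqnorm a * sqnorm b = 0.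
  have := s00 => /eqP; rewrite sqrtr_eq0 => h.
  by apply/eqP; rewrite eq_le h mulr_ge0// sqnorm_ge0.
rewrite mulf_eq0 => /orP[] /eqP h; first by rewrite sqr_dotp_eq0// ltxx.
by rewrite dotpC sqr_dotp_eq0// ltxx.
Qed.

Lemma Lmax_le (w : T) : (1 < p)%N -> 0 <= tau ->
  (Lmax n p x w <= tau) <->
  (forall i j, (i < j)%N -> (j < p)%N -> ~ corr_hit tau (xcol i w, xcol j w)).
Proof.
move=> p1 t0; split => [/bigmax_leP[_ H] i j ij jp|H].
  apply/(rho_hat_le _ _ _ t0).
  exact: (H (Ordinal (ltn_trans ij jp), Ordinal jp)).
apply/bigmax_leP; split; first by apply/rho_hat_le => //; exact: H.
by move=> [i j] /= ij; apply/rho_hat_le => //; exact: H.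
Qed.

Hypothesis HI : indep_vectors P n p x.
Hypothesis HN : forall k, (k < n)%N -> is_Np_AR P p r (x k).
Hypotheses (n0 : (0 < n)%N) (p1 : (1 < p)%N) (r9 : 9 / 10 <= r < 1) (rt : r <= tau <= 1).

Let r01 : 0 <= r < 1.
Proof. by case/andP: r9 => r9' ->; rewrite andbT (le_trans _ r9')// divr_ge0. Qed.

Local Notation D := (corr_hit tau).
Let Hit i j := [set w | D (xcol i w, xcol j w)].
Let All := [set w | forall i j, (i < j)%N -> (j < p)%N -> ~ D (xcol i w, xcol j w)].
Let Adj := [set w | forall i, (i < p.-1)%N -> ~ D (xcol i w, xcol i.+1 w)].

Let mHit i j : (i < p)%N -> (j < p)%N -> measurable (Hit i j).
Proof.
move=> ip jp; apply: (measurable_preimage (h := fun w => (xcol i w, xcol j w))).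
  by apply: measurable_fun_pair; exact: (measurable_xcol HN).
exact: measurable_corr_hit.
Qed.

Lemma measurable_no_hit : measurable All.
Proof.
rewrite (_ : All = [set w | forall j, (j < p)%N -> forall i, (i < j)%N ->
    ~ D (xcol i w, xcol j w)]).
  apply: measurable_forall_lt => j jp; apply: measurable_forall_lt => i ij.
  by apply: measurableC; apply: mHit => //; exact: ltn_trans jp.
by apply/seteqP; split => w H i j; [move=> ip ji|move=> ij jp]; exact: H.
Qed.

Let mAdj : measurable Adj.
Proof.
apply: measurable_forall_lt => i ip; apply: measurableC.
have ip1 : (i.+1 < p)%N by rewrite -(prednK (ltnW p1)).
by apply: mHit => //; exact: ltnW.
Qed.

(** Pairs at distance at least two; the extension by 0 lets the union bound run over a full double
    sum. *)
Let F (i j : 'I_p) : T -> R := if (i.+1 < j)%N then \1_(Hit i j) else cst 0.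

Let bF i j : bmf (F i j).
Proof. by rewrite /F; case: ifP => _; [apply: bmf_indic; exact: mHit|exact: bmf_cst]. Qed.

Let F_ge0 i j w : 0 <= F i j w.
Proof. by rewrite /F; case: ifP => _ //; rewrite indicE ler0n. Qed.

Let Ex_F i j : Ex P (F i j) <= 8 * expR (- (n%:R / 800)).
Proof.
rewrite /F; case: ifP => ij; last first.
  have h8 : 0 <= 8 * expR (- (n%:R / 800)) :> R by rewrite mulr_ge0 ?expR_ge0.
  have E0 := Ex_cst P (0 : R).
  by apply: (le_trans _ h8); rewrite le_eqVlt; apply/orP; left; apply/eqP; exact: E0.
have mD := measurable_corr_hit tau (n := n).
rewrite (_ : Ex P (\1_(Hit i j)) = Ex P (fun w => \1_D (xcol i w, xcol j w)))//.
rewrite (Ex_pair HI HN r01 (ltnW ij) (ltn_ord j) (bmf_indic mD)).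
set u := r ^+ (j - i).
have mW : measurable_fun setT (fun z : S * S => (z.1, lincomb u (sigr u) z.1 z.2)).
  by apply: measurable_fun_pair => //; exact: measurable_lincomb.
rewrite -(Pr_Ex_preimage (gam \x gam)%E mW mD).
apply: (distant_hit n0 r9 rt); case/andP: r01 => r0 r1.
rewrite exprn_ge0//= /u ler_wiXn2l//; first exact: ltW.
by rewrite ltn_subRL addn1.
Qed.

Lemma Pr_no_hit_adjacent :
  `|Pr P All - Pr P Adj| <= p%:R ^+ 2 * (8 * expR (- (n%:R / 800))).
Proof.
have mA := measurable_no_hit.
have AA : All `<=` Adj.
  by move=> w H i ip; apply: H => //; rewrite -(prednK (ltnW p1)).
have h1 := Pr_le P mA mAdj AA.
have h2 : Pr P Adj <= Pr P All + p%:R ^+ 2 * (8 * expR (- (n%:R / 800))).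
  have bS : bmf (fun w => \sum_(i < p) \sum_(j < p) F i j w).
    by apply: bmf_sum => i; apply: bmf_sum => j; exact: bF.
  have bA : bmf (\1_All : T -> R) by exact: bmf_indic.
  apply: (@le_trans _ _ (Ex P (fun w => \1_All w + \sum_(i < p) \sum_(j < p) F i j w))).
    rewrite Pr_Ex//; apply: Ex_le; [exact: bmf_indic|exact: bmfD|].
    move=> w; have S0 : 0 <= \sum_(i < p) \sum_(j < p) F i j w.
      by apply: sumr_ge0 => i _; apply: sumr_ge0 => j _.
    rewrite !indicE; have [a|na] := pselect (Adj w); last first.
      by rewrite (memNset na) addr_ge0.
    have [b|nb] := pselect (All w); first by rewrite (mem_set b) (mem_set a) lerDl.
    rewrite (mem_set a) (memNset nb) add0r.
    have [i [j [ij jp Dij]]] : exists i j, [/\ (i < j)%N, (j < p)%N & D (xcol i w, xcol j w)].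
      apply: contrapT => H; apply: nb => i j ij jp Dij; apply: H.
      by exists i, j.
    have ij1 : (i.+1 < j)%N.
      rewrite ltn_neqAle ij andbT; apply/eqP => e; apply: (a i); last by rewrite e.
      by rewrite -ltnS (prednK (ltnW p1)) e.
    have ip := ltn_trans ij jp.
    rewrite (bigD1 (Ordinal ip))//= (bigD1 (Ordinal jp))//=.
    rewrite {1}/F /= ij1 indicE mem_set// -addrA lerDl addr_ge0//.
      by apply: sumr_ge0.
    by apply: sumr_ge0 => k _; apply: sumr_ge0.
  rewrite ExD// -Pr_Ex// lerD2l Ex_sum; last by move=> i; apply: bmf_sum => j.
  have E i : Ex P (fun w => \sum_(j < p) F i j w) <= p%:R * (8 * expR (- (n%:R / 800))).
    rewrite Ex_sum//; apply: (@le_trans _ _ (\sum_(j < p) 8 * expR (- (n%:R / 800)))).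
      by apply: ler_sum => j _; exact: Ex_F.
    by rewrite sumr_const card_ord [leRHS]mulr_natl.
  apply: (@le_trans _ _ (\sum_(i < p) p%:R * (8 * expR (- (n%:R / 800))))).
    by apply: ler_sum => i _; exact: E.
  by rewrite sumr_const card_ord expr2 -mulrA [leRHS]mulr_natl.
by rewrite ler_norml; apply/andP; split; move: h1 h2;
  move: (Pr P All) (Pr P Adj) (p%:R ^+ 2 * _) => a b c; lra.
Qed.

Lemma Pr_no_hit_approx (H : nat) :
  `|Pr P All - (1 - Ex gam (hit_prob r D)) ^+ p.-1| <=
  p%:R ^+ 2 * (8 * expR (- (n%:R / 800))) +
  p%:R * (r ^+ H + 2 * H%:R * Ex gam (fun v => hit_prob r D v ^+ 2)).
Proof.
have mD := measurable_corr_hit tau (n := n).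
have symD := @corr_hit_sym _ n tau.
have E := Pr_no_adjacent_hit HI HN r01 mD symD (ltnW p1).
have h1 := Pr_no_hit_adjacent.
have h2 := survival_approx r01 mD symD H p.-1.
rewrite -E in h2.
rewrite -(subrKA (Pr P Adj)) (le_trans (ler_normD _ _))//; apply: lerD => //.
apply: (le_trans h2); rewrite ler_wpM2r ?ler_nat ?leq_pred// addr_ge0//.
  by rewrite exprn_ge0//; case/andP: r01.
by rewrite !mulr_ge0//; apply: Ex_ge0 => v; exact: sqr_ge0.
Qed.

End max_event.

(** * Asymptotics *)

Section limits.
Context {R : realType}.
Implicit Types f g : nat -> R.

Lemma cvg_near_eq f g (l : R) : (\forall n \near \oo, f n = g n) ->
  f @ \oo --> l -> g @ \oo --> l.
Proof.
move=> fg; apply: cvg_trans; apply: near_eq_cvg.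
exact: fg.
Qed.

Lemma cvg_limit_eq f (l l' : R) : f @ \oo --> l -> l = l' -> f @ \oo --> l'.
Proof. by move=> fl <-. Qed.

Lemma cvg0_squeeze f g : (\forall n \near \oo, `|f n| <= g n) ->
  g @ \oo --> (0 : R) -> f @ \oo --> (0 : R).
Proof.
move=> fg g0; apply: (@squeeze_cvgr _ _ _ _ (fun n => - g n) g).
- by near=> n; rewrite -ler_norml; near: n.
- by rewrite -[X in _ --> X]oppr0; exact: cvgN.
- exact: g0.
Unshelve. all: by end_near. Qed.

(** Squeezed by [exp (- b / (1 - b)) <= 1 - b <= exp (- b)], raised to the power [m]. *)
Lemma cvg_exp_poisson (b : nat -> R) (m : nat -> nat) (l : R) :
  (\forall n \near \oo, 0 <= b n) -> b @ \oo --> (0 : R) ->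
  (fun n => (m n)%:R * b n) @ \oo --> l ->
  (fun n => (1 - b n) ^+ m n) @ \oo --> expR (- l).
Proof.
move=> b0 bc mb.
apply: (@squeeze_cvgr _ _ _ _ (fun n => expR (- ((m n)%:R * b n * (1 - b n)^-1)))
                              (fun n => expR (- ((m n)%:R * b n)))).
- near=> n; have bn0 : 0 <= b n by near: n.
  have bn1 : b n <= 1 / 2 by near: n; apply: (cvgr_le 0) => //; rewrite divr_gt0.
  have c0 : 0 < 1 - b n by move: bn1; lra.
  apply/andP; split.
    rewrite -mulrA -mulrN expRM_natl lerXn2r ?nnegrE ?expR_ge0 ?(ltW c0)//.
    rewrite expRN invf_ple ?posrE ?expR_gt0//.
    apply: le_trans (expR_ge1Dx _); rewrite le_eqVlt; apply/orP; left; apply/eqP.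
    by field; rewrite gt_eqF.
  rewrite -mulrN expRM_natl lerXn2r ?nnegrE ?expR_ge0 ?(ltW c0)//.
  exact: expR_ge1Dx.
- apply: (continuous_cvg _ (@continuous_expR R _)); apply: cvgN.
  rewrite -[l]mulr1; apply: cvgM => //.
  rewrite -[X in _ --> X]invr1; apply: cvgV => //.
  by rewrite -[X in _ --> X]subr0; apply: cvgB => //; exact: cvg_cst.
- by apply: (continuous_cvg _ (@continuous_expR R _)); exact: cvgN.
Unshelve. all: by end_near. Qed.

End limits.

(** * Calibration of the Gaussian level *)

Section gaussian_tail_limit.
Context {R : realType}.
Variables (L : nat -> R) (x : R).
Hypothesis Ly : L n @[n --> \oo] --> +oo.

(** Chosen so that [exp (ell) = exp (- x) sqrt (4 pi L)], which is the prefactor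
    [sqrt (2 pi) u exp (- x)] at [u = sqrt (2 L)]. Since [level^2 / 2 = L - ell + ell^2 / (4 L)],
    the tail at [level] is then asymptotic to [exp (- L - x)]. *)
Definition ell n : R := (ln (L n) + ln (4 * pi)) / 2 - x.
Definition level n : R := (2 * L n - ell n) / Num.sqrt (2 * L n).

Let L1 : \forall n \near \oo, 1 <= L n.
Proof. exact: cvgry_ge. Qed.

Lemma cvg_invL : (fun n => (L n)^-1) @ \oo --> (0 : R).
Proof. by apply: (cvg_comp _ _ Ly); exact: cvg_inv_pinfty. Qed.

Lemma cvg_inv_sqrtL : (fun n => (Num.sqrt (L n))^-1) @ \oo --> (0 : R).
Proof.
apply: (@cvg_near_eq R (fun n => Num.sqrt ((L n)^-1))).
  by near=> n; rewrite sqrtrV// (le_trans ler01)//; near: n.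
rewrite -[X in _ --> X](@sqrtr0 R).
exact: (continuous_cvg _ (@sqrt_continuous R _) cvg_invL).
Unshelve. all: by end_near. Qed.

(** A fourth root is needed: the square of the logarithm must still be negligible against [y]. *)
Lemma ln_le_sqrt2 (y : R) : 1 <= y -> 0 <= ln y <= 4 * Num.sqrt (Num.sqrt y).
Proof.
move=> y1; rewrite ln_ge0//=; have y0 : 0 < y by rewrite (lt_le_trans ltr01).
have s0 : 0 < Num.sqrt (Num.sqrt y) by rewrite !sqrtr_gt0.
have -> : ln y = ln (Num.sqrt (Num.sqrt y) ^+ 4).
  by rewrite (exprM _ 2 2) !sqr_sqrtr ?sqrtr_ge0 ?(ltW y0).
by rewrite lnXn// -[leLHS]mulr_natl ler_pM2l// ltW// ln_sublinear.
Qed.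

Lemma cvg_ell_sqr : (fun n => ell n ^+ 2 / L n) @ \oo --> (0 : R).
Proof.
pose k : R := ln (4 * pi) / 2 - x.
apply: (@cvg0_squeeze R _ (fun n => 8 * (Num.sqrt (L n))^-1 + 2 * k ^+ 2 * (L n)^-1)); last first.
  rewrite -[X in _ --> X]addr0; apply: cvgD.
    by rewrite -[X in _ --> X](mulr0 8); apply: cvgM; [exact: cvg_cst|exact: cvg_inv_sqrtL].
  by rewrite -[X in _ --> X](mulr0 (2 * k ^+ 2)); apply: cvgM; [exact: cvg_cst|exact: cvg_invL].
near=> n; have l1 : 1 <= L n by near: n.
have l0 : 0 < L n by rewrite (lt_le_trans ltr01).
have s0 : 0 < Num.sqrt (L n) by rewrite sqrtr_gt0.
rewrite ger0_norm ?divr_ge0 ?sqr_ge0 ?(ltW l0)// ler_pdivrMr//.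
have -> : (8 * (Num.sqrt (L n))^-1 + 2 * k ^+ 2 * (L n)^-1) * L n =
    8 * Num.sqrt (L n) + 2 * k ^+ 2.
  rewrite mulrDl -[2 * _ * _ * L n]mulrA mulVf ?gt_eqF// mulr1; congr (_ + _).
  rewrite -{2}[L n](sqr_sqrtr (ltW l0)); field; by rewrite gt_eqF.
have /andP[n0 n1] := ln_le_sqrt2 l1.
have h : ln (L n) ^+ 2 <= 16 * Num.sqrt (L n).
  have : ln (L n) ^+ 2 <= (4 * Num.sqrt (Num.sqrt (L n))) ^+ 2.
    by rewrite lerXn2r// nnegrE// (le_trans n0).
  by rewrite exprMn (sqr_sqrtr (sqrtr_ge0 _)) -natrX; apply.
have -> : ell n = ln (L n) / 2 + k by rewrite /ell /k; field.
have := sqr_ge0 (ln (L n) / 2 - k).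
by move: (ln (L n)) (Num.sqrt (L n)) h => a b; lra.
Unshelve. all: by end_near. Qed.

Lemma cvg_ell : (fun n => ell n / L n) @ \oo --> (0 : R).
Proof.
apply: (@cvg0_squeeze R _ (fun n => (L n)^-1 + ell n ^+ 2 / L n)); last first.
  by rewrite -[X in _ --> X]addr0; apply: cvgD; [exact: cvg_invL|exact: cvg_ell_sqr].
near=> n; have l0 : 0 < L n by rewrite (lt_le_trans ltr01)//; near: n.
rewrite normrM normfV (gtr0_norm l0) -[X in X + _]mul1r -mulrDl ler_pM2r ?invr_gt0//.
have := sqr_ge0 (`|ell n| - 1); have := normr_ge0 (ell n).
have <- : `|ell n| ^+ 2 = ell n ^+ 2 by rewrite real_normK ?num_real.
by move: (`|ell n|) => b; lra.
Unshelve. all: by end_near. Qed.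

Lemma cvg_level : (fun n => level n / Num.sqrt (2 * L n)) @ \oo --> (1 : R).
Proof.
apply: (@cvg_near_eq R (fun n => 1 - ell n / L n * 2^-1)); last first.
  rewrite -[X in _ --> X]subr0; apply: cvgB; first exact: cvg_cst.
  by rewrite -[X in _ --> X](mul0r 2^-1); apply: cvgM; [exact: cvg_ell|exact: cvg_cst].
near=> n; have l0 : 0 < L n by rewrite (lt_le_trans ltr01)//; near: n.
have s2 : Num.sqrt (2 * L n) ^+ 2 = 2 * L n by rewrite sqr_sqrtr// mulr_ge0// ltW.
have s0 : 0 < Num.sqrt (2 * L n) by rewrite sqrtr_gt0 mulr_gt0.
have -> : level n / Num.sqrt (2 * L n) = (2 * L n - ell n) / Num.sqrt (2 * L n) ^+ 2.
  by rewrite /level; field; rewrite gt_eqF.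
rewrite s2; field.
by rewrite gt_eqF.
Unshelve. all: by end_near. Qed.

(** A shift [a] of the level changes the tail by a factor of about [exp (- sqrt (2 L) a)], hence the
    hypothesis on [a]. *)
Lemma cvg_Qtail_level (a : nat -> R) :
  (fun n => Num.sqrt (2 * L n) * a n) @ \oo --> (0 : R) ->
  (fun n => expR (L n) * Qtail (level n + a n)) @ \oo --> expR (- x).
Proof.
move=> sa; pose s n := Num.sqrt (2 * L n).
pose rho n := (level n + a n) / s n.
(* The remainder in the exponent: [(level + a)^2 / 2 = L - ell + q]. *)
pose q n := ell n ^+ 2 / L n / 4 + level n / s n * (s n * a n) +
  (s n * a n) ^+ 2 * (L n)^-1 / 4.
have cinv2 : (fun n => (2 * L n)^-1) @ \oo --> (0 : R).
  apply: (@cvg_near_eq R (fun n => 2^-1 * (L n)^-1)).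
    by near=> n; rewrite invfM.
  by rewrite -[X in _ --> X](mulr0 2^-1); apply: cvgM; [exact: cvg_cst|exact: cvg_invL].
have s0 : \forall n \near \oo, 0 < s n.
  near=> n; rewrite sqrtr_gt0 mulr_gt0// (lt_le_trans ltr01)//; near: n; exact: L1.
have s2 : \forall n \near \oo, s n ^+ 2 = 2 * L n.
  near=> n; rewrite sqr_sqrtr// mulr_ge0// (le_trans ler01)//; near: n; exact: L1.
have crho : rho @ \oo --> (1 : R).
  apply: (@cvg_near_eq R (fun n => level n / s n + s n * a n * (2 * L n)^-1)); last first.
    rewrite -[X in _ --> X]addr0; apply: cvgD; first exact: cvg_level.
    by rewrite -[X in _ --> X](mulr0 0); exact: cvgM.
  near=> n; have sn0 : 0 < s n by near: n.
  have <- : s n ^+ 2 = 2 * L n by near: n.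
  by rewrite /rho; field; rewrite gt_eqF.
have cq : q @ \oo --> (0 : R).
  rewrite -[X in _ --> X]addr0 -[X in _ --> X + _]addr0; apply: cvgD; first apply: cvgD.
  - rewrite -[X in _ --> X](mul0r 4^-1); apply: cvgM; last exact: cvg_cst.
    exact: cvg_ell_sqr.
  - by rewrite -[X in _ --> X](mulr0 1); apply: cvgM => //; exact: cvg_level.
  - rewrite -[X in _ --> X](mul0r 4^-1); apply: cvgM; last exact: cvg_cst.
    rewrite -[X in _ --> X](mulr0 (0 ^+ 2)); apply: cvgM; last exact: cvg_invL.
    by rewrite expr2; apply: (@cvg_near_eq R (fun n => s n * a n * (s n * a n)));
      [near=> n; rewrite expr2|exact: cvgM].
pose K n := expR (- x) * expR (- q n) / rho n.
have cK : K @ \oo --> expR (- x).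
  have c1 : (fun n => expR (- q n)) @ \oo --> expR (- 0 : R).
    by apply: (continuous_cvg _ (@continuous_expR R _)); exact: cvgN.
  have c2 : (fun n => (rho n)^-1) @ \oo --> (1 : R)^-1 by apply: cvgV.
  apply: (cvg_limit_eq (cvgM (cvgM (cvg_cst (expR (- x))) c1) c2)).
  by rewrite oppr0 expR0 invr1 !mulr1.
have KE : \forall n \near \oo,
    K n = expR (L n) * (normal_pdf 0 1 (level n + a n) / (level n + a n)).
  near=> n; have sn0 : 0 < s n by near: n.
  have s2n : s n ^+ 2 = 2 * L n by near: n.
  have l0 : 0 < L n by rewrite (lt_le_trans ltr01)//; near: n; exact: L1.
  have rho0 : 0 < rho n by near: n; apply: (cvgr_gt 1) => //; exact: ltr01.
  have -> : level n + a n = rho n * s n by rewrite /rho divfK// gt_eqF.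
  rewrite normal_pdf01E.
  have e1 : L n + (- (rho n * s n) ^+ 2 / 2) = ell n - q n.
    have lE : level n * s n = 2 * L n - ell n by rewrite /level -/(s n) divfK// gt_eqF.
    have -> : rho n * s n = level n + a n by rewrite /rho divfK// gt_eqF.
    have lv : level n = (s n ^+ 2 - ell n) / s n by rewrite s2n.
    have LE : L n = s n ^+ 2 / 2 by rewrite s2n; field.
    rewrite /q lv LE; field; by rewrite gt_eqF.
  have e2 : expR (ell n) = expR (- x) * (s n * Num.sqrt (2 * pi)).
    have -> : s n * Num.sqrt (2 * pi) = Num.sqrt (expR (ln (L n) + ln (4 * pi))).
      rewrite expRD lnK ?posrE// lnK ?posrE ?mulr_gt0 ?pi_gt0// -sqrtrM ?mulr_ge0 ?(ltW l0)//.
      by congr Num.sqrt; ring.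
    have -> : expR (ln (L n) + ln (4 * pi)) = expR ((ln (L n) + ln (4 * pi)) / 2) ^+ 2.
      by rewrite expr2 -expRD; congr expR; field.
    by rewrite sqrtr_sqr ger0_norm ?expR_ge0// -expRD; congr expR; rewrite /ell; ring.
  rewrite mulrA [X in _ = X / _](_ : _ = expR (ell n - q n) / Num.sqrt (2 * pi)).
    rewrite expRD e2 /K; field.
    by rewrite !gt_eqF// sqrtr_gt0 mulr_gt0// pi_gt0.
  by rewrite -e1 expRD; ring.
apply: (@squeeze_cvgr _ _ _ _ (fun n => K n / (1 + rho n ^- 2 * (2 * L n)^-1)) K).
- near=> n; have sn0 : 0 < s n by near: n.
  have s2n : s n ^+ 2 = 2 * L n by near: n.
  have rho0 : 0 < rho n by near: n; apply: (cvgr_gt 1) => //; exact: ltr01.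
  have uE : level n + a n = rho n * s n by rewrite /rho divfK// gt_eqF.
  have u0 : 0 < level n + a n by rewrite uE mulr_gt0.
  have -> : K n = expR (L n) * (normal_pdf 0 1 (level n + a n) / (level n + a n)) by near: n.
  have -> : rho n ^- 2 / (2 * L n) = (level n + a n) ^- 2.
    by rewrite uE -s2n; field; rewrite !gt_eqF.
  have d0 : 0 < 1 + (level n + a n) ^- 2 by rewrite addr_gt0// invr_gt0 exprn_gt0.
  rewrite ler_pdivrMr// -mulrA !ler_pM2l ?expR_gt0// Qtail_le// andbT [leRHS]mulrC.
  exact: Qtail_ge.
- rewrite -[X in _ --> X]divr1; apply: cvgM => //; apply: cvgV => //.
  rewrite -[X in _ --> X]addr0; apply: cvgD; first exact: cvg_cst.
  rewrite -[X in _ --> X](mulr0 (1 ^- 2)); apply: cvgM => //; apply: cvgV.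
    by rewrite expr1n.
  by apply: (@cvg_near_eq R (fun n => rho n * rho n));
    [near=> n; rewrite expr2|rewrite expr2; exact: cvgM].
- exact: cK.
Unshelve. all: by end_near. Qed.

End gaussian_tail_limit.

Lemma Ex_hit_prob {R : realType} (n : nat) (r tau : R) :
  Ex (tprod stdN n) (hit_prob r (corr_hit tau)) =
  Pr (tprod stdN n \x tprod stdN n)%E
    [set z : n.-tuple R * n.-tuple R | corr_hit tau (z.1, lincomb r (sigr r) z.1 z.2)].
Proof.
have mD := measurable_corr_hit tau (n := n).
have mW : measurable_fun setT
    (fun z : n.-tuple R * n.-tuple R => (z.1, lincomb r (sigr r) z.1 z.2)).
  by apply: measurable_fun_pair => //; exact: measurable_lincomb.
rewrite (Pr_Ex_preimage (tprod stdN n \x tprod stdN n)%E mW mD) Ex_prod1//.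
exact: (bmf_step r (bmf_indic mD)).
Qed.

(** * Hit probabilities in the asymptotic regime *)

Section regime.
Context {R : realType}.
Variables (p : nat -> nat) (r : nat -> R) (C x : R).
Hypothesis r01 : forall n, 0 <= r n < 1.
Hypothesis p_infty : forall M : nat, \forall n \near \oo, (M <= p n)%N.
Hypothesis Lsmall :
  (fun n => ln ((p n)%:R) / (n%:R `^ (7%:R)^-1)) @ \oo --> (0 : R).
Hypothesis r1 : r @ \oo --> (1 : R).
Hypotheses (C0 : 0 < C) (rC : \forall n \near \oo, C / ln ((p n)%:R) <= 1 - r n).

Definition logp n : R := ln (p n)%:R.
Local Notation L := logp.
(** The scale with [eps^2 n = log p]: deviations of the squared norm by a multiple of [eps n] have
    probability a power of [1 / p]. *)
Definition eps n : R := Num.sqrt (L n) / Num.sqrt n%:R.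
Definition scaled_level n : R := level L x n / Num.sqrt n%:R.
(** The bound on the maximal correlation obtained by solving [c_n y - d_n <= x] for [y]; see
    [threshold_eq]. *)
Definition threshold n : R := r n + (1 - r n ^+ 2) * scaled_level n.
Local Notation gam n := (tprod (@stdN R) n).
Definition mean_hit n : R := Ex (gam n) (hit_prob (r n) (corr_hit (threshold n))).
Definition sqr_hit n : R :=
  Ex (gam n) (fun v => hit_prob (r n) (corr_hit (threshold n)) v ^+ 2).

Lemma logp_cvg : L n @[n --> \oo] --> +oo.
Proof.
apply/cvgryPge => A; near=> n.
have h : (Num.truncn (expR A)).+1%:R <= (p n)%:R :> R.
  by rewrite ler_nat; near: n; exact: p_infty.
have {}h : expR A <= (p n)%:R by rewrite (le_trans _ h)// ltW// truncnS_gt.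
by rewrite /L -[A]expRK ler_ln ?posrE ?expR_gt0// (lt_le_trans (expR_gt0 A)).
Unshelve. all: by end_near. Qed.

Lemma near_logp (A : R) : \forall n \near \oo, A <= L n.
Proof. exact: (cvgry_ge logp_cvg). Qed.

(** The form in which the growth condition on [log p] enters the later estimates. *)
Lemma near_logp7 : \forall n \near \oo, L n ^+ 7 <= n%:R.
Proof.
move: Lsmall => /cvgr0_norm_le /(_ 1 ltr01) h; near=> n.
have n0 : 0 < n%:R :> R by rewrite ltr0n; near: n; exact: nbhs_infty_gt.
have p0 : 0 < n%:R `^ 7%:R^-1 :> R by exact: powR_gt0.
have : `|L n / n%:R `^ 7%:R^-1| <= 1 by near: n.
rewrite ler_norml => /andP[_]; rewrite ler_pdivrMr// mul1r => h1.
have L0 : 0 <= L n by near: n; exact: near_logp.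
have : L n ^+ 7 <= (n%:R `^ 7%:R^-1) ^+ 7 by rewrite lerXn2r// nnegrE// ltW.
rewrite -[X in _ <= X -> _]powR_mulrn ?(ltW p0)// -powRrM mulVf ?pnatr_eq0// powRr1//.
Unshelve. all: by end_near. Qed.

Lemma near_n : \forall n \near \oo, (0 < n)%N.
Proof. exact: nbhs_infty_gt. Qed.

Lemma near_p : \forall n \near \oo, (1 < p n)%N.
Proof. exact: p_infty. Qed.

Lemma expR_logp n : (0 < p n)%N -> expR (L n) = (p n)%:R.
Proof. by move=> p0; rewrite /L lnK// posrE ltr0n. Qed.

Lemma near_n_logp : \forall n \near \oo, 10 ^+ 6 * L n <= n%:R.
Proof.
near=> n; have l7 : L n ^+ 7 <= n%:R by near: n; exact: near_logp7.
have l1 : 10 <= L n by near: n; exact: near_logp.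
have l0 : 0 <= L n by rewrite (le_trans _ l1).
apply: (le_trans _ l7); rewrite [L n ^+ 7]exprSr ler_wpM2r// lerXn2r// nnegrE.
by rewrite ler0n.
Unshelve. all: by end_near. Qed.

Lemma eps_sqrt n : (0 < n)%N -> eps n * Num.sqrt n%:R = Num.sqrt (L n).
Proof. by move=> n0; rewrite /eps divfK// gt_eqF// sqrtr_gt0 ltr0n. Qed.

Lemma eps_sqr n : (0 < n)%N -> 0 <= L n -> eps n ^+ 2 * n%:R = L n.
Proof.
move=> n0 l0; have := congr1 (fun t => t ^+ 2) (eps_sqrt n0).
by rewrite exprMn !sqr_sqrtr// ler0n.
Qed.

Lemma near_eps : \forall n \near \oo, 0 < eps n <= 1 / 1000.
Proof.
near=> n; have n0 : (0 < n)%N by near: n; exact: near_n.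
have l1 : 1 <= L n by near: n; exact: near_logp.
have l0 : 0 < L n by rewrite (lt_le_trans ltr01).
have nn : 0 < n%:R :> R by rewrite ltr0n.
have nl : 10 ^+ 6 * L n <= n%:R by near: n; exact: near_n_logp.
have e0 : 0 < eps n by rewrite divr_gt0 ?sqrtr_gt0.
rewrite e0/=; have -> : 1 / 1000 = (10 ^+ 3)^-1 :> R by field.
have t0 : 0 < (10 : R) by [].
move: (10 : R) t0 nl => t t0 nl.
rewrite -(ler_pXn2r (ltn0Sn 1)) ?nnegrE ?(ltW e0) ?invr_ge0 ?exprn_ge0 ?(ltW t0)//.
rewrite -(ler_pM2r nn) eps_sqr ?(ltW l0)//.
by rewrite exprVn -exprM ler_pdivlMl// exprn_gt0.
Unshelve. all: by end_near. Qed.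

(** This controls the relative error of the tail: shifting the scaled level by [eps^2] moves the
    level by [eps^2 sqrt n], and [sqrt (2 L) eps^2 sqrt n] is a multiple of [L eps]. *)
Lemma cvg_logp_eps : (fun n => L n * eps n) @ \oo --> (0 : R).
Proof.
apply: (@cvg0_squeeze R _ (fun n => (L n)^-1)); last exact: (cvg_invL logp_cvg).
near=> n; have n0 : (0 < n)%N by near: n; exact: near_n.
have l1 : 1 <= L n by near: n; exact: near_logp.
have l0 : 0 < L n by rewrite (lt_le_trans ltr01).
have nn : 0 < n%:R :> R by rewrite ltr0n.
have l7 : L n ^+ 7 <= n%:R by near: n; exact: near_logp7.
have e0 : 0 <= eps n by rewrite divr_ge0 ?sqrtr_ge0.
rewrite ger0_norm ?mulr_ge0 ?(ltW l0)// -[leRHS]mul1r ler_pdivlMr//.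
have h0 : 0 <= L n * eps n * L n by rewrite !mulr_ge0 ?(ltW l0).
rewrite -(ler_pXn2r (ltn0Sn 1)) ?nnegrE// expr1n -(ler_pM2r nn) mul1r.
have -> : (L n * eps n * L n) ^+ 2 * n%:R = L n ^+ 4 * (eps n ^+ 2 * n%:R) by ring.
rewrite eps_sqr ?(ltW l0)// -exprSr (le_trans _ l7)//.
exact: ler_weXn2l.
Unshelve. all: by end_near. Qed.

(** The ratio to [eps] tends to [sqrt 2], which lies strictly between 7/5 and 2. *)
Lemma near_scaled_level :
  \forall n \near \oo, 7 / 5 * eps n <= scaled_level n <= 2 * eps n.
Proof.
have cl := cvg_level x logp_cvg.
near=> n; have n0 : (0 < n)%N by near: n; exact: near_n.
have l1 : 1 <= L n by near: n; exact: near_logp.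
have l0 : 0 < L n by rewrite (lt_le_trans ltr01).
have nn : 0 < Num.sqrt n%:R :> R by rewrite sqrtr_gt0 ltr0n.
have c1 : 199 / 200 <= level L x n / Num.sqrt (2 * L n).
  by near: n; apply: (cvgr_ge 1 cl); lra.
have c2 : level L x n / Num.sqrt (2 * L n) <= 101 / 100.
  by near: n; apply: (cvgr_le 1 cl); lra.
have s0 : 0 < Num.sqrt (L n) by rewrite sqrtr_gt0.
have s20 : 0 < Num.sqrt (2 * L n) by rewrite sqrtr_gt0 mulr_gt0.
have e1 : 141 / 100 * Num.sqrt (L n) <= Num.sqrt (2 * L n).
  have h : 0 <= 141 / 100 * Num.sqrt (L n) by rewrite mulr_ge0 ?(ltW s0) ?divr_ge0.
  rewrite -[leLHS]ger0_norm// -sqrtr_sqr ler_sqrt ?mulr_ge0 ?(ltW l0)//.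
  rewrite exprMn sqr_sqrtr ?(ltW l0)// ler_pM2r//; lra.
have e2 : Num.sqrt (2 * L n) <= 3 / 2 * Num.sqrt (L n).
  have h : 0 <= 3 / 2 * Num.sqrt (L n) by rewrite mulr_ge0 ?(ltW s0) ?divr_ge0.
  rewrite -[leRHS]ger0_norm// -sqrtr_sqr ler_sqrt ?sqr_ge0//.
  rewrite exprMn sqr_sqrtr ?(ltW l0)// ler_pM2r//; lra.
rewrite ler_pdivlMr// in c1; rewrite ler_pdivrMr// in c2.
rewrite /scaled_level /eps !mulrA ler_pM2r ?invr_gt0// ler_pM2r ?invr_gt0//.
by apply/andP; split; move: c1 c2 e1 e2 s0; lra.
Unshelve. all: by end_near. Qed.

Lemma near_r : \forall n \near \oo, 9 / 10 <= r n < 1 /\ 1 - r n ^+ 2 <= 1 / 10000.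
Proof.
(* As [1 - r^2 <= 2 (1 - r)], closeness [1 / 20000] of [r] to 1 gives the bound [1 / 10000]. *)
near=> n; have h : 1 - 1 / 200 * (1 / 100) <= r n.
  by near: n; apply: (cvgr_ge 1 r1); lra.
have /andP[h0 h1] := r01 n.
have -> : 1 / 10000 = 1 / 100 * (1 / 100) :> R by field.
rewrite h1 andbT; move: (r n) h h0 h1 => s h h0 h1; split; first by lra.
by nra.
Unshelve. all: by end_near. Qed.

Lemma cvg_expR_Nlogp : (fun n => expR (- L n)) @ \oo --> (0 : R).
Proof.
apply: (@cvg0_squeeze R _ (fun n => (L n)^-1)); last exact: (cvg_invL logp_cvg).
near=> n; have l1 : 1 <= L n by near: n; exact: near_logp.
have l0 : 0 < L n by rewrite (lt_le_trans ltr01).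
rewrite ger0_norm ?expR_ge0// expRN lef_pV2 ?posrE ?expR_gt0//.
by rewrite (le_trans _ (expR_ge1Dx _))// lerDr.
Unshelve. all: by end_near. Qed.

Lemma cvg_Qtail_shift (k : R) : (fun n => (p n)%:R *
    Qtail ((scaled_level n + k * eps n ^+ 2) * Num.sqrt n%:R)) @ \oo --> expR (- x).
Proof.
pose a n := k * eps n ^+ 2 * Num.sqrt n%:R.
have ca : (fun n => Num.sqrt (2 * L n) * a n) @ \oo --> (0 : R).
  apply: (@cvg_near_eq R (fun n => Num.sqrt 2 * k * (L n * eps n))); last first.
    apply: (cvg_limit_eq (cvgM (cvg_cst (Num.sqrt 2 * k)) cvg_logp_eps)).
    by rewrite mulr0.
  near=> n; have n0 : (0 < n)%N by near: n; exact: near_n.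
  have l0 : 0 <= L n by near: n; exact: near_logp.
  have -> : a n = k * eps n * Num.sqrt (L n) by rewrite -(eps_sqrt n0) /a; ring.
  rewrite sqrtrM// -{1}(sqr_sqrtr l0); ring.
apply: cvg_near_eq (cvg_Qtail_level logp_cvg ca).
near=> n; have n0 : (0 < n)%N by near: n; exact: near_n.
have p1 : (1 < p n)%N by near: n; exact: near_p.
have nn : 0 < Num.sqrt n%:R :> R by rewrite sqrtr_gt0 ltr0n.
rewrite expR_logp ?(ltnW p1)//; congr (_ * Qtail _).
by rewrite /scaled_level mulrDl divfK// gt_eqF.
Unshelve. all: by end_near. Qed.

Lemma near_expR_n : \forall n \near \oo,
  (p n)%:R ^+ 2 * expR (- (n%:R / 800)) <= expR (- L n).
Proof.
near=> n; have p1 : (1 < p n)%N by near: n; exact: near_p.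
have l0 : 0 <= L n by near: n; exact: near_logp.
have nl : 10 ^+ 6 * L n <= n%:R by near: n; exact: near_n_logp.
rewrite -expR_logp ?(ltnW p1)// -expRM_natl -expRD ler_expR.
(* 2400 is three times 800: two powers of [p] are absorbed and a factor [1 / p] remains. *)
have h : 2400 * L n <= n%:R.
  by rewrite (le_trans _ nl)// ler_wpM2r//; lra.
by move: h; lra.
Unshelve. all: by end_near. Qed.

(** The two tails, shifted by [50 eps^2] in either direction, have the same limit, and the
    exceptional events, even multiplied by [p], are of order [1 / p]. *)
Lemma cvg_mean_hit : (fun n => (p n)%:R * mean_hit n) @ \oo --> expR (- x).
Proof.
pose lo n := (p n)%:R * Qtail ((scaled_level n + 50 * eps n ^+ 2) * Num.sqrt n%:R) -
  4 * expR (- L n).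
pose up n := (p n)%:R * Qtail ((scaled_level n + (- 50) * eps n ^+ 2) * Num.sqrt n%:R) +
  8 * expR (- L n).
apply: (@squeeze_cvgr _ _ _ _ lo up); last 2 first.
- have h : (fun n => 4 * expR (- L n)) @ \oo --> (0 : R).
    by apply: (cvg_limit_eq (cvgM (cvg_cst (4 : R)) cvg_expR_Nlogp)); rewrite mulr0.
  by apply: (cvg_limit_eq (cvgB (cvg_Qtail_shift 50) h)); rewrite subr0.
- have h : (fun n => 8 * expR (- L n)) @ \oo --> (0 : R).
    by apply: (cvg_limit_eq (cvgM (cvg_cst (8 : R)) cvg_expR_Nlogp)); rewrite mulr0.
  by apply: (cvg_limit_eq (cvgD (cvg_Qtail_shift (- 50)) h)); rewrite addr0.
near=> n; have n0 : (0 < n)%N by near: n; exact: near_n.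
have p1 : (1 < p n)%N by near: n; exact: near_p.
have l0 : 0 <= L n by near: n; exact: near_logp.
have e01 : 0 < eps n <= 1 / 1000 by near: n; exact: near_eps.
have /andP[v1 v2] : 7 / 5 * eps n <= scaled_level n <= 2 * eps n.
  by near: n; exact: near_scaled_level.
have eE : expR (- (2 * (eps n ^+ 2 * n%:R))) = expR (- L n) / (p n)%:R.
  rewrite eps_sqr// -expR_logp ?(ltnW p1)// -expRN -expRD; congr expR; ring.
have p0 : 0 < (p n)%:R :> R by rewrite ltr0n ltnW.
have p1' : 1 <= (p n)%:R :> R by rewrite ler1n ltnW.
have en : (p n)%:R ^+ 2 * expR (- (n%:R / 800)) <= expR (- L n).
  by near: n; exact: near_expR_n.
have en' : (p n)%:R * expR (- (n%:R / 800)) <= expR (- L n).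
  rewrite (le_trans _ en)// ler_wpM2r ?expR_ge0// expr2 ler_peMr// ltW.
have e50 : 50 * eps n ^+ 2 <= scaled_level n.
  apply: le_trans v1; case/andP: e01 => e0 e1; rewrite expr2.
  have : 50 * (eps n * eps n) <= 50 * (eps n * (1 / 1000)).
    by rewrite ler_pM2l// ler_pM2l.
  by move: e0; lra.
rewrite /mean_hit Ex_hit_prob; apply/andP; split.
  have v0 : 0 <= scaled_level n <= 2 * eps n.
    rewrite v2 andbT (le_trans _ v1)// mulr_ge0//; case/andP: e01 => /ltW //.
  have := step_hit_lower n0 e01 (r01 n) (erefl (threshold n)) v0.
  rewrite eE -(ler_pM2l p0) mulrBr => /(le_trans _); apply.
  rewrite /lo lerB// le_eqVlt; apply/orP; left; apply/eqP; field.
  by rewrite gt_eqF.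
have v0 : 50 * eps n ^+ 2 <= scaled_level n <= 2 * eps n by rewrite e50.
have := step_hit_upper n0 e01 (r01 n) (erefl (threshold n)) v0.
rewrite eE -(ler_pM2l p0) => /le_trans; apply.
rewrite /up mulNr mulrDr lerD2l mulrDr.
have -> : (p n)%:R * (4 * (expR (- L n) / (p n)%:R)) = 4 * expR (- L n).
  by field; rewrite gt_eqF.
by move: en'; lra.
Unshelve. all: by end_near. Qed.

(** From [r <= exp (- C / L)] this many steps give [r^H <= p^(-2)], small even after summation over
    [p] positions. *)
Definition mixing_time n : nat := (Num.truncn (2 * L n ^+ 2 / C)).+1.

Lemma near_mixing : \forall n \near \oo, r n ^+ mixing_time n <= expR (- (2 * L n)).
Proof.
near=> n; have l1 : 1 <= L n by near: n; exact: near_logp.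
have l0 : 0 < L n by rewrite (lt_le_trans ltr01).
have rn : C / L n <= 1 - r n by near: n.
have /andP[r0 _] := r01 n.
have re : r n <= expR (- (C / L n)).
  by apply: le_trans (expR_ge1Dx _); rewrite lerBrDr addrC -lerBrDr.
apply: (@le_trans _ _ (expR (- (C / L n)) ^+ mixing_time n)).
  by rewrite lerXn2r// nnegrE expR_ge0.
rewrite -expRM_natl ler_expR mulrN lerN2.
have h : 2 * L n ^+ 2 / C <= (mixing_time n)%:R by rewrite ltW// truncnS_gt.
have cl : 0 < C / L n by rewrite divr_gt0.
apply: (@le_trans _ _ (2 * L n ^+ 2 / C * (C / L n))); last by rewrite ler_pM2r.
rewrite le_eqVlt; apply/orP; left; apply/eqP; field.
by rewrite !gt_eqF.
Unshelve. all: by end_near. Qed.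

(** The exponent 1/32 is that of an innovation with squared norm below [n (1 - eps / 2)], namely
    [(1/2)^2 / 8]. The Gaussian tail at [sqrt L] is smaller, and heavy points leave [p^(-1/5)] after
    multiplication by [p]. *)
Lemma near_sqr_hit : \forall n \near \oo,
  (p n)%:R * sqr_hit n <= expR (- (L n / 32)) * (3 * ((p n)%:R * mean_hit n) + 1).
Proof.
near=> n; have n0 : (0 < n)%N by near: n; exact: near_n.
have p1 : (1 < p n)%N by near: n; exact: near_p.
have l1 : 1 <= L n by near: n; exact: near_logp.
have l0 : 0 < L n by rewrite (lt_le_trans ltr01).
have e01 : 0 < eps n <= 1 / 1000 by near: n; exact: near_eps.
have v12 : 7 / 5 * eps n <= scaled_level n <= 2 * eps n.
  by near: n; exact: near_scaled_level.
have [_ r99] : 9 / 10 <= r n < 1 /\ 1 - r n ^+ 2 <= 1 / 10000.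
  by near: n; exact: near_r.
have p0 : 0 < (p n)%:R :> R by rewrite ltr0n ltnW.
have := Ex_hit_sqr_le n0 e01 (r01 n) (erefl (threshold n)) r99 v12.
rewrite eps_sqrt// eps_sqr ?(ltW l0)// -/(sqr_hit n) -/(mean_hit n).
have s1 : 1 <= Num.sqrt (L n) by rewrite -[leLHS]sqrtr1 ler_sqrt// ltW.
have Q1 : Qtail (Num.sqrt (L n)) <= expR (- (L n / 32)).
  apply: (le_trans (Qtail_le (lt_le_trans ltr01 s1))).
  rewrite ler_pdivrMr ?(lt_le_trans ltr01 s1)//.
  apply: (@le_trans _ _ (expR (- (L n / 32)) * 1)); last first.
    by rewrite ler_wpM2l// expR_ge0.
  rewrite mulr1 normal_pdf01E sqr_sqrtr ?(ltW l0)//.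
  have s2p : 1 <= Num.sqrt (2 * pi) :> R.
    have pi1 : 1 <= 2 * pi :> R by rewrite mulr_ege1 ?ler1n// (le_trans _ (@pi_ge2 R))// ler1n.
    by rewrite -[leLHS]sqrtr1 ler_sqrt// (le_trans ler01 pi1).
  apply: (@le_trans _ _ (1 * expR (- L n / 2))).
    by rewrite ler_wpM2r ?expR_ge0// invf_le1// (lt_le_trans ltr01 s2p).
  by rewrite mul1r ler_expR; move: l0; lra.
move=> h; have {}h := le_trans (ler_wpM2l (ltW p0) h) (lexx _).
apply: (le_trans h); rewrite mulrDr mulrDr mulr1; apply: lerD.
  have b0 : 0 <= mean_hit n.
    apply: Ex_ge0 => v; have := hit_prob_itv (r n) (measurable_corr_hit (threshold n) (n := n)) v.
    by case/andP.
  rewrite mulrCA mulrA [leRHS]mulrCA [leRHS]mulrA [leRHS]mulrA.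
  have -> : 3 * expR (- (L n / 32)) * (p n)%:R * mean_hit n =
    3 * expR (- (L n / 32)) * ((p n)%:R * mean_hit n) by rewrite mulrA.
  rewrite -[leLHS]mulrA ler_wpM2r ?mulr_ge0 ?(ltW p0)//.
  by move: Q1; move: (Qtail _) (expR _) => q w; lra.
rewrite -expR_logp ?(ltnW p1)// -expRD ler_expR; move: l0; lra.
Unshelve. all: by end_near. Qed.

End regime.

Section regime_limits.
Context {R : realType}.
Variables (p : nat -> nat) (r : nat -> R) (C x : R).
Hypothesis r01 : forall n, 0 <= r n < 1.
Hypothesis p_infty : forall M : nat, \forall n \near \oo, (M <= p n)%N.
Hypothesis Lsmall :
  (fun n => ln ((p n)%:R) / (n%:R `^ (7%:R)^-1)) @ \oo --> (0 : R).
Hypothesis r1 : r @ \oo --> (1 : R).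
Hypotheses (C0 : 0 < C) (rC : \forall n \near \oo, C / ln ((p n)%:R) <= 1 - r n).
Local Notation L := (@logp R p).
Local Notation b := (mean_hit p r x).
Local Notation f2 := (sqr_hit p r x).
Local Notation H := (mixing_time p C).

Lemma mean_hit_ge0 n : 0 <= b n.
Proof.
apply: Ex_ge0 => v.
by have /andP[] := hit_prob_itv (r n) (measurable_corr_hit (threshold p r x n) (n := n)) v.
Qed.

(** The factor [L^2] is the order of the mixing time. The cubic term of the exponential series beats
    it and leaves [1 / L]. *)
Lemma cvg_logp_sqr_expR : (fun n => L n ^+ 2 * expR (- (L n / 32))) @ \oo --> (0 : R).
Proof.
pose k : R := 3`!%:R * 32 ^+ 3.
apply: (@cvg0_squeeze R _ (fun n => k * (L n)^-1)); last first.
  apply: (cvg_limit_eq (cvgM (cvg_cst k) (cvg_invL (logp_cvg p_infty)))).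
  by rewrite mulr0.
near=> n; have l1 : 1 <= L n by near: n; exact: near_logp.
have l0 : 0 < L n by rewrite (lt_le_trans ltr01).
rewrite ger0_norm; last by rewrite mulr_ge0 ?sqr_ge0 ?expR_ge0.
have y0 : 0 <= L n / 32 by rewrite divr_ge0// ltW.
have h : (L n / 32) ^+ 3 / 3`!%:R <= expR (L n / 32).
  by rewrite (le_trans _ (expR_ge1Dxn 2 y0))// lerDr.
rewrite expRN ler_pdivrMr ?expR_gt0//.
have k0 : 0 <= k * (L n)^-1 by rewrite !mulr_ge0 ?invr_ge0 ?exprn_ge0 ?(ltW l0).
apply: (le_trans _ (ler_wpM2l k0 h)).
rewrite le_eqVlt; apply/orP; left; apply/eqP; rewrite /k; field.
by apply/andP; split; [rewrite pnatr_eq0 -lt0n fact_gt0|rewrite gt_eqF].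
Unshelve. all: by end_near. Qed.

Lemma cvg_mixing_error : (fun n => (p n)%:R * (r n ^+ H n + 2 * (H n)%:R * f2 n)) @ \oo
  --> (0 : R).
Proof.
have cb := cvg_mean_hit (x := x) r01 p_infty Lsmall.
apply: (@cvg0_squeeze R _ (fun n => expR (- L n) +
  (4 / C + 2) * (L n ^+ 2 * expR (- (L n / 32))) * (3 * ((p n)%:R * b n) + 1))); last first.
  have c3 : (fun n => 3 * ((p n)%:R * b n) + 1) @ \oo --> (3 * expR (- x) + 1 : R).
    by apply: cvgD; [apply: cvgM => //; exact: cvg_cst|exact: cvg_cst].
  have c2 : (fun n => (4 / C + 2) * (L n ^+ 2 * expR (- (L n / 32)))) @ \oo -->
      ((4 / C + 2) * 0 : R).
    by apply: cvgM; [exact: cvg_cst|exact: cvg_logp_sqr_expR].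
  apply: (cvg_limit_eq (cvgD (cvg_expR_Nlogp p_infty) (cvgM c2 c3))).
  by rewrite mulr0 mul0r addr0.
near=> n; have l1 : 1 <= L n by near: n; exact: near_logp.
have l0 : 0 < L n by rewrite (lt_le_trans ltr01).
have p1 : (1 < p n)%N by near: n; exact: near_p.
have p0 : 0 < (p n)%:R :> R by rewrite ltr0n ltnW.
have f0 : 0 <= f2 n by apply: Ex_ge0 => v; exact: sqr_ge0.
have b0 := mean_hit_ge0 n.
have rH : r n ^+ H n <= expR (- (2 * L n)) by near: n; exact: near_mixing.
have r0 : 0 <= r n ^+ H n by rewrite exprn_ge0//; case/andP: (r01 n).
have fb : (p n)%:R * f2 n <= expR (- (L n / 32)) * (3 * ((p n)%:R * b n) + 1).
  by near: n; exact: near_sqr_hit.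
rewrite ger0_norm; last by rewrite mulr_ge0// addr_ge0// !mulr_ge0.
rewrite mulrDr; apply: lerD.
  apply: (le_trans (ler_wpM2l (ltW p0) rH)).
  rewrite -expR_logp ?(ltnW p1)// -expRD ler_expR.
  by rewrite le_eqVlt; apply/orP; left; apply/eqP; ring.
have Hle : 2 * (H n)%:R <= (4 / C + 2) * L n ^+ 2.
  have h : (Num.truncn (2 * L n ^+ 2 / C))%:R <= 2 * L n ^+ 2 / C.
    by rewrite truncn_le divr_ge0 ?(ltW C0)// mulr_ge0 ?sqr_ge0.
  have l2 : 1 <= L n ^+ 2 by rewrite exprn_ege1.
  have -> : (H n)%:R = (Num.truncn (2 * L n ^+ 2 / C))%:R + 1 :> R by rewrite natr1.
  have -> : (4 / C + 2) * L n ^+ 2 = 2 * (2 * L n ^+ 2 / C + L n ^+ 2).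
    by field; rewrite gt_eqF.
  by rewrite ler_pM2l// lerD.
have -> : (p n)%:R * (2 * (H n)%:R * f2 n) = 2 * (H n)%:R * ((p n)%:R * f2 n) by ring.
have -> : (4 / C + 2) * (L n ^+ 2 * expR (- (L n / 32))) * (3 * ((p n)%:R * b n) + 1) =
  (4 / C + 2) * L n ^+ 2 * (expR (- (L n / 32)) * (3 * ((p n)%:R * b n) + 1)) by ring.
apply: ler_pM => //; first by rewrite mulr_ge0.
Unshelve. all: by end_near. Qed.

Lemma cvg_geometric : (fun n => (1 - b n) ^+ (p n).-1) @ \oo --> expR (- expR (- x)).
Proof.
have cb := cvg_mean_hit (x := x) r01 p_infty Lsmall.
have b0 : b @ \oo --> (0 : R).
  apply: (@cvg_near_eq R (fun n => (p n)%:R * b n * expR (- L n))); last first.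
    apply: (cvg_limit_eq (cvgM cb (cvg_expR_Nlogp p_infty))).
    by rewrite mulr0.
  near=> n; have p1 : (1 < p n)%N by near: n; exact: near_p.
  have p0 : 0 < (p n)%:R :> R by rewrite ltr0n ltnW.
  rewrite expRN expR_logp ?(ltnW p1)//; field.
  by rewrite gt_eqF.
apply: cvg_exp_poisson => //; first by near=> n; exact: mean_hit_ge0.
(* The chain makes [p - 1] steps, not [p]; the missing [b] tends to 0. *)
apply: (@cvg_near_eq R (fun n => (p n)%:R * b n - b n)); last first.
  by apply: (cvg_limit_eq (cvgB cb b0)); rewrite subr0.
near=> n; have p1 : (1 < p n)%N by near: n; exact: near_p.
by rewrite -[in LHS](prednK (ltnW p1)) -natr1 mulrDl mul1r addrK.
Unshelve. all: by end_near. Qed.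

Lemma cvg_no_hit (q : nat -> R) : (\forall n \near \oo,
  `|q n - (1 - b n) ^+ (p n).-1| <= (p n)%:R ^+ 2 * (8 * expR (- (n%:R / 800))) +
    (p n)%:R * (r n ^+ H n + 2 * (H n)%:R * f2 n)) ->
  q @ \oo --> expR (- expR (- x)).
Proof.
move=> hq.
have c0 : (fun n => q n - (1 - b n) ^+ (p n).-1) @ \oo --> (0 : R).
  apply: (@cvg0_squeeze R _ (fun n => 8 * expR (- L n) +
    (p n)%:R * (r n ^+ H n + 2 * (H n)%:R * f2 n))); last first.
    have c8 : (fun n => 8 * expR (- L n)) @ \oo --> (8 * 0 : R).
      by apply: cvgM; [exact: cvg_cst|exact: cvg_expR_Nlogp].
    by apply: (cvg_limit_eq (cvgD c8 cvg_mixing_error)); rewrite mulr0 addr0.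
  near=> n; have hn : `|q n - (1 - b n) ^+ (p n).-1| <=
    (p n)%:R ^+ 2 * (8 * expR (- (n%:R / 800))) +
    (p n)%:R * (r n ^+ H n + 2 * (H n)%:R * f2 n) by near: n.
  apply: (le_trans hn); rewrite lerD2r mulrCA ler_pM2l//.
  by near: n; exact: near_expR_n.
apply: (@cvg_near_eq R (fun n => q n - (1 - b n) ^+ (p n).-1 + (1 - b n) ^+ (p n).-1)).
  by near=> n; rewrite subrK.
by apply: (cvg_limit_eq (cvgD c0 cvg_geometric)); rewrite add0r.
Unshelve. all: by end_near. Qed.

End regime_limits.

(** * The limit law of the maximum *)

Lemma threshold_eq {R : realType} (p : nat -> nat) (r : nat -> R) (x y : R) (n : nat) :
  (0 < n)%N -> 0 < @logp R p n -> 0 <= r n < 1 ->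
  (c_seq n (p n) (r n) * y - d_seq n (p n) (r n) <= x) = (y <= threshold p r x n).
Proof.
move=> n0 l0 /andP[r0 r1].
have nn : 0 < n%:R :> R by rewrite ltr0n.
have s0 : 0 < Num.sqrt (2 * logp p n : R) by rewrite sqrtr_gt0 mulr_gt0.
have sn0 : 0 < Num.sqrt n%:R :> R by rewrite sqrtr_gt0.
have s2 : 0 < 1 - r n ^+ 2 by rewrite subr_gt0 exprn_ilt1.
have E : Num.sqrt (2 * n%:R * ln (p n)%:R) = Num.sqrt n%:R * Num.sqrt (2 * logp p n : R).
  by rewrite -sqrtrM ?(ltW nn)//; congr Num.sqrt; rewrite /logp; ring.
have c0 : 0 < c_seq n (p n) (r n) by rewrite /c_seq E divr_gt0// mulr_gt0.
rewrite lerBlDr mulrC -ler_pdivlMr//; congr (_ <= _).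
apply: (mulIf (lt0r_neq0 c0)); rewrite divfK ?lt0r_neq0//.
rewrite /c_seq /d_seq /threshold /scaled_level /level /ell E -/(logp p n).
move: (ln (logp p n)) (ln (4 * pi)) => a c.
(* Replacing [2 log p] by the square of its root makes the identity rational in the two roots. *)
have l2 : 2 * logp p n = Num.sqrt (2 * logp p n : R) ^+ 2 by rewrite sqr_sqrtr// mulr_ge0// ltW.
move: (Num.sqrt (2 * logp p n)) (Num.sqrt n%:R) s0 sn0 l2 => s sn s0 sn0 l2.
rewrite l2; field; by rewrite !gt_eqF.
Qed.

Theorem theorem3 (R : realType) (d : measure_display) (T : measurableType d)
  (P : probability T R) (p : nat -> nat) (r : nat -> R)
  (X : nat -> nat -> nat -> T -> R) :
  (forall n, 0 <= r n < 1) ->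
  (forall M : nat, \forall n \near \oo, (M <= p n)%N) ->
  (fun n => ln ((p n)%:R) / (n%:R `^ (7%:R)^-1)) @ \oo --> (0 : R) ->
  r @ \oo --> (1 : R) ->
  (exists C : R, 0 < C /\ \forall n \near \oo, C / ln ((p n)%:R) <= 1 - r n) ->
  (forall n, indep_vectors P n (p n) (X n) /\
             forall k, (k < n)%N -> is_Np_AR P (p n) (r n) (X n k)) ->
  forall x : R,
    (fun n => P [set w | c_seq n (p n) (r n) * Lmax n (p n) (X n) w
                          - d_seq n (p n) (r n) <= x])
      @ \oo --> (expR (- expR (- x)))%:E.
Proof.
move=> r01 p_infty Lsmall r1 [C [C0 rC]] HX x.
pose All n := [set w | forall i j, (i < j)%N -> (j < p n)%N ->
  ~ corr_hit (threshold p r x n) (col_of n (X n) i w, col_of n (X n) j w)].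
(* In particular the threshold eventually lies in [[r, 1]], as the bounds on distant pairs
   require. *)
have good : \forall n \near \oo, [/\ (0 < n)%N, (1 < p n)%N, 0 < @logp R p n,
    9 / 10 <= r n < 1 & r n <= threshold p r x n <= 1].
  near=> n; have n0 : (0 < n)%N by near: n; exact: near_n.
  have p1 : (1 < p n)%N by near: n; exact: near_p.
  have l1 : 1 <= @logp R p n by near: n; exact: near_logp.
  have /andP[e0 e1] : 0 < (eps p n : R) <= 1 / 1000 by near: n; exact: near_eps.
  have /andP[v1 v2] : 7 / 5 * eps p n <= scaled_level p x n <= 2 * eps p n.
    by near: n; exact: near_scaled_level.
  have [r9 _] : 9 / 10 <= r n < 1 /\ 1 - r n ^+ 2 <= 1 / 10000.
    by near: n; exact: near_r.
  split => //; first by rewrite (lt_le_trans ltr01).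
  apply: (tau_itv e1 _ (r01 n) (erefl _)); rewrite v2 andbT (le_trans _ v1)//.
  by rewrite mulr_ge0// ltW.
(* The two events are equal, not merely close, so only the probability of the event without hits has
   to be estimated. *)
have evE : \forall n \near \oo, [set w | c_seq n (p n) (r n) * Lmax n (p n) (X n) w
    - d_seq n (p n) (r n) <= x] = All n.
  near=> n; have [n0 p1 l0 /andP[r9 _] /andP[rt t1]] : [/\ (0 < n)%N, (1 < p n)%N,
    0 < @logp R p n, 9 / 10 <= r n < 1 & r n <= threshold p r x n <= 1] by near: n.
  have t0 : 0 <= threshold p r x n by rewrite (le_trans _ rt)//; case/andP: (r01 n).
  apply/seteqP; split => w /=; rewrite threshold_eq//.
    by move=> /(Lmax_le _ _ _ p1 t0).
  by move=> h; apply/(Lmax_le _ _ _ p1 t0).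
apply: cvg_EFin.
  near=> n; have -> : [set w | c_seq n (p n) (r n) * Lmax n (p n) (X n) w
    - d_seq n (p n) (r n) <= x] = All n by near: n.
  by apply: fin_num_measure; apply: measurable_no_hit => k kn; exact: (HX n).2.
apply: (@cvg_near_eq R (fun n => Pr P (All n))).
  near=> n => /=; have -> // : [set w | c_seq n (p n) (r n) * Lmax n (p n) (X n) w
    - d_seq n (p n) (r n) <= x] = All n by near: n.
apply: (cvg_no_hit r01 p_infty Lsmall r1 C0 rC).
near=> n; have [n0 p1 l0 r9 rt] : [/\ (0 < n)%N, (1 < p n)%N,
  0 < @logp R p n, 9 / 10 <= r n < 1 & r n <= threshold p r x n <= 1] by near: n.
exact: (Pr_no_hit_approx (HX n).1 (HX n).2 n0 p1 r9 rt).
Unshelve. all: by end_near. Qed.
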